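(* Assume that there exist $v\in H^k_{\rm per}(0,T)$ and $z\in H^k(\mathbb R)$ ($\mathbb F^m$-valued) such that $v$ and $z+v$ are solutions of $Au+\mathcal N(u,\cdot)=0$, and that $z+v$ is nondegenerate. Then there exist $C>0$ and $N\in\mathbb N$ such that for each $n\in\mathbb N$ with $n\ge N$ there exists an $nT$-periodic solution $u_n\in H^k_{\rm per}(0,nT)$ of $Au+\mathcal N(u,\cdot)=0$ given by $$u_n(x)=\chi_n(x)z(x)+v(x)+a_n(x),\qquad x\in[-\tfrac n2T,\tfrac n2T),$$ with $a_n\in H^k_{\rm per}(0,nT)$ satisfying $$\|a_n\|_{H^k_{\rm per}(0,nT)}\le C\|z\|_{H^k(\mathbb R\setminus(-\frac n6T,\frac n6T))}.$$ In particular, $\|a_n\|_{H^k_{\rm per}(0,nT)}\to0$ as $n\to\infty$.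
   Context: Let $k,m\in\mathbb N$, $T>0$, $\mathbb F\in\{\mathbb R,\mathbb C\}$. Let $\alpha_1,\dots,\alpha_k\in C(\mathbb R,\mathbb F^{m\times m})$ be $T$-periodic with $\alpha_k(x)$ invertible for every $x\in\mathbb R$, and put $Au=\alpha_k\partial_x^ku+\dots+\alpha_1\partial_xu$. Let $\mathcal N:\mathbb F^m\times\mathbb R\to\mathbb F^m$ be continuous, twice continuously differentiable in its first argument (with $\partial_u\mathcal N,\partial_u^2\mathcal N$ continuous on $\mathbb F^m\times\mathbb R$) and $T$-periodic in its second argument. For $\underline u\in L^\infty(\mathbb R,\mathbb F^m)$, $\mathcal L(\underline u):D(\mathcal L(\underline u))=H^k(\mathbb R)\subset L^2(\mathbb R)\to L^2(\mathbb R)$ is $\mathcal L(\underline u)\varphi=A\varphi+\partial_u\mathcal N(\underline u,\cdot)\varphi$. $\underline u$ is called nondegenerate if $\mathcal L(\underline u)$ is invertible. $H^k_{\rm per}(0,L)$ is the space of $L$-periodic functions on $\mathbb R$ that are locally $H^k$, with the $H^k(0,L)$-norm. For each (sufficiently large) $n\in\mathbb N$, $\chi_n:\mathbb R\to[0,1]$ is a fixed smooth $nT$-periodic cut-off function with $\|\chi_n\|_{W^{k,\infty}}\le1$ (norm: the maximum of the sup norms of the derivatives of order $0,\dots,k$), $\chi_n=1$ on $[-\frac n6T,\frac n6T]$ and $\chi_n=0$ on $[-\frac n2T,-\frac n3T]\cup[\frac n3T,\frac n2T]$. *)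

(* Defs.v *)
From HB Require Import structures.
From mathcomp Require Import all_boot all_order all_algebra.
From mathcomp Require Import all_classical all_reals all_analysis.
From mathcomp Require Import complex.
Set Implicit Arguments.
Unset Strict Implicit.
Unset Printing Implicit Defensive.
Import Order.TTheory GRing.Theory Num.Theory.
Import numFieldNormedType.Exports.
Local Open Scope classical_set_scope.
Local Open Scope ring_scope.

Variant scalars := RealScalars | ComplexScalars.

Definition scalar_field (R : realType) (s : scalars) : numFieldType :=
  match s with
  | RealScalars => R
  | ComplexScalars => complex R
  end.

Definition real_part (R : realType) (s : scalars) : scalar_field R s -> R :=
  match s return scalar_field R s -> R with
  | RealScalars => fun x => x
  | ComplexScalars => fun z : complex R => complex.Re z
  end.

Definition imag_part (R : realType) (s : scalars) : scalar_field R s -> R :=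
  match s return scalar_field R s -> R with
  | RealScalars => fun=> 0
  | ComplexScalars => fun z : complex R => complex.Im z
  end.

Definition of_real (R : realType) (s : scalars) : R -> scalar_field R s :=
  match s return R -> scalar_field R s with
  | RealScalars => fun x => x
  | ComplexScalars => fun x => Complex x 0
  end.

Section SobolevSpaces.
Context {R : realType} {s : scalars} {m : nat}.
Local Notation F := (scalar_field R s).
Local Notation mu := (@lebesgue_measure R).
Implicit Types (f g u : R -> 'cV[F]_m) (D : set R) (phi : R -> R).

(* A function with values in F^m is measured and integrated through its 2m
   real coordinates (over the reals, the imaginary ones vanish). *)
Definition coordinate (im : bool) (i : 'I_m) (w : 'cV[F]_m) : R :=
  if im then imag_part (w i ord0) else real_part (w i ord0).

(* The library norm on 'cV[F]_m is F-valued and is the maximum norm. *)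
Definition euclidean_norm (w : 'cV[F]_m) : R :=
  Num.sqrt (\sum_(i < m) \sum_(im : bool) coordinate im i w ^+ 2).

Definition L2 D f : Prop :=
  forall im i, (coordinate im i \o f) \_ D \in Lfun mu 2%:E.

Definition L2_norm D f : \bar R :=
  Lnorm mu 2%:E (EFin \o ((euclidean_norm \o f) \_ D)).

Definition smooth phi : Prop := forall n x, derivable (derive1n n phi) x 1.

Definition test_function phi : Prop :=
  smooth phi /\ compact (closure [set x | phi x != 0]).

Definition is_weak_derivative (j : nat) f g : Prop :=
  forall im i,
    [/\ locally_integrable setT (coordinate im i \o f),
        locally_integrable setT (coordinate im i \o g) &
        forall phi, test_function phi ->
          \int[mu]_x (coordinate im i (f x) * derive1n j phi x) =
          (-1) ^+ j * \int[mu]_x (coordinate im i (g x) * phi x)].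

Definition has_weak_derivative (j : nat) f : Prop :=
  exists g, is_weak_derivative j f g.

(* Weak derivatives are unique only up to null sets: this picks one of them
   (and is 0 when there is none). *)
Definition weak_derivative (j : nat) f : R -> 'cV[F]_m :=
  xget (fun=> 0) [set g | is_weak_derivative j f g].

Definition in_Hk (k : nat) u : Prop :=
  forall j, (j <= k)%N ->
    has_weak_derivative j u /\ L2 setT (weak_derivative j u).

Definition in_Hk_loc (k : nat) u : Prop :=
  forall j, (j <= k)%N ->
    has_weak_derivative j u /\
    forall a b : R, L2 `[a, b] (weak_derivative j u).

Definition in_Hk_per (k : nat) (L : R) u : Prop :=
  periodic u L /\ in_Hk_loc k u.

Definition Hk_norm (k : nat) D u : \bar R :=
  sqrte (\sum_(j < k.+1) (L2_norm D (weak_derivative j u) ^+ 2))%E.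

Definition Hk_per_norm (k : nat) (L : R) u : \bar R := Hk_norm k `]0, L[ u.

End SobolevSpaces.

Section Equation.
Context {R : realType} {s : scalars} {m : nat}.
Local Notation F := (scalar_field R s).
Local Notation mu := (@lebesgue_measure R).
Variables (k : nat) (alpha : nat -> R -> 'M[F]_m).
Variable nl : 'cV[F]_m -> R -> 'cV[F]_m.

Definition diff_op (u : R -> 'cV[F]_m) (x : R) : 'cV[F]_m :=
  \sum_(1 <= j < k.+1) alpha j x *m weak_derivative j u x.

(* Jacobian matrix of the nonlinearity in its first argument; the library's
   jacobian is for row vectors. *)
Definition du_nl (w : 'cV[F]_m) (x : R) : 'M[F]_m :=
  \matrix_(i, j) ('d (nl^~ x) w (delta_mx j ord0 : 'cV[F]_m)) i ord0.

(* Differentiability is over F, hence complex differentiability over C. *)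
Definition twice_C1_in_u : Prop :=
  [/\ forall w x, differentiable (nl^~ x) w,
      continuous (fun p : 'cV[F]_m * R => du_nl p.1 p.2),
      forall w x, differentiable (du_nl^~ x) w &
      forall h : 'cV[F]_m,
        continuous (fun p : 'cV[F]_m * R => 'd (du_nl^~ p.2) (p.1) h : 'M[F]_m)].

Definition solution (u : R -> 'cV[F]_m) : Prop :=
  {ae mu, forall x, diff_op u x + nl (u x) x = 0}.

Definition linearization (u phi : R -> 'cV[F]_m) (x : R) : 'cV[F]_m :=
  diff_op phi x + du_nl (u x) x *m phi x.

(* Invertibility of the unbounded operator with domain H^k in L^2: it is a
   bijection from H^k onto L^2 (functions being identified almost everywhere)
   whose inverse is bounded on L^2.  The state u is meant to be essentially
   bounded, which holds for every u in H^k + H^k_per since 0 < k. *)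
Definition nondegenerate_state (u : R -> 'cV[F]_m) : Prop :=
  [/\ forall phi, in_Hk k phi -> L2 setT (linearization u phi),
      forall f, L2 setT f ->
        exists2 phi, in_Hk k phi &
          {ae mu, forall x, linearization u phi x = f x},
      forall phi psi, in_Hk k phi -> in_Hk k psi ->
        {ae mu, forall x, linearization u phi x = linearization u psi x} ->
        {ae mu, forall x, phi x = psi x} &
      exists C : R, forall phi, in_Hk k phi ->
        (L2_norm setT phi <= C%:E * L2_norm setT (linearization u phi))%E].

End Equation.

Section Cutoff.
Context {R : realType}.

Definition Wkoo_norm (k : nat) (chi : R -> R) : \bar R :=
  \big[maxe/0%E]_(j < k.+1) ereal_sup (range (fun x => `|derive1n j chi x|%:E)).

Definition cutoff (k : nat) (T : R) (n : nat) (chi : R -> R) : Prop :=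
  [/\ smooth chi, periodic chi (n%:R * T),
      forall x, 0 <= chi x <= 1,
      (Wkoo_norm k chi <= 1)%E &
      (forall x, x \in `[- (n%:R / 6 * T), n%:R / 6 * T] -> chi x = 1) /\
      (forall x, x \in `[- (n%:R / 2 * T), - (n%:R / 3 * T)] \/
                 x \in `[n%:R / 3 * T, n%:R / 2 * T] -> chi x = 0)].

End Cutoff.

(* Main.v *)
(* Put p = nT, Z = z and nn w = N(w + v) - N(v), so that A Z + nn Z = 0, and let G be the inverse
   of the linearization L(z + v) on the whole line.  Periodic solutions near chi_n z + v are sought
   in the form chi_n z + v + a, where a is the p-periodization of eta * G b, with b supported in the
   period cell and eta a slowly varying cutoff, equal to 1 on the cell and supported in
   [-2p/3, 2p/3].  The residual of this ansatz, computed on the cell, differs from b by the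
   commutator [A, eta] G b, which is O(1/p) because the derivatives of eta are, and by the mismatch
   between N(. + v) at the periodized function and the linearization at z + v seen from each
   translate; the latter is small because, where a translate of eta by p or -p meets the cell,
   chi_n vanishes and the corresponding translate of z is small.  Hence b |-> 1_cell (b - residual)
   is a contraction of a small ball of L^2, its value at 0 is bounded by the H^k-norm of z outside
   (-p/6, p/6), and its fixed point gives a solution.  Since alpha_k is invertible, interpolation
   between L^2 and H^k upgrades the L^2-bound of G to an H^k-bound, which yields the estimate
   of a. *)
Require Import Defs.
From mathcomp Require Import all_boot all_order all_algebra.
From mathcomp Require Import all_classical all_reals all_analysis measurable_realfun.
From mathcomp Require Import complex.
From mathcomp Require Import ring lra.
Set Implicit Arguments.
Unset Strict Implicit.
Unset Printing Implicit Defensive.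
Import Order.TTheory GRing.Theory Num.Theory.
Import numFieldNormedType.Exports.
Local Open Scope classical_set_scope.
Local Open Scope ring_scope.

(** * Weak derivatives on the line *)

Section Translation.
Context {R : realType}.
Local Notation mu := (@lebesgue_measure R).

(** Invertibility of the linearization is known on the line only; nothing is assumed on the circle.
    Taking the source b rather than the correction as the unknown turns the whole-line inverse into
    an approximate inverse on the circle and keeps the iteration in L^2. The nonlinearity need not
    be Lipschitz there, but it sees b only through G b, which the one-dimensional Sobolev inequality
    bounds uniformly, so that strict differentiability near a bounded set of states suffices. G is a
    mere choice function: the a priori bound holds for every solution of the linear problem, and
    differences of solutions are solutions, which replaces linearity of G. Weak derivatives are
    fixed only up to null sets, so functions are carried along as jets, that is, sequences linked by
    first-order weak derivatives, whose entry 0 is replaced by a continuous representative where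
    pointwise values matter. The mollifier behind uniqueness of weak derivatives is extracted from
    one of the given cutoffs. *)

Lemma measurable_addr (c : R) : measurable_fun setT (fun x : R => x + c).
Proof. by apply: measurable_funD. Qed.

Lemma preimage_addr_itv (c a b : R) :
  (fun x : R => x + c) @^-1` `]a, b] = `]a - c, b - c]%classic.
Proof. by apply/seteqP; split => x /=; rewrite !in_itv/= ltrBlDr lerBrDr. Qed.

(** Lebesgue measure is determined by its values on half-open intervals, and a shift does not change
    those. *)
Lemma lebesgue_measure_addr (c : R) (A : set R) : measurable A ->
  pushforward mu (fun x : R => x + c : measurableTypeR R) A = mu A.
Proof.
move=> mA.
pose shift := fun x : R => x + c : measurableTypeR R.
have ms : measurable_fun setT shift by exact: measurable_addr.
pose m := pushforward mu shift.
apply/esym/lebesgue_measure_unique => //= _ [[a b]] _ <-.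
rewrite /pushforward /= preimage_addr_itv !lebesgue_measure_itv/= !lte_fin ltrD2r.
by case: ifPn => // _; rewrite -!EFinB opprB addrA subrK.
Qed.

Lemma negligible_addr (c : R) (A : set R) : mu.-negligible A ->
  mu.-negligible ((fun x => x + c) @^-1` A).
Proof.
move=> [B [mB B0 AB]]; exists ((fun x => x + c) @^-1` B); split.
- rewrite -[X in measurable X]setTI; exact: measurable_addr.
- have := lebesgue_measure_addr c mB; rewrite /pushforward => ->. by [].
- by move=> x /AB.
Qed.

Lemma ae_addr (c : R) (P : R -> Prop) : {ae mu, forall x, P x} ->
  {ae mu, forall x, P (x + c)}.
Proof. by move=> /(negligible_addr c). Qed.

Lemma ae_imp (P Q : R -> Prop) : (forall x, P x -> Q x) ->
  {ae mu, forall x, P x} -> {ae mu, forall x, Q x}.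
Proof. by move=> PQ; apply: (@filterS _ _ (ae_filter_ringOfSetsType (@lebesgue_measure R))). Qed.

Lemma ae_imp2 (P1 P2 Q : R -> Prop) : (forall x, P1 x -> P2 x -> Q x) ->
  {ae mu, forall x, P1 x} -> {ae mu, forall x, P2 x} -> {ae mu, forall x, Q x}.
Proof. by move=> PQ; apply: (@filterS2 _ _ (ae_filter_ringOfSetsType (@lebesgue_measure R))). Qed.

Lemma measurable_fun_addr d (T : measurableType d) (c : R) (f : R -> T) :
  measurable_fun setT f -> measurable_fun setT (fun x : R => f (x + c)).
Proof. by move=> mf; apply: measurableT_comp => //; exact: measurable_addr. Qed.

Lemma ge0_integral_addr (c : R) (f : R -> \bar R) : measurable_fun setT f ->
  (forall x, 0 <= f x)%E ->
  (\int[mu]_x f (x + c)%R = \int[mu]_x f x)%E.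
Proof.
move=> mf f0.
pose shift := fun x : R => x + c : measurableTypeR R.
have ms : measurable_fun (setT : set (measurableTypeR R)) shift by exact: measurable_addr.
have := @ge0_integral_pushforward _ _ (measurableTypeR R) (measurableTypeR R) R shift ms
  (@lebesgue_measure R) setT f measurableT mf.
rewrite preimage_setT /= => <- //.
apply: eq_measure_integral => A mA _.
exact: (lebesgue_measure_addr c mA).
Qed.

Lemma integral_addr (c : R) (f : R -> \bar R) : measurable_fun setT f ->
  (\int[mu]_x f (x + c)%R = \int[mu]_x f x)%E.
Proof.
move=> mf; rewrite integralE [RHS]integralE; congr (_ - _)%E.
  rewrite -(ge0_integral_addr c (measurable_funepos mf) (funepos_ge0 f)).
  by rewrite (funepos_comp f (fun x : R => x + c)).
rewrite -(ge0_integral_addr c (measurable_funeneg mf) (funeneg_ge0 f)).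
by rewrite (funeneg_comp f (fun x : R => x + c)).
Qed.

Lemma integrable_addr (c : R) (f : R -> \bar R) :
  mu.-integrable setT f -> mu.-integrable setT (fun x => f (x + c)).
Proof.
move=> /integrableP[mf foo]; apply/integrableP; split.
  exact: measurable_fun_addr.
rewrite (ge0_integral_addr c (f := fun x => `|f x|%E))//.
exact: measurableT_comp.
Qed.

End Translation.

(** * Smooth functions of one real variable *)

Section Smooth.
Context {R : realType}.
Implicit Types (f g h : R -> R).

(** Smoothness split by order: in f' g + f g' only one factor loses an order, so closure under
    products is an induction on a finite n. *)
Definition derivable_upto n f := forall m x, (m < n)%N -> derivable (derive1n m f) x 1.

Lemma derive1nSr n f : derive1n n.+1 f = derive1n n (derive1 f).
Proof. by rewrite /derive1n iterSr. Qed.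

Lemma smooth_derivable f x : smooth f -> derivable f x 1.
Proof. by move=> /(_ 0%N). Qed.

Lemma smooth_derive1n n f : smooth f -> smooth (derive1n n f).
Proof. by move=> sf m x; rewrite /derive1n -iterD; exact: sf. Qed.

Lemma smooth_derive1 f : smooth f -> smooth (derive1 f).
Proof. by move=> sf m x; rewrite -derive1nSr; exact: sf. Qed.

Lemma smooth_continuous f : smooth f -> continuous f.
Proof.
by move=> sf x; apply: differentiable_continuous; apply/derivable1_diffP; exact: smooth_derivable.
Qed.

Lemma smooth_uptoP f : smooth f <-> forall n, derivable_upto n f.
Proof.
split=> [sf n m x _|H n x]; first exact: sf.
exact: (H n.+1).
Qed.

Lemma derivable_uptoS n f : derivable_upto n.+1 f <->
  (forall x, derivable f x 1) /\ derivable_upto n (derive1 f).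
Proof.
split=> [H|[H1 H2] [|m] x mn].
- by split=> [x|m x mn]; [exact: (H 0%N)|rewrite -derive1nSr; apply: H].
- exact: H1.
- by rewrite derive1nSr; exact: H2.
Qed.

Lemma is_derive_add f g (x df dg : R) : is_derive x 1 f df -> is_derive x 1 g dg ->
  is_derive x 1 (fun x => f x + g x) (df + dg).
Proof. exact: (@is_deriveD R R R f g x 1 df dg). Qed.

Lemma is_derive_mul f g (x df dg : R) : is_derive x 1 f df -> is_derive x 1 g dg ->
  is_derive x 1 (fun x => f x * g x) (df * g x + f x * dg).
Proof.
move=> Df Dg; have := @is_deriveM R R f g x 1 df dg Df Dg.
by rewrite /GRing.scale/= addrC [g x * df]mulrC.
Qed.

Lemma is_derive1E f (x : R) : derivable f x 1 -> is_derive x 1 f (derive1 f x).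
Proof. move=> df; apply: DeriveDef; [exact: df|exact/esym/derive1E]. Qed.

Lemma is_derive_derive1 f (x df : R) : is_derive x 1 f df -> derive1 f x = df.
Proof. by move=> Df; rewrite derive1E derive_val. Qed.

Lemma is_derive_derivable f (x df : R) : is_derive x 1 f df -> derivable f x 1.
Proof. by move=> Df; exact: ex_derive. Qed.

Lemma derive1_add f g : (forall x, derivable f x 1) -> (forall x, derivable g x 1) ->
  derive1 (fun x => f x + g x) = (fun x => derive1 f x + derive1 g x).
Proof.
move=> df dg; apply/funext => x; apply: is_derive_derive1.
by apply: is_derive_add; exact: is_derive1E.
Qed.

Lemma derive1_mul f g : (forall x, derivable f x 1) -> (forall x, derivable g x 1) ->
  derive1 (fun x => f x * g x) = (fun x => derive1 f x * g x + f x * derive1 g x).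
Proof.
move=> df dg; apply/funext => x; apply: is_derive_derive1.
by apply: is_derive_mul; exact: is_derive1E.
Qed.

Lemma derivable_uptoD n f g : derivable_upto n f -> derivable_upto n g ->
  derivable_upto n (fun x => f x + g x).
Proof.
elim: n f g => [f g _ _ m x|n IH f g]; first by rewrite ltn0.
move=> /derivable_uptoS[f1 f2] /derivable_uptoS[g1 g2].
apply/derivable_uptoS; split=> [x|].
  exact: (is_derive_derivable (is_derive_add (is_derive1E (f1 x)) (is_derive1E (g1 x)))).
rewrite (derive1_add f1 g1); exact: (IH _ _ f2 g2).
Qed.

Lemma derivable_uptoW n f : derivable_upto n.+1 f -> derivable_upto n f.
Proof. by move=> H m x mn; apply: H; exact: ltnW. Qed.

Lemma derivable_uptoM n f g : derivable_upto n f -> derivable_upto n g ->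
  derivable_upto n (fun x => f x * g x).
Proof.
elim: n f g => [f g _ _ m x|n IH f g]; first by rewrite ltn0.
move=> fn gn; have [f1 f2] := (derivable_uptoS n f).1 fn.
have [g1 g2] := (derivable_uptoS n g).1 gn.
apply/derivable_uptoS; split=> [x|].
  exact: (is_derive_derivable (is_derive_mul (is_derive1E (f1 x)) (is_derive1E (g1 x)))).
rewrite (derive1_mul f1 g1); apply: derivable_uptoD.
  exact: (IH _ _ f2 (derivable_uptoW gn)).
exact: (IH _ _ (derivable_uptoW fn) g2).
Qed.

Lemma smoothD f g : smooth f -> smooth g -> smooth (fun x => f x + g x).
Proof. by rewrite !smooth_uptoP => sf sg n; apply: derivable_uptoD. Qed.

Lemma smoothM f g : smooth f -> smooth g -> smooth (fun x => f x * g x).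
Proof. by rewrite !smooth_uptoP => sf sg n; apply: derivable_uptoM. Qed.

Lemma derive1n_cst n (c : R) : derive1n n.+1 (fun=> c : R) = fun=> 0.
Proof.
elim: n => [|n IH]; first by apply/funext => x; rewrite derive1n1 derive1_cst.
by rewrite derive1nS IH; apply/funext => x; rewrite derive1_cst.
Qed.

Lemma smooth_cst (c : R) : smooth (fun _ : R => c).
Proof. by move=> [|n] x; [rewrite derive1n0|rewrite derive1n_cst]; exact: derivable_cst. Qed.

Lemma smoothN f : smooth f -> smooth (fun x => - f x).
Proof.
move=> sf; have := smoothM (@smooth_cst (-1)) sf.
by rewrite (_ : (fun x => -1 * f x) = (fun x => - f x))//; apply/funext => x; rewrite mulN1r.
Qed.

Lemma smoothB f g : smooth f -> smooth g -> smooth (fun x => f x - g x).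
Proof. by move=> sf /smoothN sg; exact: smoothD sf sg. Qed.

Lemma near_derive1n n f g (x : R) : (\forall y \near x, f y = g y) ->
  \forall y \near x, derive1n n f y = derive1n n g y.
Proof.
move=> fg; elim: n => [//|n IH].
have := near_join IH; apply: filterS => y fgy.
by rewrite !derive1nS !derive1E; apply: near_eq_derive.
Qed.

(** Derivatives at x depend on the germ at x only. This is how the piecewise definitions [step_of]
    and [cut_off] are seen to be smooth. *)
Lemma smooth_local f : (forall x : R, exists2 g, smooth g & \forall y \near x, f y = g y) -> smooth f.
Proof.
move=> H n x; have [g sg fg] := H x.
have := near_derive1n n fg => fgn.
apply: near_eq_derivable (sg n x).
by near do apply/esym.
Unshelve. all: by end_near. Qed.

Lemma is_derive_affine f (a b x : R) : derivable f (a * x + b) 1 ->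
  is_derive x 1 (fun x : R => f (a * x + b)) (a * derive1 f (a * x + b)).
Proof.
move=> df.
have Da : is_derive x 1 (fun y : R => a * y + b) (0 * x + a * 1 + 0).
  by apply: is_derive_add; apply: is_derive_mul.
have := @is_derive1_comp R f (fun y => a * y + b) x _ _ (is_derive1E df) Da.
by rewrite mul0r add0r mulr1 addr0 mulrC.
Qed.

Lemma derive1n_affine n f (a b : R) : smooth f ->
  derive1n n (fun x => f (a * x + b)) = fun x => a ^+ n * derive1n n f (a * x + b).
Proof.
move=> sf; elim: n => [|n IH]; first by apply/funext => x; rewrite !derive1n0 expr0 mul1r.
rewrite derive1nS IH; apply/funext => x; apply: is_derive_derive1.
have D := is_derive_affine (sf n (a * x + b)).
have := is_derive_mul (is_derive_cst (a ^+ n) x 1) D.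
by rewrite mul0r add0r mulrA -exprSr -derive1nS.
Qed.

Lemma smooth_affine f (a b : R) : smooth f -> smooth (fun x => f (a * x + b)).
Proof.
move=> sf n x; rewrite derive1n_affine//.
have D := is_derive_affine (sf n (a * x + b)).
exact: is_derive_derivable (is_derive_mul (is_derive_cst (a ^+ n) x 1) D).
Qed.

End Smooth.

(** * Locally integrable functions *)

Section LocallyIntegrable.
Context {R : realType}.
Local Notation mu := (@lebesgue_measure R).
Local Notation locint := (locally_integrable setT).
Implicit Types (f g h : R -> R).

(** Every compact set lies in a segment, so it is enough to test segments. *)
Lemma locintP f : locint f <-> measurable_fun setT f /\
  forall a b : R, mu.-integrable `[a, b] (EFin \o f).
Proof.
split=> [[mf _ H]|[mf H]].
  split=> // a b; apply/integrableP; split.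
    by apply/measurable_EFinP; exact: measurable_funTS.
  exact: (H `[a, b]%classic (subsetT _) (@segment_compact _ a b)).
split=> //; first exact: openT.
move=> K _ cK; have [M [_ HM]] := compact_bounded cK.
have KM : K `<=` `[- (M + 1), M + 1].
  move=> x Kx; have := HM (M + 1) _ x Kx; rewrite ltrDl ltr01 => /(_ isT) /=.
  by rewrite ler_norml in_itv.
have /integrableP[_] := H (- (M + 1)) (M + 1).
apply: le_lt_trans; apply: ge0_subset_integral => //.
- exact: compact_measurable.
- by apply/measurable_EFinP; apply: measurableT_comp => //; exact: measurable_funTS.
Qed.

Lemma locint_measurable f : locint f -> measurable_fun setT f.
Proof. by case. Qed.

Lemma locint_itv f (a b : R) : locint f -> mu.-integrable `[a, b] (EFin \o f).
Proof. by move=> /locintP[]. Qed.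

Lemma le_integrable_real (D : set R) f g : measurable D -> measurable_fun setT f ->
  (forall x, D x -> `|f x| <= g x) -> mu.-integrable D (EFin \o g) ->
  mu.-integrable D (EFin \o f).
Proof.
move=> mD mf fg; apply: le_integrable; first exact: mD.
  by apply/measurable_EFinP; exact: measurable_funTS.
by move=> x Dx /=; rewrite lee_fin (le_trans (fg x Dx))// ler_norm.
Qed.

Lemma integrable_scale (D : set R) (c : R) f : measurable D ->
  mu.-integrable D (EFin \o f) -> mu.-integrable D (EFin \o (fun x => c * f x)).
Proof. by move=> mD; exact: integrableZl. Qed.

Lemma integrable_normr (D : set R) f : measurable D ->
  mu.-integrable D (EFin \o f) -> mu.-integrable D (EFin \o (fun x => `|f x|)).
Proof. by move=> mD /integrable_abse. Qed.

Lemma locint_integrable_mul f h (M C : R) : locint f -> measurable_fun setT h ->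
  (forall x, `|h x| <= C) -> (forall x, M < `|x| -> h x = 0) ->
  mu.-integrable setT (EFin \o (fun x => f x * h x)).
Proof.
move=> lf mh hC hM.
have -> : (fun x => f x * h x) = (fun x => f x * h x) \_ `[- M, M].
  apply/funext => x; rewrite patchE; case: ifPn => //.
  by rewrite notin_setE /= in_itv /= -ler_norml => /negP; rewrite -ltNge => /hM ->; rewrite mulr0.
rewrite -restrict_EFin; apply/(integrable_mkcond _ _).1; first exact: measurable_itv.
apply: (@le_integrable_real _ _ (fun x => C * `|f x|)); first exact: measurable_itv.
- by apply: measurable_funM => //; exact: locint_measurable.
- by move=> x _ /=; rewrite normrM mulrC ler_wpM2r.
- by apply: integrable_scale; [exact: measurable_itv|apply: integrable_normr; [exact: measurable_itv|exact: locint_itv]].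
Qed.

Lemma continuous_bounded_itv f (a b : R) : continuous f ->
  exists C : R, forall x, a <= x <= b -> `|f x| <= C.
Proof.
move=> cf.
have cK : compact (f @` `[a, b]).
  by apply: continuous_compact; [exact: continuous_subspaceT|exact: segment_compact].
have [M [_ HM]] := compact_bounded cK.
exists (M + 1) => x xab; apply: (HM (M + 1)); first by rewrite ltrDl ltr01.
by exists x => //=; rewrite in_itv.
Qed.

Lemma locint_mul f h : locint f -> measurable_fun setT h ->
  (forall a b : R, exists C : R, forall x, a <= x <= b -> `|h x| <= C) ->
  locint (fun x => f x * h x).
Proof.
move=> lf mh hb; apply/locintP; split.
  by apply: measurable_funM => //; exact: locint_measurable.
move=> a b; have [C hC] := hb a b.
apply: (@le_integrable_real _ _ (fun x => C * `|f x|)); first exact: measurable_itv.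
- by apply: measurable_funM => //; exact: locint_measurable.
- by move=> x /=; rewrite in_itv/= => xab; rewrite normrM mulrC ler_wpM2r// hC.
- by apply: integrable_scale; [exact: measurable_itv|apply: integrable_normr; [exact: measurable_itv|exact: locint_itv]].
Qed.

Lemma locint_mul_continuous f h : locint f -> continuous h -> locint (fun x => f x * h x).
Proof.
move=> lf ch; apply: locint_mul => //; first exact: continuous_measurable_fun.
by move=> a b; exact: continuous_bounded_itv.
Qed.

Lemma locint_cst (c : R) : locint (fun=> c).
Proof.
apply/locintP; split=> // a b; apply: (@continuous_compact_integrable _ (cst c)).
  exact: segment_compact.
by apply: continuous_subspaceT => x; exact: cst_continuous.
Qed.

Lemma locint_continuous f : continuous f -> locint f.
Proof.
move=> cf; have := locint_mul_continuous (locint_cst 1) cf.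
by rewrite (_ : (fun x => 1 * f x) = f)//; apply/funext => x; rewrite mul1r.
Qed.

Lemma locintD f g : locint f -> locint g -> locint (fun x => f x + g x).
Proof. exact: locally_integrableD. Qed.

Lemma locintZ (c : R) f : locint f -> locint (fun x => c * f x).
Proof.
move=> lf; have := locint_mul_continuous lf (@cst_continuous R R c).
by rewrite (_ : (fun x => f x * cst c x) = (fun x => c * f x))//; apply/funext => x; rewrite mulrC.
Qed.

Lemma locint_addr (c : R) f : locint f -> locint (fun x => f (x + c)).
Proof.
move=> /locintP[mf H]; apply/locintP; split; first exact: measurable_fun_addr.
move=> a b; have H0 := H (a + c) (b + c).
have H1 : mu.-integrable setT ((EFin \o f) \_ `[a + c, b + c]).
  by apply/(integrable_mkcond _ _).1 => //; exact: measurable_itv.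
have := integrable_addr c H1 => H2.
apply/(integrable_mkcond _ _).2; first exact: measurable_itv.
move: H2; congr (mu.-integrable _ _); apply/funext => x; rewrite !patchE.
by rewrite !mem_setE !in_itv/= !lerD2r.
Qed.

End LocallyIntegrable.

(** * Calculus of weak derivatives of scalar functions *)

Section WeakDerivative.
Context {R : realType}.
Local Notation mu := (@lebesgue_measure R).
Local Notation locint := (locally_integrable setT).
Implicit Types (f g h phi : R -> R).

Lemma test_functionP phi : test_function phi <->
  smooth phi /\ exists M : R, forall x, M < `|x| -> phi x = 0.
Proof.
split=> -[sphi].
  move=> /compact_bounded[M [_ HM]]; split=> //; exists (M + 1) => x Mx.
  apply/eqP; apply: contraTT Mx => phix; rewrite -leNgt.
  by apply: (HM (M + 1)); [rewrite ltrDl ltr01|exact: subset_closure].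
move=> [M HM]; split=> //.
apply: (subclosed_compact _ (@segment_compact _ (- M) M)); first exact: closed_closure.
have /closure_id -> : closed `[- M, M]%classic by exact: interval_closed.
apply: closureS => x /= /eqP phix; rewrite in_itv/= -ler_norml leNgt.
by apply/negP => /HM.
Qed.

Lemma test_function_derive1n n phi : test_function phi -> test_function (derive1n n phi).
Proof.
move=> /test_functionP[sphi [M HM]]; apply/test_functionP.
split; first exact: smooth_derive1n.
exists M => x Mx.
have H : \forall y \near x, phi y = 0.
  have o : open [set y : R | M < `|y|].
    apply: (@open_comp _ _ (fun y : R => `|y|) [set y | M < y]).
      by move=> y _; exact: norm_continuous.
    exact: open_gt.
  by apply: (@filterS _ (nbhs x) _ [set y : R | M < `|y|]); [exact: HM|exact: open_nbhs_nbhs].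
have /nbhs_singleton -> := near_derive1n (g := fun=> 0) n H.
case: n => [//|n]; by rewrite derive1n_cst.
Qed.

Lemma test_function_derive1 phi : test_function phi -> test_function (derive1 phi).
Proof. by move/(test_function_derive1n 1). Qed.

Lemma test_functionM (eta phi : R -> R) : smooth eta -> test_function phi ->
  test_function (fun x => eta x * phi x).
Proof.
move=> seta /test_functionP[sphi [M HM]]; apply/test_functionP.
by split; [exact: smoothM|exists M => x /HM ->; rewrite mulr0].
Qed.

Lemma test_function_addr (c : R) phi : test_function phi -> test_function (fun x => phi (x + c)).
Proof.
move=> /test_functionP[sphi [M HM]]; apply/test_functionP; split.
  have := @smooth_affine _ _ 1 c sphi.
  by rewrite (_ : (fun x => phi (1 * x + c)) = (fun x => phi (x + c)))//; apply/funext=> x; rewrite mul1r.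
exists (M + `|c|) => x Mx; apply: HM.
have := ler_normB (x + c) c; rewrite addrK => H; rewrite -(ltrD2r `|c|).
exact: lt_le_trans H.
Qed.

Lemma test_function_continuous phi : test_function phi -> continuous phi.
Proof. by move=> [sphi _]; exact: smooth_continuous. Qed.

Lemma test_function_bounded phi : test_function phi -> exists C : R, forall x, `|phi x| <= C.
Proof.
move=> tphi; have [_ [M HM]] := (test_functionP _).1 tphi.
have [C HC] := continuous_bounded_itv (- M) M (test_function_continuous tphi).
exists (Num.max C 0) => x; rewrite le_max.
have [xM|/HM ->] := leP `|x| M; last by rewrite normr0 lexx orbT.
by rewrite HC// -ler_norml.
Qed.

Lemma integrable_test f phi : locint f -> test_function phi ->
  mu.-integrable setT (EFin \o (fun x => f x * phi x)).
Proof.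
move=> lf tphi; have [C HC] := test_function_bounded tphi.
have [_ [M HM]] := (test_functionP _).1 tphi.
apply: (locint_integrable_mul lf _ HC HM).
by apply: continuous_measurable_fun; exact: test_function_continuous.
Qed.

(** The condition that [is_weak_derivative] imposes on each real coordinate; the two are
    convertible, so scalar facts apply coordinatewise without a bridge. *)
Definition wder (j : nat) f g := [/\ locint f, locint g &
  forall phi, test_function phi ->
    \int[mu]_x (f x * derive1n j phi x) = (-1) ^+ j * \int[mu]_x (g x * phi x)].

Lemma wder_ae j f g f' g' : locint f' -> locint g' ->
  {ae mu, forall x, f x = f' x} -> {ae mu, forall x, g x = g' x} ->
  wder j f g -> wder j f' g'.
Proof.
move=> lf' lg' ff' gg' [lf lg H]; split=> // phi tphi; move: (H phi tphi).
have aeR (u u' psi : R -> R) : locint u -> locint u' -> test_function psi ->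
    {ae mu, forall x, u x = u' x} -> \int[mu]_x (u x * psi x) = \int[mu]_x (u' x * psi x).
  move=> lu lu' tpsi uu'; congr fine; apply: ae_eq_integral => //.
  - by have /integrableP[] := integrable_test lu tpsi.
  - by have /integrableP[] := integrable_test lu' tpsi.
  - by apply: (ae_imp _ uu') => x /= -> _.
rewrite (aeR f f')//; last exact: test_function_derive1n.
by rewrite (aeR g g').
Qed.

Lemma wder_linear j f g f' g' (c : R) : wder j f g -> wder j f' g' ->
  wder j (fun x => c * f x + f' x) (fun x => c * g x + g' x).
Proof.
move=> [lf lg H] [lf' lg' H'].
split; [by apply: locintD => //; exact: locintZ|by apply: locintD => //; exact: locintZ|].
move=> phi tphi.
have lin u u' psi : locint u -> locint u' -> test_function psi ->
    \int[mu]_x ((c * u x + u' x) * psi x) = c * \int[mu]_x (u x * psi x) + \int[mu]_x (u' x * psi x).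
  move=> lu lu' tpsi.
  under eq_Rintegral do rewrite mulrDl -mulrA.
  rewrite RintegralD//; last 2 first.
  - by apply: integrable_scale => //; exact: integrable_test.
  - exact: integrable_test.
  by rewrite RintegralZl//; exact: integrable_test.
rewrite !lin//; last exact: test_function_derive1n.
by rewrite H// H'// mulrDr !mulrA [c * _]mulrC.
Qed.

Lemma wder0 j : wder j (fun=> 0) (fun=> 0).
Proof.
split; [exact: locint_cst|exact: locint_cst|move=> phi _].
under eq_Rintegral do rewrite mul0r.
under [in RHS]eq_Rintegral do rewrite mul0r.
by rewrite /Rintegral integral0/= mulr0.
Qed.

Lemma wderD j f g f' g' : wder j f g -> wder j f' g' ->
  wder j (fun x => f x + f' x) (fun x => g x + g' x).
Proof.
move=> H H'; have := wder_linear 1 H H'.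
by congr wder; apply/funext => x; rewrite mul1r.
Qed.

Lemma wderZ j f g (c : R) : wder j f g -> wder j (fun x => c * f x) (fun x => c * g x).
Proof.
move=> H; have := wder_linear c H (wder0 j).
by congr wder; apply/funext => x; rewrite addr0.
Qed.

Lemma wder_addr j f g (c : R) : wder j f g -> wder j (fun x => f (x + c)) (fun x => g (x + c)).
Proof.
move=> [lf lg H]; split; [exact: locint_addr|exact: locint_addr|move=> phi tphi].
have tr u psi : locint u -> continuous psi ->
    \int[mu]_x (u (x + c) * psi x) = \int[mu]_x (u x * psi (x - c)).
  move=> lu cpsi; rewrite /Rintegral.
  rewrite -(@integral_addr _ c (fun x => (u x * psi (x - c))%:E)).
    by under [in RHS]eq_integral do rewrite addrK.
  apply/measurable_EFinP/measurable_funM; first exact: locint_measurable.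
  by apply: measurable_fun_addr; apply: continuous_measurable_fun.
have tphi' := test_function_addr (- c) tphi.
have dE : derive1n j (fun x => phi (x - c)) = fun x => derive1n j phi (x - c).
  have [sphi _] := tphi; have := @derive1n_affine _ j _ 1 (- c) sphi.
  rewrite (_ : (fun x => phi (1 * x - c)) = (fun x => phi (x - c))); last first.
    by apply/funext => x; rewrite mul1r.
  by move=> ->; apply/funext => x; rewrite expr1n !mul1r.
rewrite (tr f)//; last exact/test_function_continuous/test_function_derive1n.
rewrite (tr g)//; last exact/test_function_continuous.
by rewrite -H// dE.
Qed.

Lemma wder0P f g : locint f -> {ae mu, forall x, f x = g x} -> locint g -> wder 0 f g.
Proof.
move=> lf fg lg; have : wder 0 f f by split=> // phi _; rewrite expr0 mul1r.
apply: wder_ae => //; exact: aeW.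
Qed.

Lemma wder_comp i j f g h : wder i f g -> wder j g h -> wder (i + j) f h.
Proof.
move=> [lf lg H] [_ lh H']; split=> // phi tphi.
have := H _ (test_function_derive1n j tphi).
by rewrite /derive1n -iterD -/(derive1n (i + j) phi) => ->; rewrite H'// exprD mulrA.
Qed.

(** The relation of order i is tested against the j-th derivative of phi, and the signs (-1)^i
    cancel. It extracts first-order links between weak derivatives of consecutive orders. *)
Lemma wder_cancel i j f g h : wder i f g -> wder (i + j) f h -> wder j g h.
Proof.
move=> [lf lg H] [_ lh H']; split=> // phi tphi.
have := H _ (test_function_derive1n j tphi).
rewrite /derive1n -iterD -/(derive1n (i + j) phi) H'// exprD -mulrA => /(congr1 (fun t => (-1) ^+ i * t)).
by rewrite !mulrA -exprD addnn -mul2n exprM sqrrN expr1n expr1n !mul1r.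
Qed.

(** The weak derivative of f is tested against eta phi, and the classical product rule for eta phi
    produces the term with eta'. *)
Lemma wderM (eta : R -> R) f g : smooth eta -> wder 1 f g ->
  wder 1 (fun x => eta x * f x) (fun x => derive1 eta x * f x + eta x * g x).
Proof.
move=> seta [lf lg H].
have mulC u (h : R -> R) : locint u -> continuous h -> locint (fun x => h x * u x).
  by move=> lu ch; under eq_fun do rewrite mulrC; exact: locint_mul_continuous.
have ce := smooth_continuous seta.
have ce' := smooth_continuous (smooth_derive1 seta).
have sd (u : R -> R) : smooth u -> forall x, derivable u x 1 by move=> su x; exact: smooth_derivable.
split; [exact: mulC| by apply: locintD; exact: mulC|move=> phi tphi].
have [sphi _] := tphi.
have := H _ (test_functionM seta tphi).
rewrite !derive1n1 expr1 !mulN1r (derive1_mul (sd eta seta) (sd phi sphi)).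
have Ie := integrable_test lf (test_functionM (smooth_derive1 seta) tphi).
have Id := integrable_test lf (test_functionM seta (test_function_derive1 tphi)).
have Ig := integrable_test lg (test_functionM seta tphi).
have -> : \int[mu]_x (f x * (derive1 eta x * phi x + eta x * derive1 phi x)) =
    \int[mu]_x (f x * (derive1 eta x * phi x)) + \int[mu]_x (f x * (eta x * derive1 phi x)).
  by rewrite -RintegralD//; apply: eq_Rintegral => x _; rewrite mulrDr.
have -> : \int[mu]_x ((derive1 eta x * f x + eta x * g x) * phi x) =
    \int[mu]_x (f x * (derive1 eta x * phi x)) + \int[mu]_x (g x * (eta x * phi x)).
  by rewrite -RintegralD//; apply: eq_Rintegral => x _; ring.
have -> : \int[mu]_x (eta x * f x * derive1 phi x) = \int[mu]_x (f x * (eta x * derive1 phi x)).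
  by apply: eq_Rintegral => x _; ring.
by move=> E; rewrite opprD -E; ring.
Qed.

End WeakDerivative.

(** * Mollification at Lebesgue points, uniqueness of weak derivatives, continuous
    representatives *)

Section LebesguePoints.
Context {R : realType}.
Local Notation mu := (@lebesgue_measure R).
Local Notation locint := (locally_integrable setT).
Implicit Types (f g h phi B : R -> R).

Lemma EFin_Rintegral (D : set R) f : measurable D -> mu.-integrable D (EFin \o f) ->
  (\int[mu]_(x in D) f x)%:E = (\int[mu]_(x in D) (f x)%:E)%E.
Proof. by move=> mD fi; rewrite /Rintegral fineK//; exact: integrable_fin_num. Qed.

Lemma integrable_add (D : set R) f g : measurable D -> mu.-integrable D (EFin \o f) ->
  mu.-integrable D (EFin \o g) -> mu.-integrable D (EFin \o (fun x => f x + g x)).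
Proof. by move=> mD fi gi; apply: (integrableD _ fi gi). Qed.

Lemma integrable_sub (D : set R) f g : measurable D -> mu.-integrable D (EFin \o f) ->
  mu.-integrable D (EFin \o g) -> mu.-integrable D (EFin \o (fun x => f x - g x)).
Proof. by move=> mD fi gi; apply: (integrableB _ fi gi). Qed.

Lemma Rintegral_cst_itv (c a b : R) : a <= b -> \int[mu]_(x in `[a, b]) c = c * (b - a).
Proof.
move=> ab; rewrite Rintegral_cst; last exact: measurable_itv.
congr (_ * _).
have E : lebesgue_measure (`[a, b]%classic : set R) = (b - a)%:E.
  rewrite lebesgue_measure_itv/= lte_fin; case: ltP => // ba.
  by rewrite (le_anti (introT andP (conj ab ba))) subrr.
exact: (congr1 fine E).
Qed.

(* The existence of such a function is not assumed: [step_of] below builds one from a cutoff [chi n]. *)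
Definition smooth_step B := [/\ smooth B, forall x, x <= 3^-1 -> B x = 0,
  forall x, 2 / 3 <= x -> B x = 1 & forall x, 0 <= B x <= 1].

Lemma derive1_eq0_near f (x c : R) : (\forall y \near x, f y = c) -> derive1 f x = 0.
Proof.
move=> H; have /(_ 1%N) := near_derive1n (g := fun=> c) _ H.
by move=> /nbhs_singleton; rewrite !derive1n1 derive1_cst.
Qed.

Lemma smooth_step_derive_out B (x : R) : smooth_step B -> ~~ (0 < x < 1) -> derive1 B x = 0.
Proof.
move=> [sB B0 B1 _]; rewrite negb_and -!leNgt => /orP[x0|x1].
  apply: (@derive1_eq0_near _ _ 0).
  have x0' : x < 3^-1 by apply: (le_lt_trans x0); rewrite invr_gt0.
  apply: filterS (open_nbhs_nbhs (conj (@open_lt _ 3^-1) x0')) => t /= t0.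
  by apply: B0; exact: ltW.
apply: (@derive1_eq0_near _ _ 1).
have x1' : 2 / 3 < x by apply: lt_le_trans x1; lra.
apply: filterS (open_nbhs_nbhs (conj (@open_gt _ (2 / 3)) x1')) => t /= t0.
by apply: B1; exact: ltW.
Qed.

Lemma smooth_step_derive_bounded B : smooth_step B -> exists2 M : R, 0 < M & forall x, `|derive1 B x| <= M.
Proof.
move=> sB; have [sB0 _ _ _] := sB.
have [C HC] := continuous_bounded_itv 0 1 (smooth_continuous (smooth_derive1 sB0)).
exists (Num.max C 1); first by rewrite lt_max ltr01 orbT.
move=> x; rewrite le_max; case: (boolP (0 < x < 1)) => [/andP[x0 x1]|/(smooth_step_derive_out sB) ->].
  by rewrite HC// !ltW.
by rewrite normr0 ler01 orbT.
Qed.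

(** A one-sided mollifier: B' rescaled to [y, y + e], of integral 1. Its primitive is a rescaled
    step, so that testing against a difference of steps produces two mollifications. *)
Definition stepker B (e y : R) := derive1 (fun x => B (e^-1 * x + - (e^-1 * y))).

Lemma stepkerE B (e y x : R) : smooth_step B ->
  stepker B e y x = e^-1 * derive1 B (e^-1 * x + - (e^-1 * y)).
Proof.
move=> [sB _ _ _]; have := derive1n_affine 1 (e^-1) (- (e^-1 * y)) sB.
by rewrite derive1n1 derive1n1 expr1 /stepker => ->.
Qed.

Lemma smooth_stepker B (e y : R) : smooth_step B -> smooth (stepker B e y).
Proof. by move=> [sB _ _ _]; apply: smooth_derive1; exact: smooth_affine. Qed.

Lemma stepker_out B (e y x : R) : smooth_step B -> 0 < e -> ~~ (y <= x <= y + e) ->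
  stepker B e y x = 0.
Proof.
move=> sB e0 H; rewrite stepkerE// (smooth_step_derive_out sB) ?mulr0//.
apply: contra H; rewrite -mulrBr => /andP[]; rewrite pmulr_rgt0 ?invr_gt0// subr_gt0 => /ltW ->.
by rewrite mulrC ltr_pdivrMr// mul1r ltrBlDl => /ltW ->.
Qed.

Lemma integral_stepker B (e y : R) : smooth_step B -> 0 < e ->
  \int[mu]_(x in `[y, y + e]) stepker B e y x = 1.
Proof.
move=> sB e0; have [sB0 B0 B1 _] := sB.
have sF := @smooth_affine _ _ (e^-1) (- (e^-1 * y)) sB0.
rewrite /Rintegral.
rewrite (@continuous_FTC2 _ (stepker B e y) (fun x => B (e^-1 * x + - (e^-1 * y)))).
- have -> : B (e^-1 * y - e^-1 * y) = 0 by rewrite subrr B0// invr_ge0.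
  have -> : e^-1 * (y + e) - e^-1 * y = 1 by field; rewrite gt_eqF.
  rewrite B1; last by lra.
  by rewrite sube0.
- by rewrite ltrDl.
- apply: continuous_subspaceT; apply: smooth_continuous; exact: smooth_stepker.
- split.
  + by move=> x _; exact: smooth_derivable sF.
  + by apply: cvg_at_right_filter; exact: (smooth_continuous sF).
  + by apply: cvg_at_left_filter; exact: (smooth_continuous sF).
- by [].
Qed.

Lemma stepker_le B (M e y x : R) : smooth_step B -> 0 < e -> (forall x, `|derive1 B x| <= M) ->
  `|stepker B e y x| <= M / e.
Proof.
move=> sB e0 HM; rewrite stepkerE// normrM (@ger0_norm _ e^-1) ?invr_ge0 1?mulrC; last exact: ltW.
by rewrite ler_pM2r ?invr_gt0.
Qed.

Lemma test_stepker B (e y : R) : smooth_step B -> 0 < e -> test_function (stepker B e y).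
Proof.
move=> sB e0; apply/test_functionP; split; first exact: smooth_stepker.
exists (`|y| + e) => x Hx; apply: stepker_out => //; apply: contraTN Hx => /andP[yx xy].
rewrite -leNgt ler_norml; apply/andP; split.
  rewrite lerNl; have := ler_norm (- y); rewrite normrN => H.
  by rewrite (le_trans _ (_ : - y <= _))// ?lerN2// (le_trans H)// lerDl ltW.
by rewrite (le_trans xy)// lerD2r ler_norm.
Qed.

Lemma lebesgue_pt_itv f (y d : R) : locint f -> lebesgue_pt f y -> 0 < d ->
  exists2 r0 : R, 0 < r0 & forall r, 0 < r < r0 ->
    \int[mu]_(s in `[y, y + r]) `|f s - f y| <= d * r.
Proof.
move=> lf fy d0.
have d4 : (0 < (d / 4)%:E)%E by rewrite lte_fin divr_gt0.
have /= [r0 /= r00 H] := fy _ (open_nbhs_nbhs (conj (@open_ereal_lt_ereal _ (d / 4)%:E) d4)).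
exists (r0 / 2); first by rewrite divr_gt0.
move=> r /andP[rp rr0].
(* The open ball has radius 2 r so that it contains the closed interval [y, y + r]; its measure 4 r
   is the reason for d / 4 above. *)
have /= := H (2 * r).
rewrite /ball/= sub0r normrN ger0_norm; last by rewrite mulr_ge0 ?ltW.
rewrite mulrC -ltr_pdivlMr// => /(_ rr0).
rewrite mulr_gt0// => /(_ isT).
rewrite mulrC /davg /iavg lebesgue_measure_ball; last by rewrite mulr_ge0 ?ltW.
have r2 : 0 < (2 * r) *+ 2 by rewrite mulrn_wgt0// mulr_gt0.
rewrite inver gt_eqF// lte_pdivrMl// -EFinM => H1.
have lc : locint (fun s => f s - f y) by apply: locintD => //; exact: locint_cst.
have ilc a b : mu.-integrable `[a, b] (EFin \o (fun s => `|f s - f y|)).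
  by apply: integrable_normr; [exact: measurable_itv|exact: locint_itv].
rewrite -lee_fin EFin_Rintegral//.
have -> : d * r = (2 * r) *+ 2 * (d / 4) by lra.
apply: le_trans (ltW H1).
apply: ge0_subset_integral => //.
- exact: measurable_ball.
- apply/measurable_EFinP; apply: measurable_funTS; apply: measurableT_comp => //.
  exact: locint_measurable.
- move=> x /=; rewrite in_itv/= /ball/= => /andP[yx xyr].
  by rewrite distrC ger0_norm ?subr_ge0// ltrBlDl (le_lt_trans xyr)// ltrD2l ltr_pMl// ltr1n.
Qed.

(** The kernel has integral 1 and height at most M / r, so the error is at most M times the mean of
    |f - f y| over [y, y + r], which is small at a Lebesgue point. *)
Lemma stepker_cvg B f (y d : R) : smooth_step B -> locint f -> lebesgue_pt f y -> 0 < d ->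
  exists2 r0 : R, 0 < r0 & forall r, 0 < r < r0 ->
    `|\int[mu]_s (f s * stepker B r y s) - f y| <= d.
Proof.
move=> sB lf fy d0; have [M M0 HM] := smooth_step_derive_bounded sB.
have [r0 r00 H] := lebesgue_pt_itv lf fy (divr_gt0 d0 M0).
exists r0 => // r /[dup] /H Hr /andP[rp _].
have mI : measurable `[y, y + r]%classic by exact: measurable_itv.
have sk0 x : x \notin `[y, y + r] -> stepker B r y x = 0.
  by move=> ?; apply: stepker_out.
have -> : \int[mu]_s (f s * stepker B r y s) = \int[mu]_(s in `[y, y + r]) (f s * stepker B r y s).
  rewrite [RHS]Rintegral_mkcond; apply: eq_Rintegral => x _; rewrite patchE; case: ifPn => //.
  by rewrite mem_setE => /sk0 ->; rewrite mulr0.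
have lsk : continuous (stepker B r y) by exact/smooth_continuous/smooth_stepker.
have I1 := locint_itv y (y + r) (locint_mul_continuous lf lsk).
have I2 := locint_itv y (y + r) (locint_mul_continuous (locint_cst (f y)) lsk).
have -> : f y = \int[mu]_(s in `[y, y + r]) (f y * stepker B r y s).
  rewrite RintegralZl//; last exact/locint_itv/locint_continuous.
  by rewrite integral_stepker// mulr1.
rewrite -RintegralB//; apply: (le_trans (le_normr_Rintegral _ _)) => //.
  exact: integrable_sub.
have lc : locint (fun s => f s - f y) by apply: locintD => //; exact: locint_cst.
apply: (@le_trans _ _ (\int[mu]_(s in `[y, y + r]) (M / r * `|f s - f y|))).
  apply: le_Rintegral => //.
  - apply: integrable_normr => //; exact: integrable_sub.
  - by apply: integrable_scale => //; apply: integrable_normr => //; exact: locint_itv.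
  - by move=> x _; rewrite -mulrBl normrM mulrC ler_wpM2r// stepker_le.
rewrite RintegralZl//; last by apply: integrable_normr => //; exact: locint_itv.
apply: (@le_trans _ _ (M / r * (d / M * r))); first by rewrite ler_pM2l// divr_gt0.
by rewrite (_ : _ * _ = d)//; field; rewrite !gt_eqF.
Qed.

(* The rescaled derivatives of a step function form an approximate identity, which converges at
   every Lebesgue point. *)
Lemma weak_zero_ae B h : smooth_step B -> locint h ->
  (forall phi, test_function phi -> \int[mu]_x (h x * phi x) = 0) ->
  {ae mu, forall x, h x = 0}.
Proof.
move=> sB lh H; apply: (ae_imp _ (lebesgue_differentiation lh)) => y hy.
apply/eqP; rewrite -normr_eq0; apply/eqP/le_anti; rewrite normr_ge0 andbT.
apply/ler_addgt0Pl => d d0; rewrite addr0.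
have [r0 r00 /(_ (r0 / 2))] := stepker_cvg sB lh hy d0.
rewrite H; last by apply: test_stepker => //; rewrite divr_gt0.
rewrite sub0r normrN; apply; rewrite divr_gt0//= ltr_pdivrMr//; lra.
Qed.

Lemma wder_unique B j f g g' : smooth_step B -> wder j f g -> wder j f g' ->
  {ae mu, forall x, g x = g' x}.
Proof.
move=> sB [lf lg H] [_ lg' H'].
have lh : locint (fun x => g x - g' x) by exact: locally_integrableB.
apply: (ae_imp _ (weak_zero_ae sB lh _)) => [x /eqP|phi tphi]; first by rewrite subr_eq0 => /eqP.
have -> : \int[mu]_x ((g x - g' x) * phi x) = \int[mu]_x (g x * phi x) - \int[mu]_x (g' x * phi x).
  rewrite -RintegralB//; [|exact: integrable_test|exact: integrable_test].
  by apply: eq_Rintegral => x _; rewrite mulrBl.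
have := H phi tphi; rewrite H'// => /(congr1 (fun t => (-1) ^+ j * t)).
by rewrite !mulrA -exprD addnn -mul2n exprM sqrrN expr1n expr1n !mul1r => ->; rewrite subrr.
Qed.

Lemma lebesgue_pt_small g (u d : R) : locint g -> lebesgue_pt g u -> 0 < d ->
  exists2 r0 : R, 0 < r0 & forall r, 0 < r < r0 ->
    \int[mu]_(s in `[u, u + r]) `|g s| <= d.
Proof.
move=> lg gu d0.
have [r0 r00 Hr] := lebesgue_pt_itv lg gu ltr01.
have G0 : 0 < 1 + `|g u| by rewrite ltr_wpDr.
exists (Num.min r0 (d / (1 + `|g u|))); first by rewrite lt_min r00 divr_gt0.
move=> r /andP[rp]; rewrite lt_min => /andP[rr0 rd].
have mI : measurable `[u, u + r]%classic by exact: measurable_itv.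
have lc : locint (fun s => g s - g u) by apply: locintD => //; exact: locint_cst.
have In (v : R -> R) : locint v -> mu.-integrable `[u, u + r] (EFin \o (fun s => `|v s|)).
  by move=> lv; apply: integrable_normr => //; exact: locint_itv.
apply: (@le_trans _ _ (\int[mu]_(s in `[u, u + r]) (`|g s - g u| + `|g u|))).
  apply: le_Rintegral => //.
  - exact: In.
  - by apply: integrable_add => //; [exact: In|exact: (In (cst (g u)) (locint_cst _))].
  - by move=> s _; rewrite -{1}(subrK (g u) (g s)) ler_normD.
rewrite RintegralD//; [|exact: In|exact: (In (cst (g u)) (locint_cst _))].
apply: (@le_trans _ _ (1 * r + `|g u| * r)).
  apply: lerD; first by apply: Hr; rewrite rp.
  have ur : u <= u + r by rewrite lerDl ltW.
  by rewrite (Rintegral_cst_itv _ ur) addrAC subrr add0r.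
by rewrite -mulrDl mulrC -ler_pdivlMr// ltW.
Qed.

(** Outside the flanks [x, x + r] and [y, y + r] both steps are known and the difference is exact;
    on the flanks it is at most 1. The flanks may overlap. *)
Lemma trapezoid_indic_bound (b1 b2 x y r s : R) : 0 < r -> x < y ->
  0 <= b1 <= 1 -> 0 <= b2 <= 1 -> (s <= x -> b1 = 0) -> (x + r <= s -> b1 = 1) ->
  (s <= y -> b2 = 0) -> (y + r <= s -> b2 = 1) ->
  `|(b1 - b2) - (x <= s <= y)%R%:R| <= (x <= s <= x + r)%R%:R + (y <= s <= y + r)%R%:R.
Proof.
move=> r0 xy /andP[b10 b11] /andP[b20 b21] X0 X1 Y0 Y1.
have [sx|xs] := ltP s x.
  have sy : s < y by exact: lt_trans sx xy.
  by rewrite (X0 (ltW sx)) (Y0 (ltW sy)) (leNgt y s) sy /= !subr0 normr0 addr0.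
have := ler0n R (y <= s <= y + r)%R; have := ler0n R (s <= x + r)%R.
set p := (s <= x + r)%R%:R; set q := (y <= s <= y + r)%R%:R => p0 q0.
have [sy|ys] := leP s y.
  rewrite (Y0 sy) subr0 /= ler_norml /p.
  have [sxr|xrs] := leP s (x + r).
    by rewrite mulr1n; apply/andP; split; lra.
  by rewrite (X1 (ltW xrs)) mulr1n mulr0n; apply/andP; split; lra.
rewrite /= mulr0n subr0 ler_norml /q (ltW ys) /=.
have [syr|yrs] := leP s (y + r).
  by rewrite mulr1n -/p; apply/andP; split; lra.
have xrs : x + r <= s by lra.
by rewrite (X1 xrs) (Y1 (ltW yrs)) mulr0n -/p; apply/andP; split; lra.
Qed.

(* The weak derivative is tested against a trapezoid (a difference of two steps) approximating
   the indicator of [x, y]. *)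
Lemma wder1_increment B f g (x y : R) : smooth_step B -> wder 1 f g -> x < y ->
  lebesgue_pt f x -> lebesgue_pt f y -> lebesgue_pt g x -> lebesgue_pt g y ->
  f y - f x = \int[mu]_(s in `[x, y]) g s.
Proof.
move=> sB [lf lg H] xy fx fy gx gy.
apply/eqP; rewrite -subr_eq0 -normr_eq0; apply/eqP/le_anti; rewrite normr_ge0 andbT.
apply/ler_addgt0Pl => d d0; rewrite addr0.
have d8 : 0 < d / 4 by rewrite divr_gt0.
have [r1 r10 H1] := stepker_cvg sB lf fx d8.
have [r2 r20 H2] := stepker_cvg sB lf fy d8.
have small u : lebesgue_pt g u -> exists2 r0 : R, 0 < r0 & forall r, 0 < r < r0 ->
    \int[mu]_(s in `[u, u + r]) `|g s| <= d / 4.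
  by move=> gu; exact: lebesgue_pt_small.
have [r3 r30 H3] := small _ gx.
have [r4 r40 H4] := small _ gy.
pose r := Num.min (Num.min r1 r2) (Num.min r3 r4) / 2.
have m0 : 0 < Num.min (Num.min r1 r2) (Num.min r3 r4) by rewrite !lt_min r10 r20 r30 r40.
have rp : 0 < r by rewrite divr_gt0.
have : r < Num.min (Num.min r1 r2) (Num.min r3 r4) by rewrite ltr_pdivrMr// ltr_pMr// ltr1n.
rewrite !lt_min => /andP[/andP[rr1 rr2] /andP[rr3 rr4]].
have {}H1 := H1 r; have {}H2 := H2 r; have {}H3 := H3 r; have {}H4 := H4 r.
rewrite rp rr1 in H1; rewrite rp rr2 in H2; rewrite rp rr3 in H3; rewrite rp rr4 in H4.
have {}H1 := H1 isT; have {}H2 := H2 isT; have {}H3 := H3 isT; have {}H4 := H4 isT.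
pose bx (s : R) := B (r^-1 * s + - (r^-1 * x)).
pose by' (s : R) := B (r^-1 * s + - (r^-1 * y)).
have [sB0 B0 B1 B01] := sB.
have sbx : smooth bx by exact: smooth_affine.
have sby : smooth by' by exact: smooth_affine.
have stepl u s : s <= u -> B (r^-1 * s + - (r^-1 * u)) = 0.
  move=> su; apply: B0; rewrite -mulrBr; apply: (@le_trans _ _ 0); last by rewrite invr_ge0.
  by rewrite mulr_ge0_le0 ?invr_ge0 ?subr_le0// ltW.
have stepr u s : u + r <= s -> B (r^-1 * s + - (r^-1 * u)) = 1.
  move=> su; apply: B1; rewrite -mulrBr; apply: (@le_trans _ _ 1); first by lra.
  by rewrite mulrC ler_pdivlMr// mul1r lerBrDl.
pose phi (s : R) := bx s - by' s.
have tphi : test_function phi.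
  apply/test_functionP; split; first exact: smoothB.
  exists (`|x| + `|y| + r) => s Hs; rewrite /phi.
  have [s0|s0] := leP 0 s.
    rewrite (ger0_norm s0) in Hs.
    have -> : bx s = 1.
      by apply: stepr; rewrite (le_trans _ (ltW Hs))// lerD2r (le_trans (ler_norm x))// lerDl.
    have -> : by' s = 1.
      by apply: stepr; rewrite (le_trans _ (ltW Hs))// lerD2r (le_trans (ler_norm y))// lerDr.
    by rewrite subrr.
  rewrite (ltr0_norm s0) in Hs.
  have Hs' : `|x| + `|y| <= - s by apply: le_trans (ltW Hs); rewrite lerDl ltW.
  have -> : bx s = 0.
    apply: stepl; rewrite -lerN2 (le_trans _ Hs')// (le_trans (ler_norm (- x)))// normrN lerDl//.
  have -> : by' s = 0.
    apply: stepl; rewrite -lerN2 (le_trans _ Hs')// (le_trans (ler_norm (- y)))// normrN lerDr//.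
  by rewrite subrr.
have E := H phi tphi.
rewrite derive1n1 expr1 mulN1r in E.
have dphi s : derive1 phi s = stepker B r x s - stepker B r y s.
  have Dx := is_derive1E (@smooth_derivable _ bx s sbx).
  have Dy := is_derive1E (@smooth_derivable _ by' s sby).
  apply: is_derive_derive1.
have tk u : test_function (stepker B r u) by exact: test_stepker.
have E1 : \int[mu]_s (f s * derive1 phi s) =
    \int[mu]_s (f s * stepker B r x s) - \int[mu]_s (f s * stepker B r y s).
  rewrite -RintegralB//; [|exact: integrable_test|exact: integrable_test].
  by apply: eq_Rintegral => s _; rewrite dphi mulrBr.
rewrite {}E1 in E.
have E2 : `|\int[mu]_s (g s * phi s) - \int[mu]_(s in `[x, y]) g s| <= d / 4 + d / 4.
  have mI (u v : R) : measurable `[u, v]%classic by exact: measurable_itv.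
  have iR (u v : R) (w : R -> R) : locint w -> mu.-integrable setT (EFin \o (w \_ `[u, v])).
    move=> lw; rewrite -restrict_EFin; apply/(integrable_mkcond _ _).1; first exact: mI.
    exact: locint_itv.
  have ln : locint (fun s => `|g s|).
    apply/locintP; split; first by apply: measurableT_comp => //; exact: locint_measurable.
    by move=> a b; apply: integrable_normr => //; exact: locint_itv.
  rewrite [X in _ - X]Rintegral_mkcond -RintegralB//; [|exact: integrable_test|exact: iR].
  apply: (le_trans (le_normr_Rintegral _ _)) => //.
    by apply: integrable_sub => //; [exact: integrable_test|exact: iR].
  apply: (@le_trans _ _ (\int[mu]_s (((fun s => `|g s|) \_ `[x, x + r]) s + ((fun s => `|g s|) \_ `[y, y + r]) s))).
    apply: le_Rintegral => //.
    - by apply: integrable_normr => //; apply: integrable_sub => //; [exact: integrable_test|exact: iR].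
    - by apply: integrable_add => //; exact: iR.
    move=> s _.
    have T := trapezoid_indic_bound rp xy (B01 (r^-1 * s + - (r^-1 * x)))
      (B01 (r^-1 * s + - (r^-1 * y))) (stepl x s) (stepr x s) (stepl y s) (stepr y s).
    have pE (w : R -> R) (a b : R) : (w \_ `[a, b]) s = w s * (a <= s <= b)%R%:R.
      by rewrite patchE mem_setE in_itv/=; case: ifP => _; rewrite (mulr1,mulr0).
    by rewrite !pE -mulrBr -mulrDr normrM ler_wpM2l.
  rewrite RintegralD//; [|exact: iR|exact: iR].
  by rewrite -!Rintegral_mkcond; exact: lerD.
clear -H1 H2 E2 E; move: H1 H2 E2 E.
set p := \int[mu]_s (f s * stepker B r x s); set q := \int[mu]_s (f s * stepker B r y s).
set t := \int[mu]_x (g x * phi x); set w := \int[mu]_(s in `[x, y]) g s.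
by rewrite !ler_norml => /andP[? ?] /andP[? ?] /andP[? ?] ?; apply/andP; split; lra.
Qed.


Lemma Rintegral_itv_cat g (a b c : R) : locint g -> a <= b -> b <= c ->
  \int[mu]_(s in `[a, c]) g s = \int[mu]_(s in `[a, b]) g s + \int[mu]_(s in `[b, c]) g s.
Proof.
move=> lg ab bc; have := @Rintegral_itvB R g (BLeft a) (BRight c) b (locint_itv a c lg).
rewrite !bnd_simp => /(_ ab bc) E.
rewrite -(@Rintegral_itv_obnd_cbnd _ b (BRight c)).
  by rewrite -E addrC subrK.
apply: integrableS (locint_itv b c lg); [exact: measurable_itv|exact: measurable_itv|].
by apply: subset_itvr; rewrite bnd_simp.
Qed.

Lemma ae_exists (P : R -> Prop) : {ae mu, forall x, P x} -> exists x, P x.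
Proof.
move=> H; apply: contrapT => nP.
have [A [mA A0 HA]] := H.
have AT : A = setT.
  by apply/seteqP; split => // x _; apply: HA => /= Px; apply: nP; exists x.
have L : (mu `[0%R, 1%R]%classic <= mu A)%E.
  by apply: le_measure; rewrite ?inE//; rewrite AT.
have := L; rewrite A0 lebesgue_measure_itv/= lte_fin ltr01 -EFinB subr0 lee_fin ler10.
by [].
Qed.

(** Absolute continuity with density g. Only x <= y is considered, since the integral over a
    reversed interval is 0 here instead of changing sign. *)
Definition primitive_of f g := forall x y, x <= y -> f y - f x = \int[mu]_(s in `[x, y]) g s.

Lemma primitive_of_continuous f g : locint g -> primitive_of f g -> continuous f.
Proof.
move=> lg fg x.
have ab : x - 1 <= x + 1 by lra.
have := parameterized_integral_continuous ab (locint_itv _ _ lg).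
rewrite /parameterized_integral => H.
have {}H : {within `[x - 1, x + 1], continuous f}.
  apply: (@subspace_eq_continuous _ _ _ (fun y => f (x - 1) + \int[mu]_(s in `[x - 1, y]) g s)).
    move=> y; rewrite inE/= in_itv/= => /andP[xy _].
    by rewrite -(fg _ _ xy) addrC subrK.
  by move=> y; apply: cvgD; [exact: cvg_cst|exact: H].
have xo : x \in `]x - 1, x + 1[ by rewrite in_itv/=; apply/andP; split; lra.
by apply: (within_continuous_continuous _ H xo); lra.
Qed.

(** Between common Lebesgue points of f and g the increments of f are integrals of g; hence f agrees
    almost everywhere with the primitive of g that matches it at one such point x0. *)
Lemma continuous_version B f g : smooth_step B -> wder 1 f g ->
  exists2 F, {ae mu, forall x, f x = F x} & primitive_of F g.
Proof.
move=> sB w; have [lf lg _] := w.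
pose P x := lebesgue_pt f x /\ lebesgue_pt g x.
have aeP : {ae mu, forall x, P x}.
  by apply: (ae_imp2 _ (lebesgue_differentiation lf) (lebesgue_differentiation lg)).
have [x0 Px0] := ae_exists aeP.
(* The oriented integral from 0 to y: except at y = 0, one of the two intervals is empty. *)
pose G y := \int[mu]_(s in `[0, y]) g s - \int[mu]_(s in `[y, 0]) g s.
have e0 : \int[mu]_(s in `[0, 0]) g s = 0 by rewrite set_itv1 Rintegral_set1.
have out (a b : R) : b < a -> \int[mu]_(s in `[a, b]) g s = 0.
  by move=> ba; rewrite set_itv_ge ?Rintegral_set0// bnd_simp -ltNge.
have GE : primitive_of G g.
  move=> x y xy; rewrite /G.
  have [x0'|x0'] := leP 0 x.
    have y0 := le_trans x0' xy.
    rewrite (Rintegral_itv_cat lg x0' xy).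
    have Z t : 0 <= t -> \int[mu]_(s in `[t, 0]) g s = 0.
      by rewrite le_eqVlt => /predU1P[<-|/out].
    by rewrite !Z//; lra.
  rewrite (out 0 x)//.
  have [y0|y0] := leP 0 y.
    have Z t : 0 <= t -> \int[mu]_(s in `[t, 0]) g s = 0.
      by rewrite le_eqVlt => /predU1P[<-|/out].
    by rewrite Z// (Rintegral_itv_cat lg (ltW x0') y0); lra.
  by rewrite (out 0 y)// (Rintegral_itv_cat lg xy (ltW y0)); lra.
exists (fun y => f x0 - G x0 + G y); last by move=> x y xy; rewrite -(GE x y xy); lra.
apply: (ae_imp _ aeP) => x [fx gx]; have [fx0 gx0] := Px0.
have [xx0|xx0|->] := ltgtP x x0; last by lra.
  have := wder1_increment sB w xx0 fx fx0 gx gx0; rewrite -(GE _ _ (ltW xx0)); lra.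
have := wder1_increment sB w xx0 fx0 fx gx0 gx; rewrite -(GE _ _ (ltW xx0)); lra.
Qed.

End LebesguePoints.

(** * Sobolev and interpolation inequalities on the line *)

Section Sobolev.
Context {R : realType}.
Local Notation mu := (@lebesgue_measure R).
Local Notation locint := (locally_integrable setT).
Implicit Types (f g h F G : R -> R).

(** The integral of (|g| - A)^2 is nonnegative; the choice of A as the mean of |g| gives the
    inequality. *)
Lemma cauchy_schwarz_itv g (a b : R) : a < b -> locint g ->
  mu.-integrable `[a, b] (EFin \o (fun x => g x ^+ 2)) ->
  (\int[mu]_(x in `[a, b]) `|g x|) ^+ 2 <= (b - a) * \int[mu]_(x in `[a, b]) g x ^+ 2.
Proof.
move=> ab lg ig; have ba : 0 < b - a by rewrite subr_gt0.
have mI : measurable `[a, b]%classic by exact: measurable_itv.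
have ing : mu.-integrable `[a, b] (EFin \o (fun x => `|g x|)).
  by apply: integrable_normr => //; exact: locint_itv.
set I := \int[mu]_(x in `[a, b]) `|g x|.
pose A := I / (b - a).
have iA : mu.-integrable `[a, b] (EFin \o (fun x => (2 * A) * `|g x|)) by exact: integrable_scale.
have ic : mu.-integrable `[a, b] (EFin \o (fun=> A ^+ 2)).
  exact: (locint_itv a b (locint_cst (A ^+ 2))).
have : 0 <= \int[mu]_(x in `[a, b]) (g x ^+ 2 - (2 * A) * `|g x| + A ^+ 2).
  apply: Rintegral_ge0 => x _; rewrite -(real_normK (num_real (g x))).
  have -> : `|g x| ^+ 2 - 2 * A * `|g x| + A ^+ 2 = (`|g x| - A) ^+ 2 by ring.
  exact: sqr_ge0.
rewrite RintegralD//; last exact: integrable_sub.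
rewrite RintegralB// RintegralZl// -/I Rintegral_cst_itv ?(ltW ab)//.
have -> : A ^+ 2 * (b - a) = A * I by rewrite /A expr2 -!mulrA mulVf ?mulr1 ?gt_eqF// mulrC.
rewrite -(ler_pM2l ba).
have -> : (b - a) * (\int[mu]_(x in `[a, b]) (g x ^+ 2) - 2 * A * I + A * I) =
  (b - a) * \int[mu]_(x in `[a, b]) (g x ^+ 2) - I ^+ 2.
  by rewrite /A; field; rewrite gt_eqF.
by rewrite mulr0 subr_ge0.
Qed.

Lemma sqr_le_norm (u H : R) : `|u| <= H -> u ^+ 2 <= H ^+ 2.
Proof.
move=> uH; rewrite -(real_normK (num_real u)) ler_pXn2r ?nnegrE//.
exact: le_trans uH.
Qed.

Lemma primitive_of_diff_le F g (a b x y : R) : locint g -> primitive_of F g ->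
  a <= x <= b -> a <= y <= b -> `|F x - F y| <= \int[mu]_(s in `[a, b]) `|g s|.
Proof.
move=> lg Fg.
wlog xy : x y / x <= y.
  move=> H xab yab; have [xy|yx] := leP x y; first exact: H.
  by rewrite distrC; apply: H => //; exact: ltW.
move=> /andP[ax xb] /andP[ay yb]; rewrite distrC Fg//.
have mI (u v : R) : measurable `[u, v]%classic by exact: measurable_itv.
have ing (u v : R) : mu.-integrable `[u, v] (EFin \o (fun x => `|g x|)).
  by apply: integrable_normr => //; exact: locint_itv.
apply: (le_trans (le_normr_Rintegral _ _)) => //; first exact: locint_itv.
have ln : locint (fun x => `|g x|).
  by apply/locintP; split => //; apply: measurableT_comp => //; exact: locint_measurable.
rewrite (Rintegral_itv_cat ln ax xb) (Rintegral_itv_cat ln xy yb).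
have p (u v : R) : 0 <= \int[mu]_(s in `[u, v]) `|g s| by exact: Rintegral_ge0.
by rewrite addrCA lerDl addr_ge0.
Qed.

(** F x differs from every F y on the interval by at most the integral of |g|; square, use
    Cauchy-Schwarz and average over y in the interval, which has length 1. *)
Lemma sobolev_itv F g (a x : R) : locint g -> primitive_of F g ->
  mu.-integrable `[a, a + 1] (EFin \o (fun x => g x ^+ 2)) -> a <= x <= a + 1 ->
  F x ^+ 2 <= 2 * \int[mu]_(s in `[a, a + 1]) (F s ^+ 2) + 2 * \int[mu]_(s in `[a, a + 1]) (g s ^+ 2).
Proof.
move=> lg Fg ig xa.
have cF : continuous F by exact: primitive_of_continuous Fg.
have mI (u v : R) : measurable `[u, v]%classic by exact: measurable_itv.
have a1 : a < a + 1 by rewrite ltrDl.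
have iF : mu.-integrable `[a, a + 1] (EFin \o (fun x => F x ^+ 2)).
  apply: locint_itv; apply: locint_continuous => y.
  by apply: continuousM; exact: cF.
set H := \int[mu]_(s in `[a, a + 1]) `|g s|.
have HH : H ^+ 2 <= \int[mu]_(s in `[a, a + 1]) (g s ^+ 2).
  by have := cauchy_schwarz_itv a1 lg ig; rewrite addrAC subrr add0r mul1r.
have pt y : a <= y <= a + 1 -> F x ^+ 2 <= 2 * F y ^+ 2 + 2 * H ^+ 2.
  move=> ya; have := sqr_le_norm (primitive_of_diff_le lg Fg xa ya); rewrite -/H => h.
  have := sqr_ge0 (F x - 2 * F y).
  have -> : (F x - 2 * F y) ^+ 2 = 2 * F y ^+ 2 + 2 * (F x - F y) ^+ 2 - F x ^+ 2 by ring.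
  by rewrite subr_ge0 => h2; apply: (le_trans h2); rewrite lerD2l ler_pM2l.
have ci (c : R) : mu.-integrable `[a, a + 1] (EFin \o (fun=> c)) by exact: (locint_itv _ _ (locint_cst c)).
have : \int[mu]_(s in `[a, a + 1]) (F x ^+ 2) <= \int[mu]_(s in `[a, a + 1]) (2 * F s ^+ 2 + 2 * H ^+ 2).
  apply: le_Rintegral => //.
    by apply: integrable_add => //; exact: integrable_scale.
rewrite RintegralD//; last exact: integrable_scale.
rewrite RintegralZl// !Rintegral_cst_itv ?(ltW a1)// addrAC subrr add0r !mulr1 => h.
by apply: le_trans h _; rewrite lerD2l ler_pM2l.
Qed.

(* Taylor on [x, x + d]: d G(x) = F(x + d) - F(x) - error, the error being controlled by h. *)
Lemma interpolation_pointwise F G h (d x : R) : 0 < d -> locint h ->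
  primitive_of F G -> primitive_of G h ->
  mu.-integrable `[x, x + d] (EFin \o (fun x => h x ^+ 2)) ->
  d ^+ 2 * G x ^+ 2 <= 3 * (F (x + d) ^+ 2 + F x ^+ 2 +
    d ^+ 3 * \int[mu]_(s in `[x, x + d]) (h s ^+ 2)).
Proof.
move=> d0 lh FG Gh ih.
have xd : x < x + d by rewrite ltrDl.
have mI (u v : R) : measurable `[u, v]%classic by exact: measurable_itv.
have cG : continuous G by exact: primitive_of_continuous Gh.
have lG : locint G by exact: locint_continuous.
set H := \int[mu]_(s in `[x, x + d]) `|h s|.
have HH : H ^+ 2 <= d * \int[mu]_(s in `[x, x + d]) (h s ^+ 2).
  by have := cauchy_schwarz_itv xd lh ih; rewrite addrAC subrr add0r.
have ci (c : R) : mu.-integrable `[x, x + d] (EFin \o (fun=> c)) by exact: (locint_itv _ _ (locint_cst c)).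
have iG : mu.-integrable `[x, x + d] (EFin \o G) by exact: locint_itv.
have E : `|F (x + d) - F x - d * G x| <= d * H.
  rewrite (FG _ _ (ltW xd)).
  have -> : d * G x = \int[mu]_(s in `[x, x + d]) G x.
    by rewrite Rintegral_cst_itv ?(ltW xd)// addrAC subrr add0r mulrC.
  rewrite -RintegralB//; apply: (le_trans (le_normr_Rintegral _ _)) => //.
    exact: integrable_sub.
  apply: (@le_trans _ _ (\int[mu]_(s in `[x, x + d]) H)).
    apply: le_Rintegral => //; first by apply: integrable_normr => //; exact: integrable_sub.
    move=> y /=; rewrite in_itv/= => xy; apply: (primitive_of_diff_le lh Gh) => //.
    by rewrite lexx ltW.
  by rewrite Rintegral_cst_itv ?(ltW xd)// addrAC subrr add0r mulrC.
have {}E := sqr_le_norm E.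
have K : (d * H) ^+ 2 <= d ^+ 3 * \int[mu]_(s in `[x, x + d]) (h s ^+ 2).
  rewrite exprMn (exprSr d 2) -mulrA; apply: ler_wpM2l => //; exact: sqr_ge0.
move: E K; set u := d ^+ 3 * _; set p := F (x + d); set q := F x; set r := d * G x => E K.
rewrite -exprMn -/r.
have L : (p - q - r) ^+ 2 <= u by exact: le_trans K.
(* Writing r = p - q - (p - q - r), this is (a + b + c)^2 <= 3 (a^2 + b^2 + c^2) with its exact
   remainder. *)
have -> : r ^+ 2 = 3 * (p ^+ 2 + q ^+ 2 + (p - q - r) ^+ 2) -
    ((p + q) ^+ 2 + (p + (p - q - r)) ^+ 2 + (q - (p - q - r)) ^+ 2) by ring.
apply: (@le_trans _ _ (3 * (p ^+ 2 + q ^+ 2 + (p - q - r) ^+ 2))).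
  by rewrite gerBl !addr_ge0// sqr_ge0.
by rewrite ler_pM2l// lerD2l.
Qed.

Lemma measurable_fun_restr (D : set R) (u : R -> \bar R) : measurable D ->
  measurable_fun setT u -> measurable_fun setT (u \_ D).
Proof.
move=> mD mu'; have H := @measurable_restrictT _ _ _ _ D u mD.
by apply: H.1; exact: measurable_funTS.
Qed.

(** With s = x + t the window becomes the fixed set of t in [0, d]; Tonelli and translation
    invariance give the factor d. *)
Lemma integral_window (u : R -> \bar R) (d : R) : 0 < d ->
  measurable_fun setT u -> (forall x, 0 <= u x)%E ->
  (measurable_fun setT (fun x : R => \int[mu]_(s in `[x, (x + d)%R]) u s) /\
   \int[mu]_x \int[mu]_(s in `[x, (x + d)%R]) u s = d%:E * \int[mu]_x u x)%E.
Proof.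
move=> d0 mu' u0.
pose k (p : measurableTypeR R * measurableTypeR R) : \bar R := (u (p.1 + p.2)%R * (\1_`[0, d] p.2)%:E)%E.
have mk : measurable_fun setT k.
  apply: emeasurable_funM.
    by apply: (measurableT_comp mu'); apply: measurable_funD.
  apply/measurable_EFinP; apply: measurableT_comp => //; exact: measurable_indic.
have k0 p : (0 <= k p)%E by rewrite mule_ge0// lee_fin indicE.
have kE x : (\int[mu]_(s in `[x, (x + d)%R]) u s = \int[mu]_s k (x, s))%E.
  have mr : measurable_fun setT (u \_ `[x, (x + d)%R]).
    exact: (measurable_fun_restr (measurable_itv _) mu').
  have r0 s : (0 <= (u \_ `[x, (x + d)%R]) s)%E by rewrite patchE; case: ifP.
  rewrite integral_mkcond -(ge0_integral_addr x mr r0).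
  apply: eq_integral => s _; rewrite patchE mem_setE /k/= indicE mem_setE !in_itv/=.
  rewrite lerDr addrC lerD2l addrC.
  by case: ifP => _; rewrite ?mule1 ?mule0 1?addrC.
have E : (fun x : R => \int[mu]_(s in `[x, (x + d)%R]) u s)%E = fun x => (\int[mu]_s k (x, s))%E.
  by apply/funext => x; exact: kE.
split.
  by rewrite E; apply: (@measurable_fun_fubini_tonelli_F _ _ _ _ R (@lebesgue_measure R) k).
rewrite E.
rewrite (@fubini_tonelli _ _ _ _ R (@lebesgue_measure R) (@lebesgue_measure R) k mk k0).
have -> : (fun y => \int[mu]_x k (x, y))%E = (fun y => (\int[mu]_x u x) * (\1_`[0, d] y)%:E)%E.
  apply/funext => y; rewrite /k/= ge0_integralZr//; last exact: (measurable_fun_addr y mu').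
  by rewrite (ge0_integral_addr y).
have mi : measurable_fun setT (fun y : R => (\1_`[0, d] y : R)%:E).
  by apply/measurable_EFinP; exact: measurable_indic.
have i0 (y : R) : setT y -> (0 <= (\1_`[0, d] y : R)%:E)%E by rewrite lee_fin indicE.
have U0 : (0 <= \int[mu]_x u x)%E by apply: integral_ge0.
rewrite [LHS](_ : _ = (\int[mu]_x u x) * \int[mu]_y (\1_`[0, d] y : R)%:E)%E; last first.
  by apply: (ge0_integralZl (@lebesgue_measure R)).
have Ed : lebesgue_measure (`[0, d]%classic : set R) = d%:E.
  by rewrite lebesgue_measure_itv/= lte_fin d0 -EFinB subr0.
rewrite integral_indic// setIT muleC; congr (_ * _)%E; exact: Ed.
Qed.

Lemma integrable_sqr (D : set R) h : measurable D -> measurable_fun setT h ->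
  (\int[mu]_x (h x ^+ 2)%:E < +oo)%E -> mu.-integrable D (EFin \o (fun x => h x ^+ 2)).
Proof.
move=> mD mh hf.
have mh2 : measurable_fun setT (EFin \o (fun x => h x ^+ 2)).
  by apply/measurable_EFinP; apply: measurable_funX.
apply: (@integrableS _ _ _ mu setT) => //.
apply/integrableP; split=> //; apply: le_lt_trans hf.
by under eq_integral do rewrite /= ger0_norm ?sqr_ge0//.
Qed.

Lemma ge0_integral_scale_sum3 (a b c : R) (u v w : R -> \bar R) : 0 <= a -> 0 <= b -> 0 <= c ->
  measurable_fun setT u -> measurable_fun setT v -> measurable_fun setT w ->
  (forall x, 0 <= u x)%E -> (forall x, 0 <= v x)%E -> (forall x, 0 <= w x)%E ->
  (\int[mu]_x (a%:E * u x + b%:E * v x + c%:E * w x) =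
   a%:E * \int[mu]_x u x + b%:E * \int[mu]_x v x + c%:E * \int[mu]_x w x)%E.
Proof.
move=> a0 b0 c0 mu' mv mw u0 v0 w0.
have aE : (0 <= a%:E)%E by rewrite lee_fin.
have bE : (0 <= b%:E)%E by rewrite lee_fin.
have cE : (0 <= c%:E)%E by rewrite lee_fin.
rewrite ge0_integralD//; last 4 first.
- by move=> x _; rewrite adde_ge0// mule_ge0.
- by apply: emeasurable_funD; apply: measurable_funeM.
- by move=> x _; rewrite mule_ge0.
- exact: measurable_funeM.
rewrite ge0_integralD//; last 4 first.
- by move=> x _; rewrite mule_ge0.
- exact: measurable_funeM.
- by move=> x _; rewrite mule_ge0.
- exact: measurable_funeM.
by rewrite !ge0_integralZl.
Qed.

(** The pointwise inequality is integrated over x: F (x + d) and F x contribute 3 + 3 = 6, and the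
    window integral turns d^3 into d^4. *)
Lemma interpolation F G h (d : R) : 0 < d -> locint h ->
  primitive_of F G -> primitive_of G h -> (\int[mu]_x (h x ^+ 2)%:E < +oo)%E ->
  ((d ^+ 2)%:E * \int[mu]_x (G x ^+ 2)%:E <=
   6%:E * \int[mu]_x (F x ^+ 2)%:E + (3 * d ^+ 4)%:E * \int[mu]_x (h x ^+ 2)%:E)%E.
Proof.
move=> d0 lh FG Gh hoo.
have cG : continuous G by exact: primitive_of_continuous Gh.
have cF : continuous F by apply: (primitive_of_continuous _ FG); exact: locint_continuous.
have msq (u : R -> R) : measurable_fun setT u -> measurable_fun setT (fun x => (u x ^+ 2)%:E).
  by move=> ?; apply/measurable_EFinP; exact: measurable_funX.
have mF : measurable_fun setT F by exact: continuous_measurable_fun.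
have mG : measurable_fun setT G by exact: continuous_measurable_fun.
have mh : measurable_fun setT h by exact: locint_measurable.
have h0 x : (0 <= (h x ^+ 2)%:E)%E by rewrite lee_fin sqr_ge0.
have [mW EW] := integral_window d0 (msq _ mh) h0.
rewrite -ge0_integralZl//; last 3 first.
- exact: msq.
- by move=> x _; rewrite lee_fin sqr_ge0.
- by rewrite lee_fin sqr_ge0.
have -> : (6%:E * \int[mu]_x (F x ^+ 2)%:E + (3 * d ^+ 4)%:E * \int[mu]_x (h x ^+ 2)%:E =
  \int[mu]_x (3%:E * (F (x + d)%R ^+ 2)%:E + 3%:E * (F x ^+ 2)%:E +
    (3 * d ^+ 3)%:E * \int[mu]_(s in `[x, (x + d)%R]) (h s ^+ 2)%:E))%E.
  have d3 : 0 <= 3 * d ^+ 3 by rewrite mulr_ge0// exprn_ge0// ltW.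
  have sq0 (u : R -> R) x : (0 <= (u x ^+ 2)%:E)%E by rewrite lee_fin sqr_ge0.
  have W0 x : (0 <= \int[mu]_(s in `[x, (x + d)%R]) (h s ^+ 2)%:E)%E by apply: integral_ge0.
  rewrite (@ge0_integral_scale_sum3 3 3 _ (fun x => (F (x + d)%R ^+ 2)%:E) _ _ (ler0n _ 3) (ler0n _ 3) d3
    (measurable_fun_addr d (msq F mF)) (msq F mF) mW (fun x => sq0 F (x + d)) (sq0 F) W0).
  rewrite (ge0_integral_addr d (msq F mF)); last by move=> x; rewrite lee_fin sqr_ge0.
  rewrite EW -ge0_muleDl ?lee_fin// -EFinD muleA -EFinM.
  by congr (_ * _ + _ * _)%E; congr EFin; ring.
apply: ge0_le_integral => //.
- by move=> x _; rewrite mule_ge0// lee_fin sqr_ge0.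
- by apply: measurable_funeM; exact: msq.
- apply: emeasurable_funD; last exact: measurable_funeM.
  apply: emeasurable_funD; apply: measurable_funeM; last exact: msq.
  exact: (measurable_fun_addr d (msq F mF)).
move=> x _.
have ih : mu.-integrable `[x, x + d] (EFin \o (fun x => h x ^+ 2)).
  by apply: integrable_sqr => //; exact: measurable_itv.
rewrite -EFin_Rintegral//.
rewrite -!EFinM -!EFinD lee_fin.
have := interpolation_pointwise d0 lh FG Gh ih.
by congr (_ <= _); ring.
Qed.

End Sobolev.

(** * Coordinates, energies and weak jets of vector-valued functions *)

Section Coordinates.
Context {R : realType} {s : scalars}.
Local Notation F := (scalar_field R s).

Definition part (im : bool) (x : F) : R := if im then imag_part x else real_part x.

Lemma partD im (x y : F) : part im (x + y) = part im x + part im y.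
Proof. by rewrite /part; case: s x y => [x y|[a b] [c d]]; case: im => //=; rewrite addr0. Qed.

Lemma partN im (x : F) : part im (- x) = - part im x.
Proof. by rewrite /part; case: s x => [x|[a b]]; case: im => //=; rewrite oppr0. Qed.

Lemma part0 im : part im (0 : F) = 0.
Proof. by rewrite /part; case: s; case: im. Qed.

Lemma partB im (x y : F) : part im (x - y) = part im x - part im y.
Proof. by rewrite partD partN. Qed.

Lemma part_sum im (I : Type) (r : seq I) (P : pred I) (f : I -> F) :
  part im (\sum_(i <- r | P i) f i) = \sum_(i <- r | P i) part im (f i).
Proof. by elim/big_rec2: _ => [|i a b _ <-]; [exact: part0|rewrite partD]. Qed.

Lemma real_partM (x y : F) :
  part false (x * y) = part false x * part false y - part true x * part true y.
Proof. by rewrite /part; case: s x y => [x y|[a b] [c d]] //=; rewrite mulr0 subr0. Qed.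

Lemma imag_partM (x y : F) :
  part true (x * y) = part false x * part true y + part true x * part false y.
Proof. by rewrite /part; case: s x y => [x y|[a b] [c d]] //=; rewrite mulr0 mul0r addr0. Qed.

Lemma part_of_realM im (c : R) (x : F) : part im (of_real s c * x) = c * part im x.
Proof.
rewrite /part; case: s x => [x|[a b]]; case: im => //=.
- by rewrite mulr0.
- by rewrite mul0r addr0.
- by rewrite mul0r subr0.
Qed.

Lemma of_realD (a b : R) : of_real s (a + b) = of_real s a + of_real s b.
Proof. by case: s => //=; apply/eqP; rewrite eq_complex/= addr0 !eqxx. Qed.

Lemma of_realM (a b : R) : of_real s (a * b) = of_real s a * of_real s b.
Proof. by case: s => //=; apply/eqP; rewrite eq_complex/= !(mulr0, mul0r) subr0 addr0 !eqxx. Qed.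

Lemma of_real1 : of_real s (1 : R) = 1.
Proof. by case: s. Qed.

Lemma of_real0 : of_real s (0 : R) = 0.
Proof. by case: s. Qed.

Lemma part_inj (x y : F) : (forall im, part im x = part im y) -> x = y.
Proof.
move=> H; have := H true; have := H false; rewrite /part; case: s x y {H} => [x y //|[a b] [c d]] /=.
by move=> -> ->.
Qed.

Context {m : nat}.
Implicit Types (w : 'cV[F]_m).

Lemma coordinateE im i w : coordinate im i w = part im (w i ord0).
Proof. by []. Qed.

Lemma coordinateD im i w w' : coordinate im i (w + w') = coordinate im i w + coordinate im i w'.
Proof. by rewrite !coordinateE mxE partD. Qed.

Lemma coordinateN im i w : coordinate im i (- w) = - coordinate im i w.
Proof. by rewrite !coordinateE mxE partN. Qed.

Lemma coordinateB im i w w' : coordinate im i (w - w') = coordinate im i w - coordinate im i w'.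
Proof. by rewrite coordinateD coordinateN. Qed.

Lemma coordinate0 im i : coordinate im i (0 : 'cV[F]_m) = 0.
Proof. by rewrite coordinateE mxE part0. Qed.

Lemma coordinateZ im i (c : R) w : coordinate im i (of_real s c *: w) = c * coordinate im i w.
Proof. by rewrite !coordinateE mxE part_of_realM. Qed.

Lemma coordinate_sum im i (I : Type) (r : seq I) (P : pred I) (f : I -> 'cV[F]_m) :
  coordinate im i (\sum_(j <- r | P j) f j) = \sum_(j <- r | P j) coordinate im i (f j).
Proof.
by elim/big_rec2: _ => [|j a b _ <-]; [exact: coordinate0|rewrite coordinateD].
Qed.

Lemma coordinate_inj w w' : (forall im i, coordinate im i w = coordinate im i w') -> w = w'.
Proof. by move=> H; apply/colP => i; apply: part_inj => im; exact: H. Qed.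

(** The l^1 norm of the 2m real coordinates, used for pointwise estimates because its triangle
    inequality is immediate. Its companion [nsq], the square of [euclidean_norm], is used under
    integrals. *)
Definition n1 w : R := \sum_(i < m) \sum_(im : bool) `|coordinate im i w|.
Definition nsq w : R := \sum_(i < m) \sum_(im : bool) coordinate im i w ^+ 2.

Lemma n1_ge0 w : 0 <= n1 w.
Proof. by apply: sumr_ge0 => i _; apply: sumr_ge0. Qed.

Lemma nsq_ge0 w : 0 <= nsq w.
Proof. by apply: sumr_ge0 => i _; apply: sumr_ge0 => im _; exact: sqr_ge0. Qed.

Lemma coordinate_le_n1 im i w : `|coordinate im i w| <= n1 w.
Proof.
rewrite /n1 (bigD1 i)//= (bigD1 im)//= -addrA lerDl addr_ge0//.
  by apply: sumr_ge0.
by apply: sumr_ge0 => j _; apply: sumr_ge0.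
Qed.

Lemma coordinate_le_nsq im i w : coordinate im i w ^+ 2 <= nsq w.
Proof.
rewrite /nsq (bigD1 i)//= (bigD1 im)//= -addrA lerDl addr_ge0//.
  by apply: sumr_ge0 => *; exact: sqr_ge0.
by apply: sumr_ge0 => j _; apply: sumr_ge0 => *; exact: sqr_ge0.
Qed.

Lemma n1_le w (c : R) : (forall im i, `|coordinate im i w| <= c) -> n1 w <= (2 * m)%:R * c.
Proof.
move=> H; apply: (@le_trans _ _ (\sum_(i < m) \sum_(im : bool) c)).
  by apply: ler_sum => i _; apply: ler_sum.
rewrite sumr_const card_ord sumr_const card_bool -mulrnA.
by rewrite mulr_natl.
Qed.

Lemma n1D w w' : n1 (w + w') <= n1 w + n1 w'.
Proof.
rewrite /n1 -big_split/=; apply: ler_sum => i _; rewrite -big_split/=.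
by apply: ler_sum => im _; rewrite coordinateD ler_normD.
Qed.

Lemma n1N w : n1 (- w) = n1 w.
Proof. by apply: eq_bigr => i _; apply: eq_bigr => im _; rewrite coordinateN normrN. Qed.

Lemma n1B w w' : n1 (w - w') <= n1 w + n1 w'.
Proof. by rewrite -(n1N w'); exact: n1D. Qed.

Lemma n10 : n1 (0 : 'cV[F]_m) = 0.
Proof. by rewrite /n1 big1// => i _; rewrite big1// => im _; rewrite coordinate0 normr0. Qed.

Lemma n1Z (c : R) w : n1 (of_real s c *: w) = `|c| * n1 w.
Proof.
rewrite /n1 mulr_sumr; apply: eq_bigr => i _; rewrite mulr_sumr.
by apply: eq_bigr => im _; rewrite coordinateZ normrM.
Qed.

Lemma n1_sum (I : Type) (r : seq I) (P : pred I) (f : I -> 'cV[F]_m) :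
  n1 (\sum_(j <- r | P j) f j) <= \sum_(j <- r | P j) n1 (f j).
Proof.
elim/big_rec2: _ => [|j a b _ H]; first by rewrite n10.
by apply: le_trans (n1D _ _) _; rewrite lerD2l.
Qed.

Lemma n1_eq0 w : n1 w = 0 -> w = 0.
Proof.
move=> H; apply: coordinate_inj => im i; rewrite coordinate0.
by apply/eqP; rewrite -normr_le0 -H coordinate_le_n1.
Qed.

(** The constant is far from optimal, but it follows from (a + S)^2 <= 2 a^2 + 2 S^2 by induction,
    and only its independence of the functions matters. *)
Lemma sum_sqr_le (I : Type) (r : seq I) (a : I -> R) : (forall i, 0 <= a i) ->
  (\sum_(i <- r) a i) ^+ 2 <= 2 ^+ size r * \sum_(i <- r) a i ^+ 2.
Proof.
move=> a0; elim: r => [|i r IH]; first by rewrite !big_nil expr0 mul1r expr2 mul0r.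
rewrite !big_cons /=.
set S := \sum_(j <- r) a j in IH *; set Q := \sum_(j <- r) a j ^+ 2 in IH *.
have E : (1 : R) <= 2 ^+ size r by apply: exprn_ege1; rewrite ler1n.
apply: (@le_trans _ _ (2 * a i ^+ 2 + 2 * S ^+ 2)).
  by rewrite -subr_ge0 (_ : _ - _ = (a i - S) ^+ 2) ?sqr_ge0//; ring.
rewrite (exprS 2 (size r)) -[2 * 2 ^+ _ * _]mulrA -mulrDr ler_pM2l// mulrDr lerD//.
by rewrite ler_peMl// sqr_ge0.
Qed.

Lemma nsq_le_n1 w : nsq w <= n1 w ^+ 2.
Proof.
have S2 (I : finType) (a : I -> R) : (forall i, 0 <= a i) -> \sum_i a i ^+ 2 <= (\sum_i a i) ^+ 2.
  move=> a0; rewrite [leRHS]expr2 mulr_suml; apply: ler_sum => i _.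
  rewrite expr2 ler_wpM2l// (bigD1 i)//= lerDl; exact: sumr_ge0.
apply: le_trans (S2 _ _ _); last by move=> i; apply: sumr_ge0.
apply: ler_sum => i _.
have := S2 _ (fun im => `|coordinate im i w|) (fun=> normr_ge0 _).
by apply: le_trans; apply: ler_sum => im _; rewrite real_normK ?num_real.
Qed.

(* A crude equivalence constant between [n1 ^+ 2] and [nsq]. *)
Definition n1c : R := (2 * m)%:R ^+ 2.

Lemma n1_le_nsq w : n1 w ^+ 2 <= n1c * nsq w.
Proof.
rewrite /n1c -[nsq w]sqr_sqrtr ?nsq_ge0// -exprMn ler_pXn2r ?nnegrE ?n1_ge0//.
  apply: n1_le => im i; rewrite -[`|_|]ger0_norm// -sqrtr_sqr ler_sqrt ?nsq_ge0//.
  by rewrite real_normK ?num_real// coordinate_le_nsq.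
Qed.

Lemma n1c_ge0 : 0 <= n1c.
Proof. exact: sqr_ge0. Qed.

Lemma nsq_le_sum (I : Type) (r : seq I) w (t : I -> 'cV[F]_m) (C : R) : 0 <= C ->
  n1 w <= C * \sum_(i <- r) n1 (t i) ->
  nsq w <= C ^+ 2 * 2 ^+ size r * n1c * \sum_(i <- r) nsq (t i).
Proof.
move=> C0 H; apply: (le_trans (nsq_le_n1 w)).
apply: (@le_trans _ _ ((C * \sum_(i <- r) n1 (t i)) ^+ 2)).
  rewrite ler_pXn2r ?nnegrE ?n1_ge0// mulr_ge0// sumr_ge0// => i _; exact: n1_ge0.
rewrite exprMn -[leRHS]mulrA -[leRHS]mulrA; apply: ler_wpM2l; first exact: sqr_ge0.
have t0 i : 0 <= n1 (t i) by exact: n1_ge0.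
apply: (le_trans (sum_sqr_le r t0)).
by rewrite ler_wpM2l ?exprn_ge0// mulr_sumr; apply: ler_sum => i _; exact: n1_le_nsq.
Qed.

Definition mxbound (M : 'M[F]_m) (c : R) := forall im i j, `|part im (M i j)| <= c.

Lemma n1_mulmx (M : 'M[F]_m) (c : R) w : mxbound M c -> n1 (M *m w) <= (2 * m)%:R * c * n1 w.
Proof.
move=> Mc; rewrite -mulrA; apply: n1_le => im i.
rewrite coordinateE mxE part_sum (le_trans (ler_norm_sum _ _ _))//.
rewrite /n1 mulr_sumr; apply: ler_sum => j _.
rewrite big_bool mulrDr.
case: im.
  rewrite imag_partM (le_trans (ler_normD _ _))// !normrM.
  by apply: lerD; rewrite ler_wpM2r// Mc.
rewrite real_partM (le_trans (ler_normB _ _))// !normrM addrC.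
by apply: lerD; rewrite ler_wpM2r// Mc.
Qed.

Lemma coordinate_mulmx im i (M : 'M[F]_m) w : coordinate im i (M *m w) =
  \sum_(j < m) part im (M i j * w j ord0).
Proof. by rewrite coordinateE mxE part_sum. Qed.

Lemma partM_coordinate im i j (M : 'M[F]_m) w : part im (M i j * w j ord0) =
  part false (M i j) * coordinate im j w +
  (-1) ^+ (~~ im) * (part true (M i j) * coordinate (~~ im) j w).
Proof.
case: im; first by rewrite imag_partM /= expr0 mul1r.
by rewrite real_partM /= expr1 mulN1r.
Qed.

End Coordinates.

(** * L^2 energies of vector-valued functions *)

Section Energy.
Context {R : realType} {s : scalars} {m : nat}.
Local Notation F := (scalar_field R s).
Local Notation V := 'cV[F]_m.
Local Notation mu := (@lebesgue_measure R).
Implicit Types (f g : R -> V) (D : set R).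

Definition vmeas f := forall im i, measurable_fun setT (fun x => coordinate im i (f x)).

(** The square of [L2_norm]. Working with squares keeps roots out of the estimates until the final
    bound. *)
Definition energy D f : \bar R := (\int[mu]_(x in D) (nsq (f x))%:E)%E.

Lemma Lnorm2E (h : R -> R) : Lnorm mu 2%:E (EFin \o h) = sqrte (\int[mu]_x (h x ^+ 2)%:E)%E.
Proof.
rewrite unlock poweR12_sqrt; last by apply: integral_ge0 => x _; exact: poweR_ge0.
congr sqrte; apply: eq_integral => x _ /=; congr EFin.
by rewrite powR_mulrn// real_normK ?num_real.
Qed.

Lemma energy_ge0 D f : (0 <= energy D f)%E.
Proof. by apply: integral_ge0 => x _; rewrite lee_fin nsq_ge0. Qed.

Lemma L2_normE D f : L2_norm D f = sqrte (energy D f).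
Proof.
rewrite /L2_norm Lnorm2E; congr sqrte; rewrite /energy [RHS]integral_mkcond.
apply: eq_integral => x _; rewrite !patchE; case: ifP => _ /=; last by rewrite expr2 mul0r.
by rewrite /euclidean_norm sqr_sqrtr// nsq_ge0.
Qed.

Lemma L2_norm_sqr D f : (L2_norm D f ^+ 2 = energy D f)%E.
Proof. by rewrite L2_normE sqr_sqrte// energy_ge0. Qed.

Lemma vmeas_nsq f : vmeas f -> measurable_fun setT (fun x => (nsq (f x))%:E).
Proof.
move=> mf; apply/measurable_EFinP; apply: measurable_sum => i.
by apply: measurable_sum => im; apply: measurable_funX; exact: mf.
Qed.

Lemma sqrte_lty (x : \bar R) : (sqrte x < +oo)%E = (x < +oo)%E.
Proof. by case: x => [r| |] //=; rewrite !ltry. Qed.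

Lemma Lfun2P (h : R -> R) : (h \in Lfun mu 2%:E) <->
  measurable_fun setT h /\ (\int[mu]_x (h x ^+ 2)%:E < +oo)%E.
Proof.
split=> [H|[mh hoo]].
  split; first by have := set_mem (sub_Lfun_mfun H).
  by have := set_mem (sub_Lfun_finLfun H); rewrite /= /finite_norm Lnorm2E sqrte_lty.
rewrite inE; apply/andP; split; rewrite inE//=.
by rewrite /finite_norm Lnorm2E sqrte_lty.
Qed.

Lemma energy_coord D f : measurable D -> vmeas f ->
  (energy D f = \sum_(i < m) \sum_(im : bool) \int[mu]_(x in D) (coordinate im i (f x) ^+ 2)%:E)%E.
Proof.
move=> mD mf.
have mc im i : measurable_fun D (fun x => (coordinate im i (f x) ^+ 2)%:E).
  by apply: measurable_funTS; apply/measurable_EFinP; apply: measurable_funX; exact: mf.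
have -> : energy D f = (\int[mu]_(x in D) \sum_(i < m) \sum_(im : bool) (coordinate im i (f x) ^+ 2)%:E)%E.
  apply: eq_integral => x _; rewrite /nsq -sumEFin; apply: eq_bigr => i _.
  by rewrite -sumEFin.
rewrite ge0_integral_sum//; last 2 first.
- by move=> i; apply: emeasurable_sum => im; exact: mc.
- by move=> i x _; apply: sume_ge0 => im _; rewrite lee_fin sqr_ge0.
apply: eq_bigr => i _; rewrite ge0_integral_sum//.
- by move=> im; exact: mc.
- by move=> im x _; rewrite lee_fin sqr_ge0.
Qed.

Lemma coord_energy_le D f im i : measurable D -> vmeas f ->
  (\int[mu]_(x in D) (coordinate im i (f x) ^+ 2)%:E <= energy D f)%E.
Proof.
move=> mD mf; apply: ge0_le_integral => //.
- by move=> x _; rewrite lee_fin sqr_ge0.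
- by apply: measurable_funTS; apply/measurable_EFinP; apply: measurable_funX; exact: mf.
- by apply: measurable_funTS; exact: vmeas_nsq.
- by move=> x _; rewrite lee_fin coordinate_le_nsq.
Qed.

Lemma L2_energy D f : measurable D -> vmeas f -> (L2 D f <-> (energy D f < +oo)%E).
Proof.
move=> mD mf.
have H im i : (((coordinate im i \o f) \_ D \in Lfun mu 2%:E) <->
    (\int[mu]_(x in D) (coordinate im i (f x) ^+ 2)%:E < +oo)%E).
  have -> : (\int[mu]_(x in D) (coordinate im i (f x) ^+ 2)%:E =
      \int[mu]_x (((coordinate im i \o f) \_ D) x ^+ 2)%:E)%E.
    rewrite integral_mkcond; apply: eq_integral => x _; rewrite !patchE.
    by case: ifP => _ //=; rewrite expr2 mul0r.
  split=> [/Lfun2P[]//|H]; apply/Lfun2P; split=> //.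
  have X := @measurable_restrictT _ _ _ _ D (coordinate im i \o f) mD.
  by apply: X.1; apply: measurable_funTS; exact: mf.
split=> [L|E im i].
  rewrite energy_coord//; apply: lte_sum_pinfty => i _; apply: lte_sum_pinfty => im _.
  exact/H.
by apply/H; apply: le_lt_trans E; exact: coord_energy_le.
Qed.

Lemma L2T_vmeas f : L2 setT f -> vmeas f.
Proof. by move=> L im i; have := L im i; rewrite patch_setT => /Lfun2P[]. Qed.

Lemma L2P f : L2 setT f <-> vmeas f /\ (energy setT f < +oo)%E.
Proof.
split=> [L|[mf E]]; last exact/L2_energy.
have mf := L2T_vmeas L; split=> //; exact/L2_energy.
Qed.

Lemma energy_ae D f g : measurable D -> vmeas f -> vmeas g ->
  {ae mu, forall x, D x -> f x = g x} -> energy D f = energy D g.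
Proof.
move=> mD mf mg fg; apply: ae_eq_integral => //.
- by apply: measurable_funTS; exact: vmeas_nsq.
- by apply: measurable_funTS; exact: vmeas_nsq.
- by apply: (ae_imp _ fg) => x /= H Dx; rewrite H.
Qed.

Lemma energy_subset D D' f : measurable D -> measurable D' -> D `<=` D' -> vmeas f ->
  (energy D f <= energy D' f)%E.
Proof.
move=> mD mD' DD' mf; apply: ge0_subset_integral => //.
  by apply: measurable_funTS; exact: vmeas_nsq.
by move=> x _; rewrite lee_fin nsq_ge0.
Qed.

Lemma energy_addr (c : R) f : vmeas f -> energy setT (fun x => f (x + c)) = energy setT f.
Proof.
move=> mf; rewrite /energy (@ge0_integral_addr _ c (fun x => (nsq (f x))%:E))//.
  exact: vmeas_nsq.
by move=> x; rewrite lee_fin nsq_ge0.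
Qed.

Lemma energy_restrict D f : measurable D -> vmeas f ->
  energy setT (fun x => f x *+ (x \in D)) = energy D f.
Proof.
move=> mD mf; rewrite /energy [RHS]integral_mkcond; apply: eq_integral => x _.
rewrite patchE; case: ifP => _ /=; rewrite ?mulr1n ?mulr0n//.
by rewrite /nsq big1// => i _; rewrite big1// => im _; rewrite coordinate0 expr2 mul0r.
Qed.

Lemma energy_le_nsq (I : Type) (r : seq I) D f (t : I -> R -> V) (C : R) : measurable D -> 0 <= C ->
  vmeas f -> (forall i, vmeas (t i)) ->
  {ae mu, forall x, D x -> nsq (f x) <= C * \sum_(i <- r) nsq (t i x)} ->
  (energy D f <= C%:E * \sum_(i <- r) energy D (t i))%E.
Proof.
move=> mD C0 mf mt H.
have mn g : vmeas g -> measurable_fun D (fun x => (nsq (g x))%:E).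
  by move=> mg; apply: measurable_funTS; exact: vmeas_nsq.
have nE g x : (0 <= (nsq (g x : V))%:E)%E by rewrite lee_fin nsq_ge0.
have -> : (\sum_(i <- r) energy D (t i) = \int[mu]_(x in D) \sum_(i <- r) (nsq (t i x))%:E)%E.
  rewrite ge0_integral_sum//; first by move=> i; exact: mn.
have mS : measurable_fun D (fun x => \sum_(i <- r) (nsq (t i x))%:E)%E.
  by apply: emeasurable_sum => i; exact: mn.
rewrite -ge0_integralZl//; last by move=> x _; apply: sume_ge0.
apply: ae_ge0_le_integral => //.
- exact: mn.
- by move=> x _; apply: mule_ge0 => //; apply: sume_ge0.
- exact: measurable_funeM.
- by apply: (ae_imp _ H) => x /= Hx /Hx; rewrite sumEFin -EFinM lee_fin.
Qed.

(** The form in which pointwise bounds by finitely many functions become L^2 bounds: the constant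
    involves only their number, m and C. *)
Lemma energy_le_n1 (I : Type) (r : seq I) D f (t : I -> R -> V) (C : R) : measurable D -> 0 <= C ->
  vmeas f -> (forall i, vmeas (t i)) ->
  {ae mu, forall x, D x -> n1 (f x) <= C * \sum_(i <- r) n1 (t i x)} ->
  (energy D f <= (C ^+ 2 * 2 ^+ size r * @n1c R m)%:E * \sum_(i <- r) energy D (t i))%E.
Proof.
move=> mD C0 mf mt H; apply: energy_le_nsq => //.
  by rewrite !mulr_ge0 ?sqr_ge0 ?exprn_ge0// n1c_ge0.
by apply: (ae_imp _ H) => x Hx /Hx; exact: nsq_le_sum.
Qed.

Lemma vmeasD f g : vmeas f -> vmeas g -> vmeas (fun x => f x + g x).
Proof.
by move=> mf mg im i; under eq_fun do rewrite coordinateD; apply: measurable_funD; [exact: mf|exact: mg].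
Qed.

Lemma vmeasN f : vmeas f -> vmeas (fun x => - f x).
Proof.
by move=> mf im i; under eq_fun do rewrite coordinateN; apply: measurableT_comp => //; exact: mf.
Qed.

Lemma vmeasB f g : vmeas f -> vmeas g -> vmeas (fun x => f x - g x).
Proof. by move=> mf mg; apply: vmeasD => //; exact: vmeasN. Qed.

Lemma vmeas0 : vmeas (fun=> 0).
Proof. by move=> im i; exact: measurable_cst. Qed.

Lemma vmeas_sum (I : Type) (r : seq I) (f : I -> R -> V) : (forall i, vmeas (f i)) ->
  vmeas (fun x => \sum_(i <- r) f i x).
Proof.
move=> mf im i; under eq_fun do rewrite coordinate_sum.
by apply: measurable_sum => j; exact: mf.
Qed.

Lemma vmeas_addr (c : R) f : vmeas f -> vmeas (fun x => f (x + c)).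
Proof. by move=> mf im i; exact: (measurable_fun_addr c (mf im i)). Qed.

Lemma vmeasZ (h : R -> R) f : measurable_fun setT h -> vmeas f ->
  vmeas (fun x => of_real s (h x) *: f x).
Proof.
move=> mh mf im i; under eq_fun do rewrite coordinateZ.
by apply: measurable_funM => //; exact: mf.
Qed.

Lemma vmeas_restrict D f : measurable D -> vmeas f -> vmeas (fun x => f x *+ (x \in D)).
Proof.
move=> mD mf im i.
have X := @measurable_restrictT _ _ _ _ D (fun x => coordinate im i (f x)) mD.
have -> : (fun x => coordinate im i (f x *+ (x \in D))) = (fun x => coordinate im i (f x)) \_ D.
  by apply/funext => x; rewrite patchE; case: ifP => _; rewrite ?mulr1n ?mulr0n// coordinate0.
by apply: X.1; apply: measurable_funTS; exact: mf.
Qed.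

Definition mmeas (M : R -> 'M[F]_m) := forall im i j, measurable_fun setT (fun x => part im (M x i j)).

Lemma vmeas_mulmx (M : R -> 'M[F]_m) f : mmeas M -> vmeas f -> vmeas (fun x => M x *m f x).
Proof.
move=> mM mf im i; under eq_fun do rewrite coordinate_mulmx.
apply: measurable_sum => j; under eq_fun do rewrite partM_coordinate.
apply: measurable_funD; first by apply: measurable_funM; [exact: mM|exact: mf].
by apply: measurable_funM => //; apply: measurable_funM; [exact: mM|exact: mf].
Qed.

End Energy.

(** * Continuous representatives of vector-valued functions *)

Section ContinuousVersion.
Context {R : realType} {s : scalars} {m : nat}.
Local Notation F := (scalar_field R s).
Local Notation V := 'cV[F]_m.
Local Notation mu := (@lebesgue_measure R).
Implicit Types (f g : R -> V) (D : set R).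

Definition mkpart (s' : scalars) (a b : R) : scalar_field R s' :=
  match s' with RealScalars => a | ComplexScalars => Complex a b end.

Definition mkvec (c : bool -> 'I_m -> R) : V := \col_i mkpart s (c false i) (c true i).

(** Over the reals [mkvec] discards the imaginary entries of c. The hypothesis makes this harmless:
    such an entry is the coordinate of an actual vector, hence 0. *)
Lemma mkvec_coordinate im i (w : V) (c : bool -> 'I_m -> R) :
  c im i = coordinate im i w -> coordinate im i (mkvec c) = coordinate im i w.
Proof.
rewrite !coordinateE mxE /part; move: w c; rewrite /mkpart; case: s => w c; case: im => //=.
Qed.

Lemma coordinate_mkvec (c : bool -> 'I_m -> R) im i :
  coordinate im i (mkvec c) = if s is RealScalars then (if im then 0 else c im i) else c im i.
Proof. by rewrite coordinateE mxE /part /mkpart; case: s; case: im. Qed.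

Lemma coordinate_real_scalars i (w : V) : s = RealScalars -> coordinate true i w = 0.
Proof. by move: w => /[swap] sE; rewrite sE. Qed.

Definition vprim f g := forall im i,
  primitive_of (fun x => coordinate im i (f x)) (fun x => coordinate im i (g x)).

Definition vcont f := forall im i, continuous (fun x => coordinate im i (f x)).

Lemma vcont_vmeas f : vcont f -> vmeas f.
Proof. by move=> cf im i; apply: continuous_measurable_fun; exact: cf. Qed.

Lemma ae_forall_fin (I : finType) (P : I -> R -> Prop) :
  (forall i, {ae mu, forall x, P i x}) -> {ae mu, forall x, forall i, P i x}.
Proof.
move=> H.
have : {ae mu, forall x, forall i, i \in enum I -> P i x}.
  elim: (enum I) => [|i r IH]; first exact: aeW.
  apply: (ae_imp2 _ (H i) IH) => x Pi Pr j; rewrite inE => /orP[/eqP->//|]; exact: Pr.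
by apply: ae_imp => x Hx i; apply: Hx; rewrite mem_enum.
Qed.

Lemma vder_vprim (B : R -> R) f g : smooth_step B -> is_weak_derivative 1 f g ->
  exists2 f', {ae mu, forall x, f x = f' x} & vprim f' g.
Proof.
move=> sB fg.
have ex im i : exists G : R -> R, {ae mu, forall x, coordinate im i (f x) = G x} /\
    primitive_of G (fun x => coordinate im i (g x)).
  by have [G ? ?] := continuous_version sB (fg im i); exists G.
pose G im i := sval (cid (ex im i)).
have GE im i : {ae mu, forall x, coordinate im i (f x) = G im i x} /\
  primitive_of (G im i) (fun x => coordinate im i (g x)) by rewrite /G; case: cid.
exists (fun x => mkvec (fun im i => G im i x)).
  have := @ae_forall_fin (bool * 'I_m)%type (fun p x => coordinate p.1 p.2 (f x) = G p.1 p.2 x) _.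
  move=> /(_ (fun p => (GE p.1 p.2).1)); apply: ae_imp => x H.
  apply: coordinate_inj => im i; apply/esym/mkvec_coordinate; exact/esym/(H (im, i)).
move=> im i.
(* Over the reals the primitive chosen for an imaginary coordinate may be discarded, because both
   sides of the claim vanish. *)
have [[sE imE]|ns] := pselect (s = RealScalars /\ im).
  have -> : (fun x => coordinate im i (g x)) = fun=> 0.
    by apply/funext => x; rewrite imE coordinate_real_scalars.
  move=> x y xy; rewrite imE !coordinate_real_scalars// subrr.
  by rewrite /Rintegral integral0.
have -> : (fun x => coordinate im i (mkvec (fun im i => G im i x))) = G im i.
  apply/funext => x; rewrite coordinate_mkvec; move: ns; case: s => //; case: im => // ns.
  by exfalso; apply: ns.
exact: (GE im i).2.
Qed.

Lemma vprim_vcont f g : (forall im i, locally_integrable setT (fun x => coordinate im i (g x))) ->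
  vprim f g -> vcont f.
Proof. by move=> lg fg im i; exact: primitive_of_continuous (lg im i) (fg im i). Qed.

Lemma energy_itv_Rintegral (a b : R) f : vmeas f -> (energy `[a, b]%classic f < +oo)%E ->
  forall im i, mu.-integrable `[a, b] (EFin \o (fun x => coordinate im i (f x) ^+ 2)).
Proof.
move=> mf foo im i; apply/integrableP; split.
  by apply/measurable_EFinP; apply: measurable_funTS; apply: measurable_funX; exact: mf.
apply: le_lt_trans foo.
under eq_integral do rewrite /= ger0_norm ?sqr_ge0//.
by apply: coord_energy_le => //; exact: measurable_itv.
Qed.

Lemma vsobolev f g (a x : R) : (forall im i, locally_integrable setT (fun x => coordinate im i (g x))) ->
  vprim f g -> (energy `[a, (a + 1)%R]%classic g < +oo)%E -> a <= x <= a + 1 ->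
  ((nsq (f x))%:E <= 2%:E * energy `[a, (a + 1)%R]%classic f + 2%:E * energy `[a, (a + 1)%R]%classic g)%E.
Proof.
move=> lg fg goo xa.
have cf := vprim_vcont lg fg.
have mf := vcont_vmeas cf.
have mg : vmeas g by move=> im i; exact: locint_measurable.
have mI : measurable (`[a, a + 1]%classic : set R) by exact: measurable_itv.
have ig := energy_itv_Rintegral mg goo.
have dist (u : bool -> 'I_m -> \bar R) : (forall im i, 0 <= u im i)%E ->
    (2%:E * \sum_(i < m) \sum_(im : bool) u im i = \sum_(i < m) \sum_(im : bool) 2%:E * u im i)%E.
  move=> u0; rewrite ge0_sume_distrr => [|i _]; last by apply: sume_ge0.
  by apply: eq_bigr => i _; rewrite ge0_sume_distrr.
have I0 (h : R -> V) im i : (0 <= \int[mu]_(x in `[a, (a + 1)%R]) (coordinate im i (h x) ^+ 2)%:E)%E.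
  by apply: integral_ge0 => t _; rewrite lee_fin sqr_ge0.
rewrite !energy_coord// !dist//.
rewrite -big_split/= -sumEFin; apply: lee_sum => i _.
rewrite -big_split/= -sumEFin; apply: lee_sum => im _.
have if2 : mu.-integrable `[a, a + 1] (EFin \o (fun x => coordinate im i (f x) ^+ 2)).
  apply: locint_itv; apply: locint_continuous => t; exact: (continuousM (cf im i t) (cf im i t)).
rewrite -!EFin_Rintegral// -!EFinM -EFinD lee_fin.
exact: sobolev_itv (lg im i) (fg im i) (ig im i) xa.
Qed.

End ContinuousVersion.

(** * Jets of weak derivatives *)

Section Jets.
Context {R : realType} {s : scalars} {m : nat}.
Local Notation F := (scalar_field R s).
Local Notation V := 'cV[F]_m.
Local Notation mu := (@lebesgue_measure R).
Implicit Types (f g u : R -> V) (J : nat -> R -> V) (B : R -> R).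

Definition vlocint f := forall im i, locally_integrable setT (fun x => coordinate im i (f x)).

(** The entries are prescribed functions, unlike those of [weak_derivative], which are arbitrary
    choices. This is what lets translation, the Leibniz rule and periodization act entry by
    entry. *)
Definition vchain (k : nat) J := forall j, (j < k)%N -> is_weak_derivative 1 (J j) (J j.+1).

Lemma vlocint_vmeas f : vlocint f -> vmeas f.
Proof. by move=> lf im i; exact: locint_measurable. Qed.

Lemma vder_ae j f g f' g' : vlocint f' -> vlocint g' ->
  {ae mu, forall x, f x = f' x} -> {ae mu, forall x, g x = g' x} ->
  is_weak_derivative j f g -> is_weak_derivative j f' g'.
Proof.
move=> lf' lg' ff' gg' H im i.
apply: (@wder_ae _ j (fun x => coordinate im i (f x)) (fun x => coordinate im i (g x))) => //.
- exact: lf'.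
- exact: lg'.
- by apply: (ae_imp _ ff') => x ->.
- by apply: (ae_imp _ gg') => x ->.
- exact: H.
Qed.

Lemma vder_vlocint j f g : is_weak_derivative j f g -> vlocint f /\ vlocint g.
Proof. by move=> H; split=> im i; have [] := H im i. Qed.

Lemma vder_unique B j f g g' : smooth_step B -> is_weak_derivative j f g ->
  is_weak_derivative j f g' -> {ae mu, forall x, g x = g' x}.
Proof.
move=> sB H H'.
have := @ae_forall_fin R (bool * 'I_m)%type
  (fun p x => coordinate p.1 p.2 (g x) = coordinate p.1 p.2 (g' x)).
have E p : {ae mu, forall x, coordinate p.1 p.2 (g x) = coordinate p.1 p.2 (g' x)}.
  exact: (wder_unique sB (H p.1 p.2) (H' p.1 p.2)).
by move=> /(_ E); apply: ae_imp => x Hx; apply: coordinate_inj => im i; exact: (Hx (im, i)).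
Qed.

Lemma weak_derivativeP j u : has_weak_derivative j u -> is_weak_derivative j u (weak_derivative j u).
Proof. by move=> [g Hg]; rewrite /weak_derivative; case: xgetP => [_ -> //|/(_ g)]. Qed.

Lemma weak_derivative_ae B j u g : smooth_step B -> is_weak_derivative j u g ->
  {ae mu, forall x, weak_derivative j u x = g x}.
Proof.
move=> sB H; apply: (vder_unique sB _ H); apply: weak_derivativeP; by exists g.
Qed.

Lemma vder0 f g : vlocint f -> vlocint g -> {ae mu, forall x, f x = g x} ->
  is_weak_derivative 0 f g.
Proof.
by move=> lf lg fg im i; apply: wder0P; [exact: lf|apply: (ae_imp _ fg) => x /= -> |exact: lg].
Qed.

Lemma vderD j f g f' g' : is_weak_derivative j f g -> is_weak_derivative j f' g' ->
  is_weak_derivative j (fun x => f x + f' x) (fun x => g x + g' x).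
Proof.
move=> H H' im i; have := wderD (H im i) (H' im i).
by congr wder; apply/funext => x /=; rewrite coordinateD.
Qed.

Lemma vderB j f g f' g' : is_weak_derivative j f g -> is_weak_derivative j f' g' ->
  is_weak_derivative j (fun x => f x - f' x) (fun x => g x - g' x).
Proof.
move=> H H' im i; have := wderD (H im i) (wderZ (-1) (H' im i)).
by congr wder; apply/funext => x /=; rewrite coordinateB mulN1r.
Qed.

Lemma vder_addr j f g (c : R) : is_weak_derivative j f g ->
  is_weak_derivative j (fun x => f (x + c)) (fun x => g (x + c)).
Proof. by move=> H im i; exact: (wder_addr c (H im i)). Qed.

Lemma vchain_weak k J j : vlocint (J 0%N) -> vchain k J -> (j <= k)%N -> is_weak_derivative j (J 0%N) (J j).
Proof.
move=> l0 cJ; elim: j => [_|j IH jk]; first by apply: vder0 => //; exact: aeW.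
by move=> im i; have := wder_comp (IH (ltnW jk) im i) (cJ j jk im i); rewrite addn1.
Qed.

Lemma vchain_vlocint k J j : vlocint (J 0%N) -> vchain k J -> (j <= k)%N -> vlocint (J j).
Proof. by move=> l0 cJ jk; have [] := vder_vlocint (vchain_weak l0 cJ jk). Qed.

(** Entry 0 is u itself, since [weak_derivative 0 u] agrees with u only almost everywhere. *)
Definition jet u j := if j is 0%N then u else weak_derivative j u.

Lemma jet_weak k u : (forall j, (j <= k)%N -> has_weak_derivative j u) ->
  forall j, (j <= k)%N -> is_weak_derivative j u (jet u j).
Proof.
move=> H [|j] jk; last exact: weak_derivativeP (H _ jk).
have [lu _] := vder_vlocint (weak_derivativeP (H 0%N isT)).
by apply: vder0 => //; exact: aeW.
Qed.

(** Orders j and j + 1 are both known relative to u; cancelling the first j derivatives leaves the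
    first-order link. *)
Lemma jet_vchain k u : (forall j, (j <= k)%N -> has_weak_derivative j u) -> vchain k (jet u).
Proof.
move=> H j jk im i; have W := jet_weak H.
by apply: (wder_cancel (W j (ltnW jk) im i)); rewrite addn1; exact: (W j.+1 jk im i).
Qed.

Lemma jet_ae B k u j : smooth_step B -> (forall j, (j <= k)%N -> has_weak_derivative j u) ->
  (j <= k)%N -> {ae mu, forall x, weak_derivative j u x = jet u j x}.
Proof. by move=> sB H jk; exact: (weak_derivative_ae sB (jet_weak H jk)). Qed.

Lemma in_Hk_jet B k u : smooth_step B -> in_Hk k u ->
  vchain k (jet u) /\ forall j, (j <= k)%N -> vlocint (jet u j) /\ (energy setT (jet u j) < +oo)%E.
Proof.
move=> sB H; have H1 j : (j <= k)%N -> has_weak_derivative j u by move=> /H[].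
split; first exact: jet_vchain.
move=> j jk; have [_ lj] := vder_vlocint (jet_weak H1 jk); split=> //.
have [_ /L2P[mw]] := H j jk.
rewrite (@energy_ae _ _ _ setT (weak_derivative j u) (jet u j))//; first exact: vlocint_vmeas.
by apply: (ae_imp _ (jet_ae sB H1 jk)).
Qed.

Lemma in_Hk_loc_jet B k u : smooth_step B -> in_Hk_loc k u ->
  vchain k (jet u) /\ forall j, (j <= k)%N -> vlocint (jet u j).
Proof.
move=> sB H; have H1 j : (j <= k)%N -> has_weak_derivative j u by move=> /H[].
split; first exact: jet_vchain.
by move=> j jk; have [_ lj] := vder_vlocint (jet_weak H1 jk).
Qed.

Lemma vchain_in_Hk B k J : smooth_step B -> vlocint (J 0%N) -> vchain k J ->
  (forall j, (j <= k)%N -> (energy setT (J j) < +oo)%E) -> in_Hk k (J 0%N).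
Proof.
move=> sB l0 cJ eJ j jk; have W := vchain_weak l0 cJ jk.
split; first by exists (J j).
have [_ lw] := vder_vlocint (weak_derivativeP (ex_intro _ _ W)).
apply/L2P; split; first exact: vlocint_vmeas.
rewrite (@energy_ae _ _ _ setT _ (J j))//; last 3 first.
- exact: vlocint_vmeas.
- by apply: vlocint_vmeas; exact: vchain_vlocint jk.
- by apply: (ae_imp _ (weak_derivative_ae sB W)).
exact: eJ.
Qed.

Lemma vchain_in_Hk_loc B k J : smooth_step B -> vlocint (J 0%N) -> vchain k J ->
  (forall j (a b : R), (j <= k)%N -> (energy `[a, b]%classic (J j) < +oo)%E) -> in_Hk_loc k (J 0%N).
Proof.
move=> sB l0 cJ eJ j jk; have W := vchain_weak l0 cJ jk.
split; first by exists (J j).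
have [_ lw] := vder_vlocint (weak_derivativeP (ex_intro _ _ W)).
move=> a b; apply/L2_energy; [exact: measurable_itv|exact: vlocint_vmeas|].
rewrite (@energy_ae _ _ _ _ _ (J j))//; last 3 first.
- exact: vlocint_vmeas.
- by apply: vlocint_vmeas; exact: vchain_vlocint jk.
- by apply: (ae_imp _ (weak_derivative_ae sB W)).
exact: eJ.
Qed.

(** By uniqueness of weak derivatives the norm may be computed along any jet of the function. *)
Lemma Hk_norm_vchain B k D J : smooth_step B -> measurable D -> vlocint (J 0%N) -> vchain k J ->
  Hk_norm k D (J 0%N) = sqrte (\sum_(j < k.+1) energy D (J j))%E.
Proof.
move=> sB mD l0 cJ; rewrite /Hk_norm; congr sqrte; apply: eq_bigr => j _.
have jk : (j <= k)%N by rewrite -ltnS.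
have W := vchain_weak l0 cJ jk.
have [_ lw] := vder_vlocint (weak_derivativeP (ex_intro _ _ W)).
rewrite L2_norm_sqr; apply: energy_ae => //.
- exact: vlocint_vmeas.
- by apply: vlocint_vmeas; exact: vchain_vlocint jk.
- by apply: (ae_imp _ (weak_derivative_ae sB W)).
Qed.

Lemma vprim_trans f g h : vlocint g -> vlocint h -> {ae mu, forall x, g x = h x} ->
  vprim f g -> vprim f h.
Proof.
move=> lg lh gh fg im i x y xy; rewrite (fg im i x y xy); congr fine.
have mI : measurable (`[x, y]%classic : set R) by exact: measurable_itv.
apply: ae_eq_integral => //.
- by apply/measurable_EFinP; apply: measurable_funTS; exact: locint_measurable.
- by apply/measurable_EFinP; apply: measurable_funTS; exact: locint_measurable.
- by apply: (ae_imp _ gh) => t /= -> _.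
Qed.

Lemma vcont_vlocint f : vcont f -> vlocint f.
Proof. by move=> cf im i; exact: locint_continuous. Qed.

(** The scalar inequality requires genuine primitives, so entries j and j + 1 are first replaced by
    their continuous representatives, which changes no energy. *)
Lemma vinterpolation B k J j (d : R) : smooth_step B -> vlocint (J 0%N) -> vchain k J ->
  (forall j, (j <= k)%N -> (energy setT (J j) < +oo)%E) -> (j.+2 <= k)%N -> 0 < d ->
  ((d ^+ 2)%:E * energy setT (J j.+1) <=
   6%:E * energy setT (J j) + (3 * d ^+ 4)%:E * energy setT (J j.+2))%E.
Proof.
move=> sB l0 cJ eJ jk d0.
have jk1 : (j < k)%N by exact: ltnW.
have [f' ff' f'g] := vder_vprim sB (cJ j jk1).
have [g' gg' g'h] := vder_vprim sB (cJ j.+1 jk).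
have lj i : (i <= k)%N -> vlocint (J i) by exact: vchain_vlocint.
have lf := lj j (ltnW jk1); have lg := lj j.+1 jk1; have lh := lj j.+2 jk.
have cf' := vprim_vcont lg f'g; have cg' := vprim_vcont lh g'h.
have f'g' := vprim_trans lg (vcont_vlocint cg') gg' f'g.
rewrite (@energy_ae _ _ _ setT (J j) f')//; last 3 first.
- exact: vlocint_vmeas.
- exact: vcont_vmeas.
- by apply: (ae_imp _ ff').
rewrite (@energy_ae _ _ _ setT (J j.+1) g')//; last 3 first.
- exact: vlocint_vmeas.
- exact: vcont_vmeas.
- by apply: (ae_imp _ gg').
have dist (c : \bar R) (u : bool -> 'I_m -> \bar R) : (0 <= c)%E -> (forall im i, 0 <= u im i)%E ->
    (c * \sum_(i < m) \sum_(im : bool) u im i = \sum_(i < m) \sum_(im : bool) c * u im i)%E.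
  move=> c0 u0; rewrite ge0_sume_distrr => [|i _]; last by apply: sume_ge0.
  by apply: eq_bigr => i _; rewrite ge0_sume_distrr.
have I0 (h : R -> V) im i : (0 <= \int[mu]_x (coordinate im i (h x) ^+ 2)%:E)%E.
  by apply: integral_ge0 => t _; rewrite lee_fin sqr_ge0.
have d2 : (0 <= (d ^+ 2)%:E)%E by rewrite lee_fin sqr_ge0.
have d4 : (0 <= (3 * d ^+ 4)%:E)%E by rewrite lee_fin mulr_ge0// exprn_even_ge0.
have mh := vlocint_vmeas lh.
have hoo := eJ j.+2 jk.
rewrite !energy_coord//; [|exact: vcont_vmeas|exact: vcont_vmeas].
rewrite !dist//.
rewrite -big_split/=; apply: lee_sum => i _.
rewrite -big_split/=; apply: lee_sum => im _.
apply: interpolation => //.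
by apply: le_lt_trans hoo; exact: coord_energy_le.
Qed.

End Jets.

(** * Absorption of the intermediate derivatives *)

Section InterpolationConstants.
Context {R : realType}.

(* The relation that [vinterpolation] gives between the energies [e j] of the entries of a jet. *)
Definition interpolating (k : nat) (e : nat -> R) := (forall j, 0 <= e j) /\
  forall j (d : R), (j.+2 <= k)%N -> 0 < d ->
    d ^+ 2 * e j.+1 <= 6 * e j + 3 * d ^+ 4 * e j.+2.

(** The bound on e j by a small multiple of e j.+1 is inserted in the three-term inequality, where e
    j.+1 is absorbed on the left. *)
Lemma interpolating_step k j (eps : R) : (j < k)%N -> 0 < eps ->
  exists2 C : R, 0 <= C & forall e, interpolating k e -> e j <= eps * e j.+1 + C * e 0%N.
Proof.
elim: j eps => [|j IH] eps jk eps0.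
  by exists 1 => // e [e0 _]; rewrite mul1r lerDr mulr_ge0// ltW.
(* With d^2 = D = eps / 6 below, 6 / D times eps / 72 equals 1/2, which is absorbed, and 3 D equals
   eps / 2. *)
have [C C0 HC] := IH (eps / 72) (ltnW jk) (divr_gt0 eps0 (ltr0n _ 72)).
exists (72 / eps * C); first by rewrite mulr_ge0// divr_ge0// ltW.
move=> e ie; have {}HC := HC e ie; have [e0 He] := ie.
pose D := eps / 6; have D0 : 0 < D by rewrite divr_gt0.
have := He j (Num.sqrt D) jk; rewrite sqrtr_gt0 D0 => /(_ isT).
rewrite (exprM (Num.sqrt D) 2 2) sqr_sqrtr; last exact: ltW.
move=> h.
have h1 : e j.+1 <= 6 / D * e j + 3 * D * e j.+2.
  rewrite -(ler_pM2l D0) (le_trans h)//.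
  by rewrite (_ : D * _ = 6 * e j + 3 * D ^+ 2 * e j.+2)//; field; rewrite gt_eqF.
have h2 : 6 / D * e j <= 6 / D * (eps / 72 * e j.+1 + C * e 0%N).
  by rewrite ler_pM2l// divr_gt0.
have E1 : 6 / D * (eps / 72 * e j.+1 + C * e 0%N) = 2^-1 * e j.+1 + 36 / eps * C * e 0%N.
  by rewrite /D; field; rewrite gt_eqF.
have E2 : 3 * D * e j.+2 = 2^-1 * eps * e j.+2 by rewrite /D; field.
have h3 : e j.+1 <= 2^-1 * e j.+1 + 36 / eps * C * e 0%N + 2^-1 * eps * e j.+2.
  by rewrite -E1 -E2; apply: (le_trans h1); rewrite lerD2r.
have E3 : 72 / eps * C * e 0%N = 2 * (36 / eps * C * e 0%N) by field; rewrite gt_eqF.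
by rewrite E3; move: h3; set x := 36 / eps * C * e 0%N; lra.
Qed.

(** Going down from k, the first step uses the given eps and all later ones use 1, so that eps is
    never multiplied up. The constants are added to get one valid for all j. *)
Lemma interpolating_bound k (eps : R) : 0 < eps ->
  exists2 C : R, 0 <= C & forall e, interpolating k e -> forall j, (j < k)%N ->
    e j <= eps * e k + C * e 0%N.
Proof.
move=> eps0.
have H i : (i <= k)%N -> (0 < i)%N -> exists2 C : R, 0 <= C &
    forall e, interpolating k e -> e (k - i)%N <= eps * e k + C * e 0%N.
  elim: i => [//|[|i] IH] ik _.
    have k0 : (k - 1 < k)%N by rewrite ltn_subrL.
    have [C C0 HC] := interpolating_step k0 eps0; exists C => // e /HC.
    by rewrite subn1 prednK.
  have [C C0 HC] := IH (ltnW ik) isT.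
  have ki : (k - i.+2 < k)%N by rewrite ltn_subrL (leq_trans _ ik).
  have [C' C'0 HC'] := interpolating_step ki (@ltr01 R).
  exists (C + C'); first exact: addr_ge0.
  move=> e ie; apply: (le_trans (HC' e ie)); rewrite mul1r -subSn// subSS mulrDl addrA lerD2r.
  exact: HC.
have : forall n, (n <= k)%N -> exists2 C : R, 0 <= C & forall e, interpolating k e ->
    forall i, (0 < i)%N -> (i <= n)%N -> e (k - i)%N <= eps * e k + C * e 0%N.
  elim=> [_|n IH nk]; first by exists 0 => // e _ [].
  have [C C0 HC] := IH (ltnW nk).
  have [C' C'0 HC'] := H n.+1 nk isT.
  exists (C + C'); first exact: addr_ge0.
  move=> e ie i i0; have [e0 _] := ie; rewrite leq_eqVlt => /orP[/eqP ->|].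
    by apply: (le_trans (HC' e ie)); rewrite lerD2l ler_wpM2r// lerDr.
  by rewrite ltnS => ni; apply: (le_trans (HC e ie i i0 ni)); rewrite lerD2l ler_wpM2r// lerDl.
move=> /(_ k (leqnn k))[C C0 HC]; exists C => // e ie j jk.
have := HC e ie (k - j)%N; rewrite subn_gt0 jk leq_subr subKn ?(ltnW jk)//; exact.
Qed.

End InterpolationConstants.

(** * Leibniz rule and commutators with a cutoff *)

Section Leibniz.
Context {R : realType} {s : scalars} {m : nat}.
Local Notation F := (scalar_field R s).
Local Notation V := 'cV[F]_m.
Local Notation mu := (@lebesgue_measure R).
Implicit Types (f g u : R -> V) (J : nat -> R -> V) (eta : R -> R).

(* [leib j eta J] is the j-th derivative of [eta J] expanded by the Leibniz rule, written as a
   recursion instead of with binomial coefficients. *)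
Fixpoint leib (j : nat) eta J : R -> V :=
  if j is j'.+1 then fun x => leib j' (derive1 eta) J x + leib j' eta (fun i => J i.+1) x
  else fun x => of_real s (eta x) *: J 0%N x.

Lemma leib_vder j eta J : smooth eta ->
  (forall i, (i <= j)%N -> is_weak_derivative 1 (J i) (J i.+1)) ->
  is_weak_derivative 1 (leib j eta J) (leib j.+1 eta J).
Proof.
elim: j eta J => [|j IH] eta J seta HJ.
  move=> im i; have := wderM seta (HJ 0%N (leqnn _) im i).
  congr wder; apply/funext => x /=; first by rewrite coordinateZ.
  by rewrite coordinateD !coordinateZ.
apply: vderD; first by apply: IH; [exact: smooth_derive1|move=> i ij; apply: HJ; exact: leqW].
by apply: IH => // i ij; exact: HJ.
Qed.

Lemma leib_le j eta J (M x : R) : (forall i, (i <= j)%N -> `|derive1n i eta x| <= M) ->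
  n1 (leib j eta J x) <= M * 2 ^+ j * \sum_(i < j.+1) n1 (J i x).
Proof.
elim: j eta J => [|j IH] eta J H.
  rewrite /= n1Z big_ord1 expr0 mulr1 ler_wpM2r ?n1_ge0//; exact: (H 0%N).
have M0 : 0 <= M by apply: le_trans (H 0%N isT).
apply: (le_trans (n1D _ _)).
have H1 : n1 (leib j (derive1 eta) J x) <= M * 2 ^+ j * \sum_(i < j.+1) n1 (J i x).
  by apply: IH => i ij; rewrite -derive1nSr; exact: H.
have H2 : n1 (leib j eta (fun i => J i.+1) x) <= M * 2 ^+ j * \sum_(i < j.+1) n1 (J i.+1 x).
  by apply: IH => i ij; apply: H; exact: leqW.
rewrite exprSr mulrA -mulrA mulr_natl mulr2n mulrDr.
have c0 : 0 <= M * 2 ^+ j by rewrite mulr_ge0// exprn_ge0.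
apply: lerD.
  by apply: (le_trans H1); rewrite ler_wpM2l// [leRHS]big_ord_recr/= lerDl n1_ge0.
by apply: (le_trans H2); rewrite ler_wpM2l// [leRHS]big_ord_recl/= lerDr n1_ge0.
Qed.

(** Subtracting eta J j leaves only terms in which eta is differentiated at least once, so that the
    size of eta itself does not enter. *)
Lemma leib_commutator j eta J (e x : R) : 0 <= e ->
  (forall i, (0 < i <= j)%N -> `|derive1n i eta x| <= e) ->
  n1 (leib j eta J x - of_real s (eta x) *: J j x) <= e * 2 ^+ j * \sum_(i < j.+1) n1 (J i x).
Proof.
move=> e0; elim: j eta J => [|j IH] eta J H.
  by rewrite /= subrr n10 mulr_ge0 ?mulr_ge0 ?exprn_ge0 ?sumr_ge0// => i _; exact: n1_ge0.
rewrite /= -addrA; apply: (le_trans (n1D _ _)).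
have H1 : n1 (leib j (derive1 eta) J x) <= e * 2 ^+ j * \sum_(i < j.+1) n1 (J i x).
  by apply: leib_le => i ij; rewrite -derive1nSr; exact: H.
have H2 : n1 (leib j eta (fun i => J i.+1) x - of_real s (eta x) *: J j.+1 x) <=
    e * 2 ^+ j * \sum_(i < j.+1) n1 (J i.+1 x).
  by apply: (IH eta (fun i => J i.+1)) => i /andP[i0 ij]; apply: H; rewrite i0 leqW.
rewrite exprSr mulrA -mulrA mulr_natl mulr2n mulrDr.
have c0 : 0 <= e * 2 ^+ j by rewrite mulr_ge0// exprn_ge0.
apply: lerD.
  by apply: (le_trans H1); rewrite ler_wpM2l// [leRHS]big_ord_recr/= lerDl n1_ge0.
by apply: (le_trans H2); rewrite ler_wpM2l// [leRHS]big_ord_recl/= lerDr n1_ge0.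
Qed.

Lemma leib_eq0 j eta J (x : R) : (forall i, (i <= j)%N -> derive1n i eta x = 0) ->
  leib j eta J x = 0.
Proof.
move=> H; apply: n1_eq0; apply/le_anti; rewrite n1_ge0 andbT.
have := @leib_le j eta J 0 x; rewrite !mul0r; apply => i ij; by rewrite H// normr0.
Qed.

Lemma leib_eq1 j eta J (x : R) : eta x = 1 -> (forall i, (0 < i <= j)%N -> derive1n i eta x = 0) ->
  leib j eta J x = J j x.
Proof.
move=> e1 H; apply/eqP; rewrite -subr_eq0; apply/eqP; apply: n1_eq0.
apply/le_anti; rewrite n1_ge0 andbT.
have := @leib_commutator j eta J 0 x (lexx 0); rewrite !mul0r e1 of_real1 scale1r; apply => i ij.
by rewrite H// normr0.
Qed.

Lemma leibB j eta J J' (x : R) :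
  leib j eta (fun i x => J i x - J' i x) x = leib j eta J x - leib j eta J' x.
Proof.
elim: j eta J J' => [|j IH] eta J J' /=; first by rewrite scalerBr.
by rewrite !IH opprD addrACA.
Qed.

Lemma leib_vmeas j eta J : smooth eta -> (forall i, (i <= j)%N -> vmeas (J i)) -> vmeas (leib j eta J).
Proof.
elim: j eta J => [|j IH] eta J seta HJ /=.
  apply: vmeasZ; last exact: HJ.
  by apply: continuous_measurable_fun; exact: smooth_continuous.
apply: vmeasD.
  by apply: IH => [|i ij]; [exact: smooth_derive1|apply: HJ; exact: leqW].
by apply: IH => // i ij; exact: HJ.
Qed.

End Leibniz.

(** * Periodization *)

Section Periodization.
Context {R : realType}.
Local Notation mu := (@lebesgue_measure R).

(** A test function sees only a bounded interval. A periodization coincides there with a finite sum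
    of translates whose length depends on the interval. *)
Lemma wder_local j (f g : R -> R) :
  (forall Q : nat, exists f' g', wder j f' g' /\
     forall x, `|x| <= Q%:R -> f x = f' x /\ g x = g' x) -> wder j f g.
Proof.
move=> H.
have li (u : R -> R) : (forall Q : nat, exists2 u', locally_integrable setT u' &
    forall x, `|x| <= Q%:R -> u x = u' x) -> locally_integrable setT u.
  move=> Hu; apply/locintP; split.
    (* At each x the sequence v n x is eventually equal to u x, so u is measurable as a pointwise
       limit. *)
    pose v n := projT1 (cid2 (Hu n)).
    have vE n : locally_integrable setT (v n) /\ forall x, `|x| <= n%:R -> u x = v n x.
      by rewrite /v; case: cid2.
    apply: (@measurable_fun_cvg _ _ _ setT v u) => [n|x _].
      by apply: locint_measurable; exact: (vE n).1.
    apply: cvg_near_cst; exists (Num.bound `|x|) => // n /= xn.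
    rewrite -(vE n).2// (le_trans (ltW (archi_boundP _)))// ler_nat//.
  move=> a b; pose Q := Num.bound (Num.max `|a| `|b|).
  have [u' lu' uu'] := Hu Q.
  have := locint_itv a b lu'; apply: eq_integrable; first exact: measurable_itv.
  move=> x; rewrite inE/= in_itv/= => /andP[ax xb]; congr EFin; apply/esym/uu'.
  have m0 : 0 <= Num.max `|a| `|b| by rewrite le_max normr_ge0.
  apply: le_trans (ltW (archi_boundP m0)).
  rewrite ler_norml lerNl !le_max; apply/andP; split.
    by rewrite -(normrN a) (le_trans _ (ler_norm (- a)))// lerN2.
  by rewrite (le_trans xb (ler_norm b)) orbT.
split.
- by apply: li => Q; have [f' [g' [[lf' _ _] E]]] := H Q; exists f' => // x /E[].
- by apply: li => Q; have [f' [g' [[_ lg' _] E]]] := H Q; exists g' => // x /E[].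
move=> phi tphi.
have [_ [M HM]] := (test_functionP _).1 tphi.
have [_ [M' HM']] := (test_functionP _).1 (test_function_derive1n j tphi).
pose Q := Num.bound (Num.max `|M| `|M'|).
have m0 : 0 <= Num.max `|M| `|M'| by rewrite le_max normr_ge0.
have [f' [g' [[_ _ D] E]]] := H Q.
have key (u u' psi : R -> R) N : (forall x, `|x| <= Q%:R -> u x = u' x) ->
    (forall x, N < `|x| -> psi x = 0) -> N <= Q%:R ->
    \int[mu]_x (u x * psi x) = \int[mu]_x (u' x * psi x).
  move=> uu' psi0 NQ; apply: eq_Rintegral => x _.
  have [xQ|Qx] := leP `|x| Q%:R; first by rewrite uu'.
  by rewrite psi0 ?mulr0// (le_lt_trans NQ).
have MQ : M <= Q%:R.
  by apply: le_trans (ltW (archi_boundP m0)); rewrite le_max ler_norm.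
have MQ' : M' <= Q%:R.
  by apply: le_trans (ltW (archi_boundP m0)); rewrite le_max ler_norm orbT.
have Ef x : `|x| <= Q%:R -> f x = f' x by move=> /E[].
have Eg x : `|x| <= Q%:R -> g x = g' x by move=> /E[].
by rewrite (key f f' _ M' Ef HM' MQ') (key g g' _ M Eg HM MQ); exact: D.
Qed.

Variable p : R.
Hypothesis p0 : 0 < p.

Fixpoint shifts (N : nat) : seq R :=
  if N is N'.+1 then N'.+1%:R * p :: - (N'.+1%:R * p) :: shifts N' else [:: 0].

Context {s : scalars} {m : nat}.
Local Notation F := (scalar_field R s).
Local Notation V := 'cV[F]_m.
Implicit Types (f g : R -> V).

Definition tsum N g x : V := \sum_(c <- shifts N) g (x + c).

(* For [g] vanishing outside (-3p/4, 3p/4) this is the sum over all translates by multiples of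
   [p]; the range of the sum depends on [x] so that no infinite sum is needed. *)
Definition per g x : V := tsum (Num.bound (`|x| / p)) g x.

(** The value 3/4 lies strictly between 2/3, beyond which the cutoffs vanish together with their
    derivatives, and 1; the margin p / 4 makes [tsum N] exact up to |x| = N p + p / 4. *)
Definition supp34 g := forall x, 3 / 4 * p <= `|x| -> g x = 0.

Lemma tsumS N g x : tsum N.+1 g x = g (x + N.+1%:R * p) + (g (x - N.+1%:R * p) + tsum N g x).
Proof. by rewrite /tsum /= !big_cons. Qed.

(** A shift by at least (N + 1) p moves such an x to distance at least p - p / 4 = 3 p / 4 from 0,
    where g vanishes. *)
Lemma tsum_stable g N N' x : supp34 g -> `|x| <= N%:R * p + p / 4 -> (N <= N')%N ->
  tsum N' g x = tsum N g x.
Proof.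
move=> sg xN; elim: N' => [|N' IH]; first by rewrite leqn0 => /eqP ->.
rewrite leq_eqVlt => /orP[/eqP -> //|]; rewrite ltnS => NN'.
have NN'R : (N%:R : R) <= N'%:R by rewrite ler_nat.
have NE : N'.+1%:R * p = N'%:R * p + p by rewrite -natr1 mulrDl mul1r.
have NP : (N%:R : R) * p <= N'%:R * p by rewrite ler_wpM2r// ltW.
move: xN; rewrite ler_norml => /andP[x1 x2].
have h1 : g (x + (N'%:R * p + p)) = 0 by apply: sg; rewrite ler_normr; apply/orP; left; lra.
have h2 : g (x - (N'%:R * p + p)) = 0 by apply: sg; rewrite ler_normr; apply/orP; right; lra.
by rewrite tsumS IH// NE h1 h2 !add0r.
Qed.

Lemma per_tsum g N x : supp34 g -> `|x| <= N%:R * p + p / 4 -> per g x = tsum N g x.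
Proof.
move=> sg xN; rewrite /per; set M := Num.bound _.
have xM : `|x| <= M%:R * p + p / 4.
  have : `|x| / p < M%:R by apply: archi_boundP; rewrite divr_ge0// ltW.
  by rewrite ltr_pdivrMr// => /ltW H; apply: (le_trans H); rewrite lerDl divr_ge0// ltW.
have [NM|MN] := leqP N M; first exact: tsum_stable.
by apply/esym/tsum_stable => //; exact: ltnW.
Qed.

(** Both sides are the sum over the translates from -N p to (N + 1) p: a shift by p exchanges only
    the end terms. *)
Lemma tsum_addp N g x : tsum N g (x + p) + g (x - N%:R * p) = tsum N g x + g (x + N.+1%:R * p).
Proof.
elim: N => [|N IH]; first by rewrite /tsum /= !big_seq1 !addr0 mul0r subr0 mul1r addrC.
rewrite !tsumS.
have -> : x + p + N.+1%:R * p = x + N.+2%:R * p by rewrite -[N.+2%:R]natr1; ring.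
have -> : x + p - N.+1%:R * p = x - N%:R * p by rewrite -[N.+1%:R]natr1; ring.
apply: coordinate_inj => im i; have := congr1 (coordinate im i) IH.
by rewrite !coordinateD; lra.
Qed.

Lemma per_periodic g x : supp34 g -> per g (x + p) = per g x.
Proof.
(* The additional unit makes N serve for x + p as well as for x, and makes both end terms of
   [tsum_addp] vanish. *)
move=> sg; pose N := (Num.bound (`|x| / p)).+1.
have H : `|x| < (Num.bound (`|x| / p))%:R * p.
  by rewrite -ltr_pdivrMr//; apply: archi_boundP; rewrite divr_ge0// ltW.
have E : (N%:R : R) = (Num.bound (`|x| / p))%:R + 1 by rewrite -natr1.
have E2 : (N.+1%:R : R) = (Num.bound (`|x| / p))%:R + 1 + 1 by rewrite -natr1 E.
have xp : `|x + p| <= `|x| + p by rewrite (le_trans (ler_normD _ _))// (gtr0_norm p0).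
have p40 : 0 <= p / 4 by rewrite divr_ge0// ltW.
rewrite (@per_tsum g N x)//; last by rewrite E mulrDl mul1r; lra.
rewrite (@per_tsum g N (x + p))//; last by rewrite E mulrDl mul1r; lra.
have := tsum_addp N g x.
have [x1 x2] : - `|x| <= x /\ x <= `|x| by split; [rewrite lerNl -normrN ler_norm|exact: ler_norm].
rewrite (sg (x - _)); last by rewrite ler_normr E mulrDl mul1r; apply/orP; right; lra.
by rewrite (sg (x + _)) ?addr0// E2 !mulrDl !mul1r ler_normr; apply/orP; left; lra.
Qed.

Lemma vder_tsum N j f g : is_weak_derivative j f g -> is_weak_derivative j (tsum N f) (tsum N g).
Proof.
move=> H; elim: N => [|N IH].
  by rewrite /tsum; have := vder_addr 0 H; congr is_weak_derivative; apply/funext => x; rewrite big_seq1.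
have E u : tsum N.+1 u = fun x => u (x + N.+1%:R * p) + (u (x - N.+1%:R * p) + tsum N u x).
  by apply/funext => x; exact: tsumS.
by rewrite !E; apply: vderD; [exact: vder_addr|apply: vderD => //; exact: vder_addr].
Qed.

Lemma vder_per j f g : is_weak_derivative j f g -> supp34 f -> supp34 g ->
  is_weak_derivative j (per f) (per g).
Proof.
move=> H sf sg im i; apply: wder_local => Q.
pose N := Num.bound (Q%:R / p).
have QN : Q%:R < N%:R * p :> R.
  by rewrite -ltr_pdivrMr//; apply: archi_boundP; rewrite divr_ge0// ltW.
exists (coordinate im i \o tsum N f), (coordinate im i \o tsum N g); split; first exact: vder_tsum H im i.
move=> x xQ /=.
have xN : `|x| <= N%:R * p + p / 4.
  by apply: (le_trans xQ); apply: (le_trans (ltW QN)); rewrite lerDl divr_ge0// ltW.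
by rewrite !(@per_tsum _ N).
Qed.

(** On D only the listed translates contribute, each with at most the full energy; the constant
    depends on their number and not on p. *)
Lemma energy_per_itv (D : set R) g N : measurable D -> vmeas g -> vmeas (per g) -> supp34 g ->
  (forall x, D x -> `|x| <= N%:R * p + p / 4) ->
  (energy D (per g) <= (2 ^+ size (shifts N) * @n1c R m * (size (shifts N))%:R)%:E * energy setT g)%E.
Proof.
move=> mD mg mp sg DN.
have c0 : 0 <= 2 ^+ size (shifts N) * @n1c R m :> R by rewrite mulr_ge0 ?exprn_ge0 ?n1c_ge0.
have := @energy_le_n1 R s m R (shifts N) D (per g) (fun c x => g (x + c)) 1 mD ler01 mp.
move=> /(_ (fun c => vmeas_addr c mg)).
rewrite expr1n mul1r => H.
apply: (@le_trans _ _ ((2 ^+ size (shifts N) * @n1c R m)%:E *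
    \sum_(c <- shifts N) energy D (fun x => g (x + c)%R))%E).
  apply: H; apply: aeW => x /= Dx; rewrite mul1r (@per_tsum _ N) ?DN//; exact: n1_sum.
rewrite [X in (_ <= X * _)%E]EFinM -[leRHS]muleA; apply: lee_wpmul2l; first by rewrite lee_fin.
have sumE (r : seq R) : (\sum_(c <- r) energy setT g = (size r)%:R%:E * energy setT g)%E.
  elim: r => [|c r IH]; first by rewrite big_nil mul0e.
  by rewrite big_cons IH /= -natr1 EFinD ge0_muleDl ?lee_fin// mul1e addeC.
rewrite -sumE; apply: lee_sum => c _; rewrite -(energy_addr c mg).
by apply: energy_subset => //; exact: vmeas_addr.
Qed.

(** The line is a countable union of translates of the cell, and translates of null sets are
    null. *)
Lemma ae_periodic (P : R -> Prop) : (forall x, P x <-> P (x + p)) ->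
  {ae mu, forall x, - (p / 2) <= x < p / 2 -> P x} -> {ae mu, forall x, P x}.
Proof.
move=> PP H.
have Pn n x : P x <-> P (x + n%:R * p).
  elim: n => [|n IH]; first by rewrite mul0r addr0.
  by rewrite -natr1 mulrDl mul1r addrA; split=> [/(IH.1)/(PP _).1|/(PP _).2/(IH.2)].
have H1 : {ae mu, forall x, forall n : nat, - (p / 2) <= x + n%:R * p < p / 2 -> P (x + n%:R * p)}.
  by apply: ae_foralln => n; exact: (ae_addr (n%:R * p) H).
have H2 : {ae mu, forall x, forall n : nat, - (p / 2) <= x + - (n%:R * p) < p / 2 -> P (x + - (n%:R * p))}.
  by apply: ae_foralln => n; exact: (ae_addr (- (n%:R * p)) H).
apply: (ae_imp2 _ H1 H2) => x h1 h2.
(* The index for which x - k p lies in the cell. Its sign decides which of the two families of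
   natural shifts is used. *)
pose k := Num.floor ((x + p / 2) / p).
have /andP[k1 k2] := real_floor_itv (num_real ((x + p / 2) / p)).
rewrite -/k in k1 k2.
rewrite ler_pdivlMr// in k1; rewrite ltr_pdivrMr// in k2.
rewrite intrD mulrDl mul1r in k2.
case: (k) k1 k2 => n; rewrite ?NegzE ?mulrNz -!pmulrn => k1 k2.
  apply: (iffRL (_ : P x <-> P (x - n%:R * p))); last by apply: h2; apply/andP; split; lra.
  by have := Pn n (x - n%:R * p); rewrite subrK => ->.
by apply/(Pn n.+1)/h1; apply/andP; split; lra.
Qed.

End Periodization.

Lemma top_arith (R : realType) (S p q a b : R) : 0 <= S -> 0 <= p -> 0 <= q -> 0 <= a -> 0 <= b ->
  a + (p * S + q * b) <= (1 + p + q) * (b + S + a).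
Proof. by move=> *; nra. Qed.

(** * Boundedness of the inverse into H^k *)

Section InverseBound.
Context {R : realType} {s : scalars} {m : nat}.
Local Notation F := (scalar_field R s).
Local Notation V := 'cV[F]_m.
Local Notation mu := (@lebesgue_measure R).
Variables (k : nat) (alpha : nat -> R -> 'M[F]_m) (Bm : R -> 'M[F]_m) (ca cb kappa : R).
Hypothesis alpha_le : forall j x, (1 <= j <= k)%N -> mxbound (alpha j x) ca.
Hypothesis Bm_le : forall x, mxbound (Bm x) cb.
Hypothesis alpha_inv : forall x w, n1 w <= kappa * n1 (alpha k x *m w).
Hypothesis k_gt0 : (0 < k)%N.

(** The equation is solved for its top-order term and the leading coefficient is inverted. The datum
    f takes slot k of the sum, so that one indexed family can be handed to [energy_le_n1]. *)
Lemma top_pointwise (J : nat -> R -> V) (f : V) (x : R) : 0 <= ca -> 0 <= cb -> 0 <= kappa ->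
  \sum_(1 <= j < k.+1) alpha j x *m J j x + Bm x *m J 0%N x = f ->
  n1 (J k x) <= kappa * (1 + (2 * m)%:R * ca + (2 * m)%:R * cb) *
    \sum_(i <- index_iota 0 k.+1) n1 (if (i < k)%N then J i x else f).
Proof.
move=> ca0 cb0 kp0 eqf; rewrite -mulrA.
apply: (le_trans (alpha_inv x _)); apply: ler_wpM2l => //.
have -> : alpha k x *m J k x =
    f - (\sum_(1 <= j < k) alpha j x *m J j x + Bm x *m J 0%N x).
  rewrite -eqf big_nat_recr //= [X in X - _](_ : _ = alpha k x *m J k x +
    (\sum_(1 <= j < k) alpha j x *m J j x + Bm x *m J 0%N x)); last first.
    by rewrite addrA [alpha k x *m _ + _]addrC.
  by rewrite addrK.
have -> : \sum_(i <- index_iota 0 k.+1) n1 (if (i < k)%N then J i x else f) =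
    n1 (J 0%N x) + \sum_(1 <= i < k) n1 (J i x) + n1 f.
  rewrite big_nat_recr //= ltnn big_ltn //= k_gt0; congr (_ + _ + _).
  by apply: eq_big_nat => i /andP[_ ->].
have le1 : n1 (\sum_(1 <= j < k) alpha j x *m J j x) <=
    (2 * m)%:R * ca * \sum_(1 <= i < k) n1 (J i x).
  apply: (le_trans (n1_sum _ _ _)); rewrite mulr_sumr.
  rewrite big_nat [leRHS]big_nat; apply: ler_sum => i /andP[i1 ik].
  by apply: n1_mulmx; apply: alpha_le; rewrite i1 ltnW.
have le2 := n1_mulmx (J 0%N x) (@Bm_le x).
have le3 := n1B f (\sum_(1 <= j < k) alpha j x *m J j x + Bm x *m J 0%N x).
have le4 := n1D (\sum_(1 <= j < k) alpha j x *m J j x) (Bm x *m J 0%N x).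
have S0 : 0 <= \sum_(1 <= i < k) n1 (J i x) by apply: sumr_ge0 => i _; exact: n1_ge0.
have pa := mulr_ge0 (ler0n R (2 * m)) ca0; have pb := mulr_ge0 (ler0n R (2 * m)) cb0.
apply: (le_trans le3); apply: (le_trans (lerD (lexx _) (le_trans le4 (lerD le1 le2)))).
have := n1_ge0 (J 0%N x); have := n1_ge0 f; move: S0 pa pb.
exact: top_arith.
Qed.

Lemma fine_sum_energy (r : seq nat) D (t : nat -> R -> V) :
  (forall i, (energy D (t i) < +oo)%E) ->
  (\sum_(i <- r) energy D (t i) = (\sum_(i <- r) fine (energy D (t i)))%:E)%E.
Proof.
move=> fin; rewrite -sumEFin; apply: eq_bigr => i _.
by rewrite fineK // ge0_fin_numE ?energy_ge0.
Qed.

Lemma energy_top (J : nat -> R -> V) f : 0 <= ca -> 0 <= cb -> 0 <= kappa ->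
  (forall i, (i <= k)%N -> vmeas (J i) /\ (energy setT (J i) < +oo)%E) ->
  vmeas f -> (energy setT f < +oo)%E ->
  {ae mu, forall x, \sum_(1 <= j < k.+1) alpha j x *m J j x + Bm x *m J 0%N x = f x} ->
  fine (energy setT (J k)) <=
    (kappa * (1 + (2 * m)%:R * ca + (2 * m)%:R * cb)) ^+ 2 * 2 ^+ k.+1 * @n1c R m *
    (\sum_(i < k) fine (energy setT (J i)) + fine (energy setT f)).
Proof.
move=> ca0 cb0 kp0 Jfin fm ffin eqf.
pose t i := if (i < k)%N then J i else f.
have tP i : vmeas (t i) /\ (energy setT (t i) < +oo)%E.
  by rewrite /t; case: ifPn => // /ltnW; exact: Jfin.
have C0 : 0 <= kappa * (1 + (2 * m)%:R * ca + (2 * m)%:R * cb).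
  by rewrite mulr_ge0 // !addr_ge0 // mulr_ge0.
have := @energy_le_n1 R s m nat (index_iota 0 k.+1) setT (J k) t _ measurableT C0
  (Jfin k (leqnn k)).1 (fun i => (tP i).1) _.
rewrite size_iota subn0 fine_sum_energy; last by move=> i; exact: (tP i).2.
rewrite -EFinM => H.
rewrite -lee_fin fineK; last by rewrite ge0_fin_numE ?energy_ge0// (Jfin k (leqnn k)).2.
move: H.
have -> : \sum_(i <- index_iota 0 k.+1) fine (energy setT (t i)) =
   \sum_(i < k) fine (energy setT (J i)) + fine (energy setT f).
  rewrite big_nat_recr //= {2}/t ltnn -(big_mkord xpredT (fun i => fine (energy setT (J i)))).
  by congr (_ + _); apply: eq_big_nat => i /andP[_ ik]; rewrite /t ik.
apply; apply: ae_imp eqf => x ex _.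
apply: le_trans (top_pointwise ca0 cb0 kp0 ex) _.
rewrite le_eqVlt; apply/orP; left; apply/eqP; congr (_ * _).
by apply: eq_bigr => i _; rewrite /t; case: ifP.
Qed.

Lemma inverse_bound (B : R -> R) (C0 : R) : smooth_step B -> 0 <= ca -> 0 <= cb -> 0 <= kappa ->
  0 <= C0 -> exists2 C : R, 0 <= C & forall (J : nat -> R -> V) f,
  vlocint (J 0%N) -> vchain k J ->
  (forall i, (i <= k)%N -> (energy setT (J i) < +oo)%E) ->
  vmeas f -> (energy setT f < +oo)%E ->
  {ae mu, forall x, \sum_(1 <= j < k.+1) alpha j x *m J j x + Bm x *m J 0%N x = f x} ->
  (energy setT (J 0%N) <= C0%:E * energy setT f)%E ->
  (\sum_(i < k.+1) energy setT (J i) <= C%:E * energy setT f)%E.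
Proof.
move=> BS ca0 cb0 kp0 C00.
set K := (kappa * (1 + (2 * m)%:R * ca + (2 * m)%:R * cb)) ^+ 2 * 2 ^+ k.+1 * @n1c R m.
have K0 : 0 <= K by rewrite mulr_ge0 ?n1c_ge0 // mulr_ge0 ?sqr_ge0 ?exprn_ge0.
(* K becomes opaque: the arithmetic below needs only K >= 0, and KE is kept to recognize it once. *)
have KE := erefl K; rewrite {1}/K in KE; clearbody K.
have kR : 1 <= k%:R :> R by rewrite ler1n.
(* With this eps, K times the sum of the k lower energies contains at most half of the top energy,
   which is absorbed; K + 1 avoids division by 0. *)
have eps0 : 0 < (2 * (K + 1) * k%:R)^-1 :> R by rewrite invr_gt0; nra.
have [Ci Ci0 Hi] := @interpolating_bound R k _ eps0.
have Q0 : 0 <= k%:R * Ci * C0 by rewrite !mulr_ge0.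
exists ((1 + 1) * (2 * K * (k%:R * Ci * C0 + 1)) + k%:R * Ci * C0).
  have := mulr_ge0 K0 (addr_ge0 Q0 ler01); move: Q0; lra.
move=> J f J0 Jc Jfin fm ffin eqf leJ0.
pose e i := fine (energy setT (J i)).
have eE i : (i <= k)%N -> energy setT (J i) = (e i)%:E.
  by move=> ik; rewrite fineK // ge0_fin_numE ?energy_ge0 // Jfin.
have fE : energy setT f = (fine (energy setT f))%:E.
  by rewrite fineK // ge0_fin_numE ?energy_ge0.
have ie : interpolating k e.
  split=> [j|j d jk d0]; first by rewrite fine_ge0 ?energy_ge0.
  have := vinterpolation BS J0 Jc Jfin jk d0.
  by rewrite (eE j) ?(eE j.+1) ?(eE j.+2) ?(ltnW jk) // ?(ltnW (ltnW jk)).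
have Jm i : (i <= k)%N -> vmeas (J i) /\ (energy setT (J i) < +oo)%E.
  by move=> ik; split; [exact: vlocint_vmeas (vchain_vlocint J0 Jc ik)|exact: Jfin].
have top := energy_top ca0 cb0 kp0 Jm fm ffin eqf.
rewrite KE -/(e k) in top.
have lowsum : \sum_(i < k) e i <= k%:R * ((2 * (K + 1) * k%:R)^-1 * e k + Ci * e 0%N).
  have -> : k%:R * ((2 * (K + 1) * k%:R)^-1 * e k + Ci * e 0%N) =
     \sum_(i < k) ((2 * (K + 1) * k%:R)^-1 * e k + Ci * e 0%N).
    by rewrite sumr_const card_ord mulr_natl.
  by apply: ler_sum => i _; apply: Hi.
have e0f : e 0%N <= C0 * fine (energy setT f).
  by move: leJ0; rewrite eE // fE -EFinM lee_fin fE.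
have f0 : 0 <= fine (energy setT f) by rewrite fine_ge0 ?energy_ge0.
have ek0 : 0 <= e k by rewrite fine_ge0 ?energy_ge0.
rewrite fE -EFinM.
rewrite [leLHS](_ : _ = (\sum_(i < k.+1) e i)%:E); last first.
  by rewrite -sumEFin; apply: eq_bigr => i _; rewrite eE // -ltnS.
rewrite lee_fin big_ord_recr /=.
move: top lowsum e0f f0 ek0; rewrite -/(e _).
have -> : \sum_(i < k) fine (energy setT (J i)) = \sum_(i < k) e i by [].
move: (\sum_(i < k) e i) (fine _) (e k) (e 0%N) => S E a b.
have -> : k%:R * ((2 * (K + 1) * k%:R)^-1 * a + Ci * b) =
   a / (2 * (K + 1)) + k%:R * Ci * b.
  by field; rewrite !gt_eqF //; lra.
move=> top low bE E0 a0.
have kc0 : 0 <= k%:R * Ci by rewrite mulr_ge0.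
have low2 : S <= a / (2 * (K + 1)) + k%:R * Ci * C0 * E.
  by apply: le_trans low _; rewrite lerD2l -!mulrA !ler_wpM2l.
have h1 : K * (a / (2 * (K + 1))) <= a / 2.
  rewrite mulrA ler_pdivrMr; last lra.
  have -> : a / 2 * (2 * (K + 1)) = a * (K + 1) by field.
  by rewrite mulrDr; have := mulr_ge0 a0 K0; lra.
have h2 : a / (2 * (K + 1)) <= a.
  rewrite ler_pdivrMr; last lra.
  have -> : a * (2 * (K + 1)) = 2 * (a * K) + 2 * a by ring.
  by have := mulr_ge0 a0 K0; move: a0; lra.
have h3 : K * S <= K * (a / (2 * (K + 1))) + K * (k%:R * Ci * C0 * E).
  by rewrite -mulrDr ler_wpM2l.
have h4 : a <= 2 * K * (k%:R * Ci * C0 + 1) * E.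
  have -> : 2 * K * (k%:R * Ci * C0 + 1) * E = 2 * (K * (k%:R * Ci * C0 * E)) + 2 * (K * E) by ring.
  move: top h3; rewrite mulrDr; lra.
rewrite mulrDl -mulrA mulrDl !mul1r; lra.
Qed.

End InverseBound.

(** * Uniform differentiability of the nonlinearity *)

Section ScalarTopology.
Context {R : realType} {s : scalars}.
Local Notation F := (scalar_field R s).

Lemma of_real_lt (a b : R) : (of_real s a < of_real s b) = (a < b).
Proof. by case: s => //=; rewrite ltcR. Qed.

(** In the order of the complex field positive elements are real, so radii of balls in F always come
    from R. *)
Lemma gt0_of_real (e : F) : 0 < e -> e = of_real s (real_part e).
Proof.
case: s e => //= e; rewrite ltcE => /andP[/eqP /= ie _].
by case: e ie => a b /= ->.
Qed.

Lemma part_le_norm im (x : F) (e : R) : `|x| < of_real s e -> `|part im x| < e.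
Proof.
case: s x => //= x.
  by case: im => //= xe; rewrite /part /= normr0 (le_lt_trans _ xe).
rewrite normc_def ltcR => xe; apply: le_lt_trans xe.
rewrite -sqrtr_sqr ler_wsqrtr //.
by case: im; rewrite /part /= ?lerDl ?lerDr sqr_ge0.
Qed.

Lemma norm_lt_parts (x : F) (e : R) : (forall im, `|part im x| < e) -> `|x| < of_real s (2 * e).
Proof.
move=> xe; have e0 : 0 < e by apply: le_lt_trans (xe false).
move: x xe; case: s => /= x xe.
  by have := xe false; rewrite /part /=; lra.
rewrite normc_def ltcR -[ltRHS]ger0_norm; last lra.
rewrite -sqrtr_sqr ltr_sqrt; last by rewrite exprn_gt0 //; lra.
have := xe false; have := xe true; rewrite /part /= => h1 h2.
rewrite exprMn; move: h1 h2; rewrite !ltr_norml => /andP[? ?] /andP[? ?]; nra.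
Qed.

Lemma near_part (x : F) (e : R) : 0 < e -> \forall y \near x, forall im, `|part im (y - x)| < e.
Proof.
move=> e0; apply/nbhs_ballP; exists (of_real s e) => /=.
  by rewrite -(@of_real0 R s) of_real_lt.
by move=> y; rewrite -ball_normE /= distrC => xy im; exact: part_le_norm.
Qed.

Lemma nbhs_part (x : F) (A : set F) : nbhs x A ->
  exists2 e : R, 0 < e & forall y, (forall im, `|part im (y - x)| < e) -> A y.
Proof.
move=> /nbhs_ballP[e /= e0 eA]; exists (real_part e / 2).
  by rewrite divr_gt0 // -of_real_lt of_real0 -gt0_of_real.
move=> y xy; apply: eA; rewrite -ball_normE /= distrC (gt0_of_real e0).
by have := norm_lt_parts xy; rewrite mulrC divfK.
Qed.

Lemma mkpart_part (x : F) : mkpart s (part false x) (part true x) = x.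
Proof. by case: s x => //= -[]. Qed.

Lemma part_mkpart_le im (a b a' b' e : R) : `|a - a'| < e -> `|b - b'| < e ->
  `|part im (mkpart s a b - mkpart s a' b')| < e.
Proof.
move=> ae be; rewrite partB; case: s; case: im => //=.
by rewrite /part /= subrr normr0 (le_lt_trans _ ae).
Qed.

Lemma mkpart_continuous : continuous (fun p : R * R => mkpart s p.1 p.2).
Proof.
move=> [a b] A /nbhs_part[e e0 eA]; rewrite nbhs_simpl /=.
have na : \forall y \near a, `|y - a| < e.
  by apply/nbhs_ballP; exists e => // y; rewrite -ball_normE /= distrC.
have nb : \forall y \near b, `|y - b| < e.
  by apply/nbhs_ballP; exists e => // y; rewrite -ball_normE /= distrC.
exists ([set y | `|y - a| < e], [set y | `|y - b| < e]) => //= -[a' b'] /= [ha hb].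
by apply: eA => im; exact: part_mkpart_le.
Qed.

(** Compactness is inherited from a real square, for both scalar fields at once; over the reals the
    second component is ignored. *)
Definition part_box (r : R) : set F :=
  (fun p : R * R => mkpart s p.1 p.2) @` (`[- r, r]%classic `*` `[- r, r]%classic).

Lemma part_box_compact r : compact (part_box r).
Proof.
apply: continuous_compact; last by apply: compact_setX; exact: segment_compact.
by apply: continuous_subspaceT; exact: mkpart_continuous.
Qed.

Lemma part_boxP (r : R) (x : F) : (forall im, `|part im x| <= r) -> part_box r x.
Proof.
move=> xr; exists (part false x, part true x); last exact: mkpart_part.
have := xr false; have := xr true; rewrite !ler_norml => xt xf.
by split; rewrite /= in_itv.
Qed.

End ScalarTopology.

(** * Topology of matrices and vectors in real coordinates *)

Section MatrixTopology.
Context {R : realType} {s : scalars}.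
Local Notation F := (scalar_field R s).

Lemma near_mx_part m n (M : 'M[F]_(m, n)) (e : R) : 0 < e ->
  \forall N \near M, forall im i j, `|part im ((N : 'M[F]_(m, n)) i j - M i j)| < e.
Proof.
move=> e0; exists (fun i j => [set y | forall im, `|part im (y - M i j)| < e]).
  by move=> i j; exact: near_part.
by move=> N MN im i j; exact: MN.
Qed.

Lemma nbhs_mx_part m n (M : 'M[F]_(m, n)) (A : set 'M[F]_(m, n)) : nbhs M A ->
  exists2 e : R, 0 < e & forall N : 'M[F]_(m, n), (forall im i j, `|part im (N i j - M i j)| < e) -> A N.
Proof.
move=> [P PM PA].
have : \forall e \near (0 : R)^'+, forall ij : 'I_m * 'I_n,
    forall y, (forall im, `|part im (y - M ij.1 ij.2)| < e) -> P ij.1 ij.2 y.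
  apply: filter_forall => -[i j]; have [e e0 eP] := nbhs_part (PM i j).
  near=> d => y yd; apply: eP => im; apply: lt_trans (yd im) _.
  by near: d; exact: nbhs_right_lt.
move=> eP; have [e [e0 He]] : exists e : R, 0 < e /\ forall ij : 'I_m * 'I_n,
    forall y, (forall im, `|part im (y - M ij.1 ij.2)| < e) -> P ij.1 ij.2 y.
  near (0 : R)^'+ => e; exists e; split; first by near: e; exact: nbhs_right_gt.
  by near: e.
exists e => // N MN; apply: PA => i j; apply: (He (i, j)) => im; exact: MN.
Unshelve. all: by end_near. Qed.

Lemma continuous_mx_part (T : topologicalType) m n (f : T -> 'M[F]_(m, n)) (x : T) (e : R) :
  {for x, continuous f} -> 0 < e ->
  \forall y \near x, forall im i j, `|part im (f y i j - f x i j)| < e.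
Proof. by move=> fc e0; have := near_mx_part (f x) e0; exact: fc. Qed.

Lemma continuous_mxP (T : topologicalType) m n (f : T -> 'M[F]_(m, n)) (x : T) :
  (forall e : R, 0 < e -> \forall y \near x, forall im i j, `|part im (f y i j - f x i j)| < e) ->
  {for x, continuous f}.
Proof.
move=> fc A /nbhs_mx_part[e e0 eA]; rewrite nbhs_simpl /=.
by apply: filterS (fc e e0) => y ye; exact: eA.
Qed.

Lemma mx_part_continuous (T : topologicalType) m n (f : T -> 'M[F]_(m, n)) im i j :
  continuous f -> continuous (fun x => part im (f x i j)).
Proof.
move=> fc x; apply/cvgrPdist_lt => e e0.
have := continuous_mx_part (@fc x) e0; apply: filterS => y /(_ im i j).
by rewrite partB distrC.
Qed.

End MatrixTopology.

Section VectorTopology.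
Context {R : realType} {s : scalars} {m : nat}.
Local Notation F := (scalar_field R s).
Local Notation V := 'cV[F]_m.
Implicit Types (f g u : R -> V).

Lemma vcont_continuous u : vcont u -> continuous u.
Proof.
move=> uc x; apply: continuous_mxP => e e0.
have : \forall y \near x, forall ii : bool * 'I_m,
    `|coordinate ii.1 ii.2 (u y) - coordinate ii.1 ii.2 (u x)| < e.
  apply: (@filter_forall R _ (fun ii y => `|coordinate ii.1 ii.2 (u y) - coordinate ii.1 ii.2 (u x)| < e) (nbhs x)) => -[im i].
  have /cvgrPdist_lt/(_ _ e0) := @uc im i x.
  by apply: filterS => y; rewrite distrC.
apply: filterS => y ye im i j; have := ye (im, i).
by rewrite !coordinateE -partB (ord1 j).
Qed.

Lemma continuous_vcont u : continuous u -> vcont u.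
Proof. by move=> uc im i; have := mx_part_continuous (j := ord0) uc; apply. Qed.

Lemma near_n1 (w : V) (e : R) : 0 < e -> \forall w' \near w, n1 (w' - w) < e.
Proof.
move=> e0; have d0 : 0 < e / ((2 * m)%:R + 1) by rewrite divr_gt0 // ltr_wpDl.
have := near_mx_part w d0; apply: filterS => w' ww'.
have : n1 (w' - w) <= (2 * m)%:R * (e / ((2 * m)%:R + 1)).
  by apply: n1_le => im i; rewrite coordinateE !mxE ltW.
move=> /le_lt_trans; apply; rewrite mulrCA gtr_pMr // ltr_pdivrMr ?ltr_wpDl //.
by rewrite mul1r ltrDl.
Qed.

Lemma nbhs_n1 (w : V) (A : set V) : nbhs w A -> exists2 e : R, 0 < e &
  forall w', n1 (w' - w) < e -> A w'.
Proof.
move=> /nbhs_mx_part[e e0 eA]; exists e => // w' ww'; apply: eA => im i j.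
rewrite (ord1 j); apply: le_lt_trans ww'.
by have := coordinate_le_n1 im i (w' - w); rewrite coordinateE !mxE.
Qed.

Definition vbox (r : R) : set V := [set w | forall i, part_box r (w i ord0)].

(** Compactness of products is applied to row vectors and transported by the transposition, which is
    continuous. *)
Lemma vbox_compact r : compact (vbox r).
Proof.
have cr := rV_compact (fun i : 'I_m => @part_box_compact R s r).
have -> : vbox r = trmx @` [set v : 'rV[F]_m | forall i, part_box r (v ord0 i)].
  apply/seteqP; split => [w wr|_ [v vr <-]] /=.
    by exists w^T; [move=> i; rewrite mxE; exact: wr|exact: trmxK].
  by move=> i; rewrite mxE; exact: vr.
apply: continuous_compact cr; apply: continuous_subspaceT => v.
apply: continuous_mxP => e e0; have := near_mx_part v e0.
by apply: filterS => v' vv' im i j; rewrite !mxE; exact: vv'.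
Qed.

Lemma vboxP r (w : V) : n1 w <= r -> vbox r w.
Proof.
move=> wr i; apply: part_boxP => im; apply: le_trans wr.
by rewrite -coordinateE; exact: coordinate_le_n1.
Qed.

End VectorTopology.

(** * Reduction to one period, and uniform bounds on compact sets *)

Section PeriodicReduction.
Context {R : realType}.

(** The shift depends on x alone, so that it can be applied simultaneously to several T-periodic
    functions. *)
Lemma period_shift (T x : R) : 0 < T -> exists2 c : R, 0 <= x - c <= T &
  forall (V : zmodType) (f : R -> V), periodic f T -> forall y, f (y + c) = f y.
Proof.
move=> T0; exists ((Num.floor (x / T))%:~R * T).
  have /andP[h1 h2] := floor_itv (x / T).
  have e : x = x / T * T by rewrite divfK // gt_eqF.
  rewrite {1 3}e -mulrBl; apply/andP; split; first by rewrite mulr_ge0 ?subr_ge0 // ltW.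
  by rewrite -[leRHS]mul1r ler_wpM2r ?ltW // ltrBlDl; move: h2; rewrite intrD.
move=> V f fT; have fn n y : f (y + n%:R * T) = f y.
  by elim: n y => [|n IH] y; rewrite ?mul0r ?addr0 // -natr1 mulrDl mul1r addrA fT IH.
move=> y; case: (Num.floor _) => n; first exact: fn.
have := fn n.+1 (y - n.+1%:R * T); rewrite subrK => ->.
by rewrite NegzE mulrNz mulNr.
Qed.

Lemma periodic_mul (V : zmodType) (f : R -> V) (T : R) n : periodic f T -> periodic f (n%:R * T).
Proof.
move=> fT; elim: n => [|n IH] y; rewrite ?mul0r ?addr0 // -natr1 mulrDl mul1r addrA fT.
exact: IH.
Qed.

End PeriodicReduction.

Section CompactBounds.
Context {R : realType} {s : scalars} {m : nat}.
Local Notation F := (scalar_field R s).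
Local Notation V := 'cV[F]_m.

Lemma mxboundD (M N : 'M[F]_m) (a b : R) : mxbound M a -> mxbound N b -> mxbound (M + N) (a + b).
Proof. by move=> Ma Nb im i j; rewrite mxE partD (le_trans (ler_normD _ _)) // lerD. Qed.

Lemma mxbound_le (M : 'M[F]_m) (a b : R) : a <= b -> mxbound M a -> mxbound M b.
Proof. by move=> ab Ma im i j; rewrite (le_trans (Ma _ _ _)). Qed.

Lemma mxbound_pinfty (M : 'M[F]_m) : \forall c \near +oo, mxbound M (c : R).
Proof.
have : \forall c \near +oo, forall ijk : bool * 'I_m * 'I_m,
    `|part ijk.1.1 (M ijk.1.2 ijk.2)| <= (c : R).
  apply: (@filter_forall R _ (fun ijk c => `|part ijk.1.1 (M ijk.1.2 ijk.2)| <= (c : R)) (+oo%R)).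
  by move=> ijk; exact: nbhs_pinfty_ge.
by apply: filterS => c Mc im i j; exact: (Mc (im, i, j)).
Qed.

Lemma near_mxbound (T : topologicalType) (f : T -> 'M[F]_m) (x : T) (e : R) :
  {for x, continuous f} -> 0 < e -> \forall y \near x, mxbound (f y - f x) e.
Proof.
move=> fc e0; have := continuous_mx_part fc e0; apply: filterS => y xy im i j.
by rewrite !mxE ltW // xy.
Qed.

Lemma near_pinfty_exists (P : R -> Prop) : (\forall c \near +oo, P (c : R)) ->
  exists2 c : R, 0 <= c & P c.
Proof.
move=> Pc; near (+oo : set_system R) => c; exists c; last by near: c.
by near: c; exact: nbhs_pinfty_ge.
Unshelve. all: by end_near. Qed.

Lemma near0_exists (P : R -> Prop) : (\forall d \near (0 : R)^'+, P d) ->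
  exists2 d : R, 0 < d & P d.
Proof.
move=> Pd; near (0 : R)^'+ => d; exists d; last by near: d.
by near: d; exact: nbhs_right_gt.
Unshelve. all: by end_near. Qed.

Lemma compact_mxbound (T : topologicalType) (K : set T) (f : T -> 'M[F]_m) :
  compact K -> continuous f -> exists2 c : R, 0 <= c & forall x, K x -> mxbound (f x) c.
Proof.
move=> /compact_near_coveringP cK fc; apply: near_pinfty_exists.
apply: cK => x Kx.
have n1x := @near_mxbound _ f x 1 (fc x) ltr01.
have nc : \forall c \near +oo, mxbound (f x) (c - 1 : R).
  have [c0 [_ H]] := mxbound_pinfty (f x).
  exists (c0 + 1); split; first exact: num_real.
  by move=> c /=; rewrite -ltrBrDr; exact: H.
exists ([set y | mxbound (f y - f x) 1], [set c | mxbound (f x) (c - 1)]) => //=.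
move=> [y c] /= [h1 h2]; have := mxboundD h1 h2.
by rewrite subrK addrC subrK.
Qed.

(** An inverse bound at x survives a small perturbation of the matrix with its constant doubled;
    compactness makes the constant uniform. *)
Lemma compact_inverse_bound (T : topologicalType) (K : set T) (f : T -> 'M[F]_m) :
  compact K -> continuous f -> (forall x, K x -> f x \in unitmx) ->
  exists2 c : R, 0 <= c & forall x, K x -> forall w : V, n1 w <= c * n1 (f x *m w).
Proof.
move=> /compact_near_coveringP cK fc fu; apply: near_pinfty_exists.
apply: cK => x Kx.
have [b b0 Hb] := near_pinfty_exists (mxbound_pinfty (invmx (f x))).
have a0' : 0 <= (2 * m)%:R * b by rewrite mulr_ge0.
have l1 (w : V) : n1 w <= (2 * m)%:R * b * n1 (f x *m w).
  by rewrite -{1}(mulKmx (fu x Kx) w); exact: n1_mulmx.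
move: ((2 * m)%:R * b) a0' l1 => a a0' l1.
(* For perturbations of this size, a times the norm of (f y - f x) w is at most half of that of w.
   The added units keep the denominator positive. *)
have e0 : 0 < (2 * ((2 * m)%:R + 1) * (a + 1))^-1 :> R.
  by rewrite invr_gt0 !mulr_gt0 // ltr_wpDl.
have n1x := @near_mxbound _ f x _ (fc x) e0.
exists ([set y | mxbound (f y - f x) (2 * ((2 * m)%:R + 1) * (a + 1))^-1], [set c | 2 * a <= c]) => /=.
  by split=> //; apply: nbhs_pinfty_ge; exact: num_real.
move=> [y c] /= [h1 h2] w.
have l2 := n1_mulmx w h1.
have l3 : n1 (f x *m w) <= n1 (f y *m w) + n1 ((f y - f x) *m w).
  rewrite -[X in n1 X <= _](_ : f y *m w - (f y - f x) *m w = _); first exact: n1B.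
  by rewrite mulmxBl subKr.
have l4 : a * ((2 * m)%:R * (2 * ((2 * m)%:R + 1) * (a + 1))^-1 * n1 w) <= 2^-1 * n1 w.
  rewrite !mulrA ler_wpM2r ?n1_ge0 // ler_pdivrMr ?mulr_gt0 // ?ltr_wpDl //.
  have -> : 2^-1 * (2 * ((2 * m)%:R + 1) * (a + 1)) = ((2 * m)%:R + 1) * (a + 1) :> R by field.
  by rewrite mulrC ler_pM // lerDl.
have l5 : a * n1 (f x *m w) <= a * n1 (f y *m w) + 2^-1 * n1 w.
  by apply: le_trans (ler_wpM2l a0' l3) _; rewrite mulrDr lerD2l (le_trans _ l4) // ler_wpM2l.
have l6 : n1 w <= 2 * a * n1 (f y *m w) by move: (l1 w) l5; lra.
by apply: le_trans l6 _; rewrite ler_wpM2r ?n1_ge0.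
Qed.

(** Only the base point has to lie in K; w may leave it. The radius r around w0 is split in two, one
    half for p.1 and one for w. *)
Lemma compact_unif_continuous (K : set (V * R)) (g : V * R -> 'M[F]_m) (e : R) :
  compact K -> continuous g -> 0 < e -> exists2 d : R, 0 < d &
  forall p, K p -> forall w, n1 (w - p.1) <= d -> mxbound (g (w, p.2) - g p) e.
Proof.
move=> /compact_near_coveringP cK gc e0; apply: near0_exists.
apply: cK => -[w0 x0] Kp.
have e20 : 0 < e / 2 by rewrite divr_gt0.
have [[A B] /= [/nbhs_n1[r r0 rA] nB] AB] := @near_mxbound _ g (w0, x0) _ (gc (w0, x0)) e20.
have r20 : 0 < r / 2 by rewrite divr_gt0.
exists ([set w | n1 (w - w0) < r / 2] `*` B, [set d | d < r / 2]) => /=.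
  split; last exact: nbhs_right_lt.
  by exists ([set w | n1 (w - w0) < r / 2], B) => //=; split => //; exact: near_n1.
move=> [[w x] d] /= [[h1 h2] h3] w' h4.
have g1 : mxbound (g (w, x) - g (w0, x0)) (e / 2).
  by apply: (AB (w, x)); split => //=; apply: rA; lra.
have g2 : mxbound (g (w', x) - g (w0, x0)) (e / 2).
  apply: (AB (w', x)); split => //=; apply: rA.
  have := n1D (w' - w) (w - w0); rewrite addrA subrK; lra.
move=> im i j; have := g1 im i j; have := g2 im i j; rewrite !mxE !partB.
by rewrite !ler_norml => /andP[? ?] /andP[? ?]; apply/andP; split; lra.
Qed.

End CompactBounds.

(** * Mean value theorem over both scalar fields *)

Section MeanValue.
Context {R : realType} {s : scalars} {m : nat}.
Local Notation F := (scalar_field R s).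
Local Notation V := 'cV[F]_m.

Lemma coordinate_continuous im i : continuous (fun w : V => coordinate im i w).
Proof.
have -> : (fun w : V => coordinate im i w) = (fun w : V => part im (w i ord0)).
  by apply/funext => w; rewrite coordinateE.
by apply: (@mx_part_continuous R s V m 1 id im i ord0) => w.
Qed.

Lemma of_real_dnbhs : of_real s r @[r --> (0 : R)^'] --> (0 : F)^'.
Proof.
move=> A [e /= e0 eA]; exists (real_part e) => /=.
  by rewrite -(of_real_lt (s := s)) of_real0 -gt0_of_real.
move=> r /=; rewrite sub0r normrN => re r0; apply: eA => /=.
  rewrite sub0r normrN (gt0_of_real e0); move: re; clear; case: s e => //= e.
  by rewrite normc_def /= expr0n /= addr0 sqrtr_sqr ltcR.
by apply: contra_neq r0; move: r {re}; clear; case: s => //= r [].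
Qed.

Lemma real_derivative (f : V -> V) (w h : V) im i : differentiable f w ->
  (r^-1 * (coordinate im i (f (w + of_real s r *: h)) - coordinate im i (f w))) @[r --> (0 : R)^']
  --> coordinate im i ('d f w h : V).
Proof.
move=> df; have /cvg_ex[l Hl] := diff_derivable (v := h) df.
have lE : l = 'd f w h :> V by rewrite -deriveE // /derive; apply/esym/cvg_lim.
rewrite -lE.
have c1 := cvg_comp _ _ of_real_dnbhs Hl.
have c2 := cvg_comp _ _ c1 (@coordinate_continuous im i l).
apply: cvg_trans c2; apply: near_eq_cvg; near=> r => /=.
have r0 : r != 0 by near: r; exact: nbhs_dnbhs_neq.
have -> : (of_real s r)^-1 = of_real s r^-1.
  have rr : of_real s r * of_real s r^-1 = 1 by rewrite -of_realM mulfV // of_real1.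
  have u : of_real s r != 0 by apply/eqP => e; move: rr; rewrite e mul0r => /eqP; rewrite eq_sym oner_eq0.
  by apply: (mulfI u); rewrite rr mulfV.
by rewrite coordinateZ coordinateB [w + _]addrC.
Unshelve. all: by end_near. Qed.

(** The real mean value theorem along a real segment. The intermediate point depends on the
    coordinate, hence later estimates use bounds valid on the whole segment. *)
Lemma mean_value_coordinate (f : V -> V) (w w' : V) im i : (forall x, differentiable f x) ->
  exists2 t : R, 0 <= t <= 1 & coordinate im i (f w - f w') =
    coordinate im i ('d f (w' + of_real s t *: (w - w')) (w - w') : V).
Proof.
move=> df; pose h := w - w'; pose y (t : R) := w' + of_real s t *: h.
pose phi (t : R) := coordinate im i (f (y t)).
have yD t r : y (r + t) = y t + of_real s r *: h.
  by rewrite /y of_realD scalerDl [_ *: h + _]addrC addrA.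
have dphi t : is_derive t (1 : R) phi (coordinate im i ('d f (y t) h : V)).
  have H : (r^-1 *: ((phi \o shift t) (r *: (1 : R)) - phi t)) @[r --> (0 : R)^'] -->
      coordinate im i ('d f (y t) h : V).
    have := real_derivative (h := h) (im := im) (i := i) (df (y t)); apply: cvg_trans.
    apply: near_eq_cvg; apply: filterE => r /=.
    by rewrite /phi /shift /= yD /GRing.scale /= mulr1.
  by apply: DeriveDef; [apply/cvg_ex; exists (coordinate im i ('d f (y t) h : V)) | exact/cvg_lim].
have cphi : {within `[(0 : R), 1], continuous phi}.
  apply: continuous_subspaceT => t; apply: differentiable_continuous; apply/derivable1_diffP.
  by apply: ex_derive.
have [t t01 e] := MVT_segment ler01 (fun t _ => dphi t) cphi.
exists t; first by move: t01; rewrite in_itv.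
rewrite -/h -/(y t) coordinateB; move: e; rewrite subr0 mulr1 => <-.
by rewrite /phi /y of_real1 of_real0 scale1r scale0r addr0 subrKC.
Qed.

Lemma jacobian_mulmx (f : V -> V) (w h : V) : differentiable f w ->
  'd f w h = (\matrix_(i, j) ('d f w (delta_mx j ord0 : V) : V) i ord0) *m h.
Proof.
move=> df; rewrite {1}(matrix_sum_delta h).
rewrite linear_sum; apply/matrixP => i j; rewrite (ord1 j) summxE mxE.
apply: eq_bigr => a _; rewrite big_ord1 linearZ /= !mxE mulrC; congr (_ * _).
Qed.

End MeanValue.

(** * Estimates for the nonlinearity, uniform in x *)

Section Nonlinearity.
Context {R : realType} {s : scalars} {m : nat}.
Local Notation F := (scalar_field R s).
Local Notation V := 'cV[F]_m.
Local Notation mu := (@lebesgue_measure R).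
Variables (nl : V -> R -> V) (T : R).
Hypothesis T_gt0 : 0 < T.
Hypothesis nl_cont : continuous (fun p : V * R => nl p.1 p.2).
Hypothesis nl_C2 : twice_C1_in_u nl.
Hypothesis nl_per : forall w, periodic (nl w) T.

Lemma nl_differentiable w x : differentiable (nl^~ x) w.
Proof. by have [h _ _ _] := nl_C2; exact: h. Qed.

Lemma du_nl_continuous : continuous (fun p : V * R => du_nl nl p.1 p.2).
Proof. by have [_ h _ _] := nl_C2. Qed.

Lemma du_nl_periodic w : periodic (du_nl nl w) T.
Proof.
move=> x; rewrite /du_nl; have -> // : nl^~ (x + T) = nl^~ x.
by apply/funext => w'; rewrite nl_per.
Qed.

Lemma state_box_compact (r : R) : compact (@vbox R s m r `*` `[0, T]%classic).
Proof. by apply: compact_setX; [exact: vbox_compact|exact: segment_compact]. Qed.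

Lemma du_nl_bounded (r : R) : exists2 c : R, 0 <= c &
  forall w x, n1 w <= r -> mxbound (du_nl nl w x) c.
Proof.
have [c c0 Hc] := compact_mxbound (@state_box_compact r) du_nl_continuous.
exists c => // w x wr; have [d dT Hd] := period_shift x T_gt0.
have := Hd _ _ (du_nl_periodic w) (x - d); rewrite subrK => ->.
by apply: (Hc (w, x - d)); split; [exact: vboxP|rewrite /= in_itv].
Qed.

Lemma du_nl_unif_continuous (r e : R) : 0 < e -> exists2 d : R, 0 < d &
  forall w w' x, n1 w <= r -> n1 (w' - w) <= d -> mxbound (du_nl nl w' x - du_nl nl w x) e.
Proof.
move=> e0; have [d d0 Hd] := compact_unif_continuous (@state_box_compact r) du_nl_continuous e0.
exists d => // w w' x wr ww'; have [c cT Hc] := period_shift x T_gt0.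
have := Hc _ _ (du_nl_periodic w) (x - c); rewrite subrK => ->.
have := Hc _ _ (du_nl_periodic w') (x - c); rewrite subrK => ->.
by apply: (Hd (w, x - c)) => //; split; [exact: vboxP|rewrite /= in_itv].
Qed.

Lemma n1_segment (w w' w0 : V) (t r : R) : 0 <= t <= 1 -> n1 (w - w0) <= r -> n1 (w' - w0) <= r ->
  n1 (w' + of_real s t *: (w - w') - w0) <= r.
Proof.
move=> /andP[t0 t1] h h'.
have -> : w' + of_real s t *: (w - w') - w0 =
    of_real s t *: (w - w0) + of_real s (1 - t) *: (w' - w0).
  apply: coordinate_inj => im i.
  by rewrite !(coordinateB, coordinateD, coordinateZ); ring.
apply: (le_trans (n1D _ _)); rewrite !n1Z !ger0_norm ?subr_ge0 //.
have := ler_wpM2l t0 h; have : (1 - t) * n1 (w' - w0) <= (1 - t) * r by rewrite ler_wpM2l ?subr_ge0.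
lra.
Qed.

Lemma nl_mean_value w w' x im i : exists2 t : R, 0 <= t <= 1 &
  coordinate im i (nl w x - nl w' x) =
  coordinate im i (du_nl nl (w' + of_real s t *: (w - w')) x *m (w - w')).
Proof.
have [t t01 e] := mean_value_coordinate w w' im i (fun y => nl_differentiable y x).
by exists t => //; rewrite e jacobian_mulmx //; exact: nl_differentiable.
Qed.

Lemma nl_lipschitz (r : R) : exists2 L : R, 0 <= L &
  forall w w' x, n1 w <= r -> n1 w' <= r -> n1 (nl w x - nl w' x) <= L * n1 (w - w').
Proof.
have [c c0 Hc] := du_nl_bounded r.
exists ((2 * m)%:R * ((2 * m)%:R * c)) => [|w w' x wr w'r]; first by rewrite !mulr_ge0.
rewrite -mulrA; apply: n1_le => im i; have [t t01 ->] := nl_mean_value w w' x im i.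
apply: (le_trans (coordinate_le_n1 _ _ _)); apply: n1_mulmx; apply: Hc.
by have := @n1_segment w w' 0 t r t01; rewrite !subr0; apply.
Qed.

(** A contraction compares two states near w0 with each other, hence strict differentiability, with
    d uniform over bounded w0 and over all x. *)
Lemma nl_strictly_differentiable (r e : R) : 0 < e -> exists2 d : R, 0 < d &
  forall w0 w w' x, n1 w0 <= r -> n1 (w - w0) <= d -> n1 (w' - w0) <= d ->
    n1 (nl w x - nl w' x - du_nl nl w0 x *m (w - w')) <= e * n1 (w - w').
Proof.
(* One factor 2m comes from summing the coordinates and one from the matrix product. *)
move=> e0; pose e' := e / ((2 * m)%:R ^+ 2 + 1).
have e'0 : 0 < e' by rewrite divr_gt0 // ltr_wpDl ?sqr_ge0.
have [d d0 Hd] := du_nl_unif_continuous r e'0.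
have e'e : (2 * m)%:R ^+ 2 * e' <= e.
  rewrite /e' mulrA ler_pdivrMr ?ltr_wpDl ?sqr_ge0 //.
  by rewrite mulrC ler_pM2l // lerDl.
clearbody e'; exists d => // w0 w w' x w0r wd w'd.
have le1 : n1 (nl w x - nl w' x - du_nl nl w0 x *m (w - w')) <=
    (2 * m)%:R * ((2 * m)%:R * e' * n1 (w - w')).
  apply: n1_le => im i; have [t t01 E] := nl_mean_value w w' x im i.
  rewrite coordinateB E -coordinateB -mulmxBl.
  apply: (le_trans (coordinate_le_n1 _ _ _)); apply: n1_mulmx; apply: Hd => //.
  exact: n1_segment.
by apply: le_trans le1 _; rewrite !mulrA ler_wpM2r ?n1_ge0.
Qed.

Lemma graph_continuous (u : R -> V) : continuous u -> continuous (fun x => (u x, x)).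
Proof.
by move=> uc x; apply: (@cvg_pair _ _ _ (nbhs x) (nbhs (u x)) (nbhs x)) => //; exact: uc.
Qed.

Lemma nl_vcont (u : R -> V) : vcont u -> vcont (fun x => nl (u x) x).
Proof.
move=> /vcont_continuous uc; apply: continuous_vcont => x.
exact: (continuous_comp (@graph_continuous u uc x) (@nl_cont (u x, x))).
Qed.

Lemma continuous_mmeas (M : R -> 'M[F]_m) : continuous M -> mmeas M.
Proof.
by move=> Mc im i j; apply: continuous_measurable_fun; exact: mx_part_continuous.
Qed.

End Nonlinearity.

(** * Uniform bounds for the periodic coefficients *)

Section Coefficients.
Context {R : realType} {s : scalars} {m : nat}.
Local Notation F := (scalar_field R s).
Local Notation V := 'cV[F]_m.

Lemma periodic_mxbound (al : R -> 'M[F]_m) (T : R) : 0 < T -> continuous al -> periodic al T ->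
  exists2 c : R, 0 <= c & forall x, mxbound (al x) c.
Proof.
move=> T0 ac aT; have [c c0 Hc] := compact_mxbound (@segment_compact R 0 T) ac.
exists c => // x; have [d dT Hd] := period_shift x T0.
by have := Hd _ _ aT (x - d); rewrite subrK => ->; apply: Hc; rewrite /= in_itv.
Qed.

Lemma periodic_mxbound_all (al : nat -> R -> 'M[F]_m) (T : R) k : 0 < T ->
  (forall j, (1 <= j <= k)%N -> continuous (al j)) ->
  (forall j, (1 <= j <= k)%N -> periodic (al j) T) ->
  exists2 c : R, 0 <= c & forall j x, (1 <= j <= k)%N -> mxbound (al j x) c.
Proof.
move=> T0 ac aT; elim: k ac aT => [|k IH] ac aT.
  by exists 0 => // -[|j] x.
have kW j : (1 <= j <= k)%N -> (1 <= j <= k.+1)%N.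
  by move=> /andP[-> jk]; exact: leqW.
have [c c0 Hc] := IH (fun j jk => ac j (kW j jk)) (fun j jk => aT j (kW j jk)).
have k1 : (1 <= k.+1 <= k.+1)%N by rewrite leqnn.
have [d d0 Hd] := periodic_mxbound T0 (ac k.+1 k1) (aT k.+1 k1).
exists (c + d) => [|j x]; first exact: addr_ge0.
rewrite [(j <= k.+1)%N]leq_eqVlt => /andP[j1 /orP[/eqP ->|jk]].
  by apply: mxbound_le (Hd x); rewrite lerDr.
by apply: mxbound_le (Hc j x _); rewrite ?lerDl // j1.
Qed.

Lemma periodic_inverse_bound (al : R -> 'M[F]_m) (T : R) : 0 < T -> continuous al -> periodic al T ->
  (forall x, al x \in unitmx) ->
  exists2 c : R, 0 <= c & forall x (w : V), n1 w <= c * n1 (al x *m w).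
Proof.
move=> T0 ac aT au.
have [c c0 Hc] := compact_inverse_bound (@segment_compact R 0 T) ac (fun x _ => au x).
exists c => // x; have [d dT Hd] := period_shift x T0.
by have := Hd _ _ aT (x - d); rewrite subrK => ->; apply: Hc; rewrite /= in_itv.
Qed.

End Coefficients.

(** * A contraction principle in L^2 *)

Section L2Contraction.
Context {R : realType} {s : scalars} {m : nat}.
Local Notation F := (scalar_field R s).
Local Notation V := 'cV[F]_m.
Local Notation mu := (@lebesgue_measure R).
Implicit Types (f g : R -> V).

Lemma nsqN (w : V) : nsq (- w) = nsq w.
Proof. by apply: eq_bigr => i _; apply: eq_bigr => im _; rewrite coordinateN sqrrN. Qed.

Lemma nsqD_le (w w' : V) : nsq (w + w') <= 2 * nsq w + 2 * nsq w'.
Proof.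
rewrite /nsq !mulr_sumr -big_split; apply: ler_sum => i _.
rewrite !mulr_sumr -big_split; apply: ler_sum => im _; rewrite coordinateD /=.
move: (coordinate im i w) (coordinate im i w') => a b.
by have := sqr_ge0 (a - b); rewrite sqrrB sqrrD; lra.
Qed.

Lemma energyD_le D f g : measurable D -> vmeas f -> vmeas g ->
  (energy D (fun x => (f x + g x)%R) <= 2%:E * energy D f + 2%:E * energy D g)%E.
Proof.
move=> mD fm gm; pose t (b : bool) := if b then f else g.
have tm b : vmeas (t b) by case: b.
have := @energy_le_nsq R s m bool [:: true; false] D _ t 2 mD (ler0n R 2) (vmeasD fm gm) tm.
rewrite big_cons big_seq1 /= ge0_muleDr ?energy_ge0 //; apply.
apply/aeW => x _; rewrite big_cons big_seq1 /= mulrDr; exact: nsqD_le.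
Qed.

Lemma energyN D f : energy D (fun x => - f x) = energy D f.
Proof. by apply: eq_integral => x _; rewrite nsqN. Qed.

Lemma energyB_le D f g : measurable D -> vmeas f -> vmeas g ->
  (energy D (fun x => (f x - g x)%R) <= 2%:E * energy D f + 2%:E * energy D g)%E.
Proof.
by move=> mD fm gm; rewrite -(energyN D g); apply: energyD_le => //; exact: vmeasN.
Qed.

Lemma nsq_eq0 (w : V) : nsq w = 0 -> w = 0.
Proof.
move=> w0; apply: n1_eq0; apply/eqP.
have := n1_le_nsq w; rewrite w0 mulr0 => h.
by rewrite -sqrf_eq0 eq_le h sqr_ge0.
Qed.

Lemma energy_eq0 f : vmeas f -> energy setT f = 0%E -> {ae mu, forall x, f x = 0}.
Proof.
move=> fm e0.
have H : (\int[mu]_x `|(nsq (f x))%:E| = 0)%E.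
  by rewrite -[RHS]e0; apply: eq_integral => x _; rewrite gee0_abs // lee_fin nsq_ge0.
have := (ae_eq_integral_abs mu measurableT (vmeas_nsq fm)).1 H.
by apply: ae_imp => x /(_ I)[/nsq_eq0].
Qed.

Lemma energy_lty_ae0 (u : R -> \bar R) : measurable_fun setT u -> (forall x, 0 <= u x)%E ->
  (\int[mu]_x u x < +oo)%E -> {ae mu, forall x, (u x < +oo)%E}.
Proof.
move=> um u0 ui.
have : mu.-integrable setT u.
  apply/integrableP; split => //.
  by under eq_integral => x _ do rewrite gee0_abs //.
move=> /integrable_ae => /(_ measurableT); apply: ae_imp => x /(_ I).
by rewrite ge0_fin_numE.
Qed.

Lemma geometric_increments_cvg (c : nat -> R) (K : R) : c 0%N = 0 -> 0 <= K ->
  (forall n, `|c n.+1 - c n| <= K * 2^-1 ^+ n) -> cvgn c.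
Proof.
move=> c0 K0 cK.
have : cvgn [normed series (fun n => c n.+1 - c n)].
  apply: (@series_le_cvg _ _ (geometric K 2^-1)) => [n|n|n|] //=.
  - by rewrite /geometric /= mulr_ge0 // exprn_ge0.
  - by apply: is_cvg_geometric_series; rewrite ger0_norm // invf_lt1 // ltr1n.
move=> /normed_cvg; have -> // : series (fun n => c n.+1 - c n) = c.
by apply/funext => n; rewrite /series /= telescope_sumr // c0 subr0.
Qed.

(* A coordinatewise upper limit: total, measurable, and equal to the limit where it exists. *)
Definition vlim (b : nat -> R -> V) x : V :=
  mkvec (fun im i => fine (limn_esup (fun n => (coordinate im i (b n x))%:E))).

Lemma vlim_vmeas (b : nat -> R -> V) : (forall n, vmeas (b n)) -> vmeas (vlim b).
Proof.
move=> bm im i.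
have H im' : measurable_fun setT (fun x => fine (limn_esup (fun n => (coordinate im' i (b n x))%:E))).
  apply: (measurableT_comp (@fine_measurable R setT measurableT)).
  by apply: measurable_fun_limn_esup => n; apply/measurable_EFinP; exact: bm.
have -> : (fun x => coordinate im i (vlim b x)) =
  fun x => if s is RealScalars then (if im then 0 else
    fine (limn_esup (fun n => (coordinate im i (b n x))%:E)))
  else fine (limn_esup (fun n => (coordinate im i (b n x))%:E)).
  by apply/funext => x; rewrite coordinate_mkvec.
case: s b bm H => [|] b bm H; last exact: H.
by case: im => //; exact: H.
Qed.

Lemma vlim_cvg (b : nat -> R -> V) x im i : cvgn (fun n => coordinate im i (b n x)) ->
  coordinate im i (b n x) @[n --> \oo] --> coordinate im i (vlim b x).
Proof.
move=> /cvg_ex[l Hl].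
have E : fine (limn_esup (fun n => (coordinate im i (b n x))%:E)) = l.
  have Hl' : (coordinate im i (b n x))%:E @[n --> \oo] --> l%:E.
    by apply/fine_cvgP; split; [exact: nearW|exact: Hl].
  by rewrite (cvg_limn_einf_sup Hl').2.
have -> // : coordinate im i (vlim b x) = l.
rewrite /vlim coordinate_mkvec -[RHS]E.
case: im Hl E => Hl E; last by case: s b Hl E.
rewrite E; case: s b Hl E => b Hl E //.
have zero : (fun n => coordinate true i (b n x)) = fun=> 0.
  by apply/funext => n.
by move: Hl; rewrite zero => Hl; apply/esym; apply: cvg_unique Hl (cvg_cst _).
Qed.

Lemma nsq_cvg (b : nat -> V) (w : V) :
  (forall im i, coordinate im i (b n) @[n --> \oo] --> coordinate im i w) ->
  nsq (b n) @[n --> \oo] --> nsq w.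
Proof.
move=> bw; rewrite /nsq; apply: cvg_big => [|i _]; first exact: add_continuous.
apply: cvg_big => [|im _]; first exact: add_continuous.
by rewrite expr2; under eq_fun do rewrite expr2; exact: cvgM.
Qed.

Variables (rho : R) (Phi : (R -> V) -> R -> V).
Hypothesis rho0 : 0 <= rho.
(** In terms of norms the radius is twice the bound for Phi 0. The ball contains the iterates
    because 2 (4 rho) / 16 + 2 rho <= 4 rho, the factors 2 coming from the squared triangle
    inequality. *)
Definition l2_ball f := vmeas f /\ (energy setT f <= (4 * rho)%:E)%E.
Hypothesis Phi_vmeas : forall f, l2_ball f -> vmeas (Phi f).
Hypothesis Phi_zero : (energy setT (Phi (fun=> 0%R)) <= rho%:E)%E.
(* The factor 1/16 leaves room for the weights 4^n in [picard_ae_cvg]. *)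
Hypothesis Phi_contract : forall f g, l2_ball f -> l2_ball g ->
  (energy setT (fun x => (Phi f x - Phi g x)%R) <= 16^-1%:E * energy setT (fun x => (f x - g x)%R))%E.

Definition picard n : R -> V := iter n Phi (fun=> 0).

Lemma energy0 D : energy D (fun _ : R => (0 : V)) = 0%E.
Proof.
rewrite /energy -[RHS](integral0 mu D); apply: eq_integral => x _; rewrite /nsq big1 // => i _.
by rewrite big1 // => im _; rewrite coordinate0 expr0n.
Qed.

Lemma zero_ball : l2_ball (fun=> 0).
Proof. by split; [exact: vmeas0|rewrite energy0 lee_fin mulr_ge0]. Qed.

Lemma picard_ball n : l2_ball (picard n).
Proof.
elim: n => [|n [bm be]]; first exact: zero_ball.
have fm := Phi_vmeas (conj bm be); split => //.
have zm := Phi_vmeas zero_ball.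
have -> : energy setT (picard n.+1) =
    energy setT (fun x => (Phi (picard n) x - Phi (fun=> 0) x) + Phi (fun=> 0) x).
  by apply: eq_integral => x _; rewrite subrK.
apply: le_trans (energyD_le measurableT (vmeasB fm zm) zm) _.
have h := Phi_contract (conj bm be) zero_ball.
have h2 : (energy setT (fun x => (picard n x - 0)%R) <= (4 * rho)%:E)%E.
  by under eq_fun do rewrite subr0.
have h3 := le_trans h (lee_wpmul2l _ h2); rewrite -EFinM lee_fin invr_ge0 in h3.
apply: (le_trans (leeD (lee_wpmul2l _ (h3 _)) (lee_wpmul2l _ Phi_zero))); rewrite ?lee_fin //.
by move: rho0; lra.
Qed.

(** The two iterates are the i-th images of [picard n] and of 0, so the contraction is applied i
    times and no series of norms has to be summed. *)
Lemma picard_cauchy i n : (energy setT (fun x => (picard (n + i) x - picard i x)%R) <=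
  (16^-1 ^+ i * (4 * rho))%:E)%E.
Proof.
elim: i => [|i IH].
  rewrite addn0 expr0 mul1r; under eq_fun do rewrite /= subr0.
  exact: (picard_ball n).2.
rewrite addnS; apply: (le_trans (Phi_contract (picard_ball _) (picard_ball _))).
by rewrite exprS -mulrA EFinM lee_wpmul2l // lee_fin invr_ge0.
Qed.

(* The increments have energy at most 16^-n, so that the sum of 4^n |increment|^2 is integrable,
   hence almost everywhere finite, which forces geometric convergence at almost every point. *)
Lemma picard_ae_cvg : {ae mu, forall x, forall im i, cvgn (fun n => coordinate im i (picard n x))}.
Proof.
pose u n x := ((4 ^+ n)%:E * (nsq (picard n.+1 x - picard n x))%:E)%E.
have um n : measurable_fun setT (u n).
  by apply: measurable_funeM; apply: vmeas_nsq; apply: vmeasB; exact: (picard_ball _).1.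
have u0 n x : (0 <= u n x)%E.
  by rewrite mule_ge0 // lee_fin ?exprn_ge0 // nsq_ge0.
(* The decay 4^-n is relaxed to 2^-n, in the form that [epsilon_trick0] sums. *)
have ui n : (\int[mu]_x u n x <= (8 * rho / (2 ^ n.+1)%:R)%:E)%E.
  rewrite ge0_integralZl //; first last.
  - by move=> x _; rewrite lee_fin nsq_ge0.
  - by apply: vmeas_nsq; apply: vmeasB; exact: (picard_ball _).1.
  have := picard_cauchy n 1; rewrite add1n => h.
  apply: (le_trans (lee_wpmul2l _ h)); first by rewrite lee_fin exprn_ge0.
  rewrite -EFinM lee_fin.
  have -> : 4 ^+ n * (16^-1 ^+ n * (4 * rho)) = (4^-1 ^+ n) * (4 * rho).
    by rewrite mulrA -exprMn; congr (_ ^+ _ * _); lra.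
  have -> : 8 * rho / (2 ^ n.+1)%:R = 2^-1 ^+ n * (4 * rho).
    by rewrite natrX exprS invfM exprVn; field; rewrite expf_neq0.
  by rewrite ler_wpM2r ?mulr_ge0 // lerXn2r ?nnegrE ?invr_ge0 //; lra.
have sm : measurable_fun setT (fun x => \sum_(0 <= n <oo) u n x)%E.
  by apply: ge0_emeasurable_sum => // n x _ _; exact: u0.
have si : (\int[mu]_x (\sum_(0 <= n <oo) u n x) < +oo)%E.
  rewrite integral_nneseries //.
  apply: (@le_lt_trans _ _ (8 * rho)%:E); last exact: ltry.
  apply: le_trans (epsilon_trick0 xpredT _); last by rewrite mulr_ge0.
  apply: lee_nneseries => n _; last exact: ui.
  by move=> _; apply: integral_ge0 => x _; exact: u0.
have s0 x : (0 <= \sum_(0 <= n <oo) u n x)%E by apply: nneseries_ge0 => n _ _; exact: u0.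
have := energy_lty_ae0 sm s0 si; apply: ae_imp => x sx im i.
have [K [K0 HK]] : exists K : R, 0 <= K /\ (\sum_(0 <= n <oo) u n x)%E = K%:E.
  exists (fine (\sum_(0 <= n <oo) u n x)%E); rewrite fine_ge0 // fineK //.
  by rewrite ge0_fin_numE.
(* A coordinate of the increment is at most sqrt K times 2^-n, and K + 1 bounds sqrt K without a
   root. *)
apply: (@geometric_increments_cvg _ (K + 1)); first by rewrite /picard /= coordinate0.
  by rewrite addr_ge0.
move=> n.
have le1 : 4 ^+ n * nsq (picard n.+1 x - picard n x) <= K.
  rewrite -lee_fin -HK EFinM -[X in (X <= _)%E]/(u n x).
  apply: le_trans (nneseries_lim_ge n.+1 _); last by move=> j _ _; exact: u0.
  by rewrite big_nat_recr //= leeDr // sume_ge0.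
rewrite -coordinateB.
have le2 := coordinate_le_nsq im i (picard n.+1 x - picard n x).
rewrite -(ler_pXn2r (n := 2)) ?nnegrE ?mulr_ge0 ?exprn_ge0 ?addr_ge0 // ?invr_ge0 //.
rewrite real_normK ?num_real // exprMn -exprM mulnC exprM.
have -> : 2^-1 ^+ 2 = 4^-1 :> R by rewrite expr2; lra.
apply: (le_trans le2).
have p4 : 0 < 4 ^+ n :> R by rewrite exprn_gt0.
rewrite exprVn ler_pdivlMr // mulrC; apply: (le_trans le1).
by rewrite sqrrD1 -[leLHS]addr0; have := sqr_ge0 K; move: K0; lra.
Qed.

(** Fatou's lemma, applied to [picard_cauchy] as n grows, transfers the bound to the almost
    everywhere limit. *)
Lemma picard_limit i : (energy setT (fun x => (vlim picard x - picard i x)%R) <=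
  (16^-1 ^+ i * (4 * rho))%:E)%E.
Proof.
have pm n : vmeas (picard n) := (picard_ball n).1.
pose u n x := (nsq (picard (n + i) x - picard i x))%:E.
have um n : measurable_fun setT (u n) by apply: vmeas_nsq; exact: vmeasB.
have u0 n x : (0 <= u n x)%E by rewrite lee_fin nsq_ge0.
have lm : measurable_fun setT (fun x => limn_einf (u^~ x)).
  have -> : (fun x => limn_einf (u^~ x)) = (fun x => - limn_esup (fun n => - u n x))%E.
    by apply/funext => x; rewrite -[limn_einf _]oppeK -limn_esupN.
  apply: measurableT_comp => //; apply: measurable_fun_limn_esup => n.
  exact: measurableT_comp.
have -> : energy setT (fun x => (vlim picard x - picard i x)%R) =
    (\int[mu]_x limn_einf (u^~ x))%E.
  apply: ge0_ae_eq_integral => //.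
  - by apply: vmeas_nsq; apply: vmeasB => //; exact: vlim_vmeas.
  - by move=> x _; rewrite lee_fin nsq_ge0.
  - move=> x _; rewrite limn_einf_lim; apply: lime_ge; first exact: is_cvg_einfs.
    by apply: nearW => n; apply: le_ereal_inf_tmp => _ [j _ <-]; exact: u0.
  have := picard_ae_cvg; apply: ae_imp => x cx _.
  have H : nsq (picard (n + i) x - picard i x) @[n --> \oo] --> nsq (vlim picard x - picard i x).
    apply: nsq_cvg => im j; rewrite coordinateB; under eq_fun do rewrite coordinateB.
    apply: cvgB; last exact: cvg_cst.
    have := vlim_cvg (cx im j).
    by rewrite -(cvg_shiftn i).
  have H' : u n x @[n --> \oo] --> (nsq (vlim picard x - picard i x))%:E.
    by apply/fine_cvgP; split; [exact: nearW|exact: H].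
  by rewrite (cvg_limn_einf_sup H').1.
apply: (le_trans (fatou mu measurableT um (fun n x _ => u0 n x))).
rewrite limn_einf_lim; apply: lime_le; first exact: is_cvg_einfs.
apply: nearW => n; apply: (le_trans _ (picard_cauchy i n)).
by apply: ereal_inf_lbound; exists n => /=.
Qed.

(** The limit and its image are both within a geometrically small energy of [picard i.+1], for every
    i. *)
Lemma l2_contraction_fixpoint : exists2 f, l2_ball f & {ae mu, forall x, f x = Phi f x}.
Proof.
have pm n : vmeas (picard n) := (picard_ball n).1.
have fm : vmeas (vlim picard) by exact: vlim_vmeas.
have fb : l2_ball (vlim picard).
  split => //; have := picard_limit 0; rewrite expr0 mul1r.
  by under eq_fun do rewrite subr0.
exists (vlim picard) => //.
have Pm := Phi_vmeas fb.
have le1 i : (energy setT (fun x => (vlim picard x - Phi (vlim picard) x)%R) <=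
    (16^-1 ^+ i * (16 * rho))%:E)%E.
  have -> : energy setT (fun x => (vlim picard x - Phi (vlim picard) x)%R) =
      energy setT (fun x => (vlim picard x - picard i.+1 x) - (Phi (vlim picard) x - Phi (picard i) x)).
    by apply: eq_integral => x _; rewrite opprB addrA subrK.
  apply: (le_trans (energyB_le measurableT (vmeasB fm (pm _)) (vmeasB Pm (pm i.+1)))).
  have h1 := picard_limit i.+1.
  have h2 := le_trans (Phi_contract fb (picard_ball i)) (lee_wpmul2l _ (picard_limit i)).
  apply: (le_trans (leeD (lee_wpmul2l _ h1) (lee_wpmul2l _ (h2 _)))); rewrite ?lee_fin ?invr_ge0 //.
  rewrite exprS; have p : 0 <= 16^-1 ^+ i * rho by rewrite mulr_ge0 // exprn_ge0 // invr_ge0.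
  by move: p; lra.
have e0 : energy setT (fun x => (vlim picard x - Phi (vlim picard) x)%R) = 0%E.
  apply/eqP; rewrite eq_le energy_ge0 andbT.
  have c0 : (fun i => (16^-1 ^+ i * (16 * rho))%:E) @ \oo --> (0 : \bar R)%E.
    apply/fine_cvgP; split; first exact: nearW.
    rewrite -[X in _ --> X](mul0r (16 * rho)); apply: cvgMl.
    by apply: cvg_expr; rewrite ger0_norm ?invr_ge0 // invf_lt1 // ltr1n.
  rewrite -(cvg_lim _ c0) //; apply: lime_ge; first by apply/cvg_ex; exists 0%E.
  exact: nearW.
have := energy_eq0 (vmeasB fm Pm) e0; apply: ae_imp => x /eqP.
by rewrite subr_eq0 => /eqP.
Qed.

End L2Contraction.

(** * The approximate inverse on the circle *)

Section ApproximateInverse.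
Context {R : realType} {s : scalars} {m : nat}.
Local Notation F := (scalar_field R s).
Local Notation V := 'cV[F]_m.
Local Notation mu := (@lebesgue_measure R).
Implicit Types (f g b : R -> V) (W J : nat -> R -> V).

Lemma vprimB (f f' g g' : R -> V) : vlocint f' -> vlocint g' -> vprim f f' -> vprim g g' ->
  vprim (fun x => f x - g x) (fun x => f' x - g' x).
Proof.
move=> lf lg ff gg im i x y xy.
rewrite !coordinateB; under eq_Rintegral do rewrite coordinateB.
rewrite RintegralB //; [|exact: locint_itv|exact: locint_itv].
by rewrite -(ff im i x y xy) -(gg im i x y xy); ring.
Qed.

Lemma leib_zero j eta (x : R) : leib j eta (fun _ _ => 0 : V) x = 0.
Proof.
elim: j eta => [|j IH] eta /=; first by rewrite scaler0.
by rewrite !IH addr0.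
Qed.

Lemma vmeas_sum_nat (a n : nat) (f : nat -> R -> V) : (forall i, (a <= i < n)%N -> vmeas (f i)) ->
  vmeas (fun x => \sum_(a <= i < n) f i x).
Proof.
move=> fm; have := @vmeas_sum R s m nat (index_iota a n)
  (fun i => if (a <= i < n)%N then f i else (fun=> 0)).
have -> : (fun x => \sum_(i <- index_iota a n) (if (a <= i < n)%N then f i else fun=> 0) x) =
   fun x => \sum_(a <= i < n) f i x.
  by apply/funext => x; apply: eq_big_nat => i ->.
by apply=> i; case: ifPn => [/fm|_] //; exact: vmeas0.
Qed.

Lemma vcontD f g : vcont f -> vcont g -> vcont (fun x => f x + g x).
Proof.
move=> fc gc im i x; under eq_fun do rewrite coordinateD.
by apply: cvgD; [exact: fc|exact: gc].
Qed.

Lemma vcont_addr (c : R) f : vcont f -> vcont (fun x => f (x + c)).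
Proof.
move=> fc im i x; apply: (@continuous_comp _ _ _ (fun x : R => x + c) (fun y => coordinate im i (f y))).
  by apply: cvgD; [exact: cvg_id|exact: cvg_cst].
exact: fc.
Qed.

Lemma vcont_sum (I : Type) (r : seq I) (f : I -> R -> V) : (forall i, vcont (f i)) ->
  vcont (fun x => \sum_(i <- r) f i x).
Proof.
move=> fc; elim: r => [|a r IH].
  by under eq_fun do rewrite big_nil; move=> im i x; exact: cvg_cst.
by under eq_fun do rewrite big_cons; exact: vcontD.
Qed.

Lemma vcontZ (h : R -> R) f : continuous h -> vcont f -> vcont (fun x => of_real s (h x) *: f x).
Proof.
move=> hc fc im i x; under eq_fun do rewrite coordinateZ.
by apply: cvgM; [exact: hc|exact: fc].
Qed.

Lemma n1_sqr_le (w : V) (a c : R) : 0 <= c -> nsq w <= a -> @n1c R m * a <= c ^+ 2 -> n1 w <= c.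
Proof.
move=> c0 wa ac; rewrite -(ler_pXn2r (n := 2)) ?nnegrE ?n1_ge0 //.
apply: le_trans (n1_le_nsq w) (le_trans _ ac).
by rewrite ler_wpM2l ?n1c_ge0.
Qed.

Lemma energy01_le (k : nat) (D : set R) (J : nat -> R -> V) : (0 < k)%N ->
  (energy D (J 0%N) + energy D (J 1%N) <= \sum_(i < k.+1) energy D (J i))%E.
Proof.
move=> k0.
have -> : (\sum_(i < k.+1) energy D (J i) = energy D (J 0%N) + energy D (J 1%N) +
    \sum_(i < k.-1) energy D (J i.+2))%E.
  by rewrite -[in LHS](prednK k0) big_ord_recl big_ord_recl /= addeA.
by rewrite leeDl // sume_ge0 // => i _; exact: energy_ge0.
Qed.

Variables (k : nat) (alpha : nat -> R -> 'M[F]_m) (Bm : R -> 'M[F]_m) (nn : V -> R -> V).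
Variables (Z : nat -> R -> V) (ca : R).
Hypothesis k_gt0 : (0 < k)%N.
Hypothesis ca_ge0 : 0 <= ca.
Hypothesis alpha_le : forall j x, (1 <= j <= k)%N -> mxbound (alpha j x) ca.

Definition jet_op J x : V := \sum_(1 <= j < k.+1) alpha j x *m J j x.

(* [W] is the jet of a solution of the linearized equation on the whole line. *)
Definition solves W f := [/\ forall i, (i <= k)%N -> vlocint (W i) /\ (energy setT (W i) < +oo)%E,
  vchain k W, vprim (W 0%N) (W 1%N) &
  {ae mu, forall x, jet_op W x + Bm x *m W 0%N x = f x}].

Definition commutator (eta : R -> R) J x : V :=
  \sum_(1 <= j < k.+1) alpha j x *m (leib j eta J x - of_real s (eta x) *: J j x).

Definition jet_sum J x : R := \sum_(i < k.+1) n1 (J i x).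

Lemma jet_sum_ge0 J x : 0 <= jet_sum J x.
Proof. by apply: sumr_ge0 => i _; exact: n1_ge0. Qed.

Lemma n1_le_jet_sum J x i : (i <= k)%N -> n1 (J i x) <= jet_sum J x.
Proof.
move=> ik; rewrite /jet_sum (bigD1 (Ordinal (ik : (i < k.+1)%N))) //= lerDl.
by apply: sumr_ge0 => j _; exact: n1_ge0.
Qed.

Lemma partial_jet_sum_le J x j : (j <= k)%N -> \sum_(i < j.+1) n1 (J i x) <= jet_sum J x.
Proof.
move=> jk; rewrite /jet_sum -!(big_mkord xpredT (fun i => n1 (J i x))).
rewrite (@big_cat_nat _ _ _ j.+1 0 k.+1) //= lerDl.
by apply: sumr_ge0 => i _; exact: n1_ge0.
Qed.

(** There are k coefficient matrices, each costing 2m ca, and 2^k is the Leibniz constant. *)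
Definition jetc : R := k%:R * ((2 * m)%:R * ca * 2 ^+ k).

Lemma jetc_ge0 : 0 <= jetc.
Proof. by rewrite !mulr_ge0 // exprn_ge0. Qed.

Lemma n1_jet_op_le J (t : nat -> V) x (e : R) : 0 <= e ->
  (forall j, (1 <= j <= k)%N -> n1 (t j) <= e * 2 ^+ j * \sum_(i < j.+1) n1 (J i x)) ->
  n1 (\sum_(1 <= j < k.+1) alpha j x *m t j) <= jetc * e * jet_sum J x.
Proof.
move=> e0 H; apply: (le_trans (n1_sum _ _ _)).
have -> : jetc * e * jet_sum J x =
    \sum_(1 <= j < k.+1) ((2 * m)%:R * ca * (e * 2 ^+ k * jet_sum J x)).
  rewrite sumr_const_nat subn1 /= -mulr_natl /jetc; ring.
rewrite big_nat [leRHS]big_nat; apply: ler_sum => j; rewrite ltnS => jk.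
apply: (le_trans (n1_mulmx _ (alpha_le x jk))).
apply: ler_wpM2l; first by rewrite mulr_ge0.
apply: (le_trans (H j jk)); apply: ler_pM.
- by rewrite mulr_ge0 // exprn_ge0.
- by apply: sumr_ge0 => i _; exact: n1_ge0.
- by apply: ler_wpM2l => //; apply: ler_weXn2l; [rewrite ler1n|case/andP: jk].
- by apply: partial_jet_sum_le; case/andP: jk.
Qed.

Lemma jet_op_leib eta J x :
  jet_op (fun j => leib j eta J) x = of_real s (eta x) *: jet_op J x + commutator eta J x.
Proof.
rewrite /jet_op /commutator scaler_sumr -big_split /=; apply: eq_bigr => j _.
by rewrite mulmxBr -scalemxAr subrKC.
Qed.

Lemma commutator_le eta J x (e : R) : 0 <= e ->
  (forall i, (0 < i <= k)%N -> `|derive1n i eta x| <= e) ->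
  n1 (commutator eta J x) <= jetc * e * jet_sum J x.
Proof.
move=> e0 etae; apply: n1_jet_op_le => // j /andP[_ jk]; apply: leib_commutator => // i /andP[i0 ij].
by apply: etae; rewrite i0 (leq_trans ij).
Qed.

(** This stands in for linearity of the solution operator, which is only a choice of one solution
    for each source. *)
Lemma solvesB W W' f f' : solves W f -> solves W' f' ->
  solves (fun i x => W i x - W' i x) (fun x => f x - f' x).
Proof.
move=> [We Wc Wp Wf] [We' Wc' Wp' Wf']; split.
- move=> i ik; have [l e] := We i ik; have [l' e'] := We' i ik; split.
    move=> im j; have := locintD (l im j) (locintZ (-1) (l' im j)).
    by congr (locally_integrable _ _); apply/funext => x; rewrite coordinateB mulN1r.
  apply: (le_lt_trans (energyB_le measurableT (vlocint_vmeas l) (vlocint_vmeas l'))).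
  by rewrite lte_add_pinfty // lte_mul_pinfty // ge0_fin_numE.
- by move=> j jk; apply: vderB; [exact: Wc|exact: Wc'].
- by apply: vprimB => //; [exact: (We 1%N k_gt0).1|exact: (We' 1%N k_gt0).1].
- apply: ae_imp2 Wf Wf' => x <- <-; rewrite /jet_op mulmxBr.
  under eq_bigr do rewrite mulmxBr.
  by rewrite sumrB opprD !addrA; congr (_ - _); rewrite -!addrA; congr (_ + _); rewrite addrC.
Qed.

Lemma solves0 : solves (fun _ _ => 0) (fun=> 0).
Proof.
have l0 : @vlocint R s m (fun=> 0).
  move=> im i; have := @locint_cst R 0.
  by congr (locally_integrable _ _); apply/funext => x; rewrite coordinate0.
split.
- by move=> i _; split => //; rewrite energy0.
- move=> j _ im i; have := @wder0 R 1.
  rewrite (_ : (fun _ : R => 0 : R) = (fun x : R => coordinate im i (0 : V))) //.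
  by apply/funext => x; rewrite coordinate0.
- move=> im i x y xy; under eq_Rintegral do rewrite coordinate0.
  by rewrite !coordinate0 subrr Rintegral_cst_itv // mul0r.
- by apply/aeW => x; rewrite /jet_op big1 ?mulmx0 ?addr0 // => j _; rewrite mulmx0.
Qed.

(** * The contraction at one fixed period *)

Section AtPeriod.
(** The parameters e and eps measure the two errors, commutator and linearization; delta is the
    radius where the linearization is accurate, sigma bounds the corrections uniformly and zs bounds
    Z away from 0. Three translates meet the cell, whence the three sigma in [small]. *)
Variables (p : R) (chi eta : R -> R) (e delta sigma zs eps : R).
Hypothesis p_gt0 : 0 < p.
Hypothesis alpha_p : forall j, (1 <= j <= k)%N -> periodic (alpha j) p.
Hypothesis nn_p : forall w, periodic (nn w) p.
Hypothesis eta_smooth : smooth eta.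
Hypothesis e_ge0 : 0 <= e.
Hypothesis eta_small : forall i x, (0 < i <= k)%N -> `|derive1n i eta x| <= e.
Hypothesis eta01 : forall x, 0 <= eta x <= 1.
Hypothesis eta_one : forall x, `|x| <= p / 2 -> eta x = 1.
Hypothesis eta_zero : forall x, 2 / 3 * p <= `|x| -> eta x = 0.
Hypothesis chi01 : forall x, 0 <= chi x <= 1.
Hypothesis chi_one : forall x, `|x| <= p / 6 -> chi x = 1.
Hypothesis chi_zero : forall x, p / 3 <= `|x| -> chi x = 0.
Hypothesis nn_diff : forall y w w', n1 (w - Z 0%N y) <= delta -> n1 (w' - Z 0%N y) <= delta ->
  n1 (nn w y - nn w' y - Bm y *m (w - w')) <= eps * n1 (w - w').
Hypothesis Z_tail : forall y, p / 6 <= `|y| -> n1 (Z 0%N y) <= zs.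
Hypothesis zs_ge0 : 0 <= zs.
Hypothesis sigma_ge0 : 0 <= sigma.
Hypothesis eps_ge0 : 0 <= eps.
Hypothesis small : sigma *+ 3 + zs <= delta.

Definition cell : set R := `[- (p / 2), p / 2[%classic.

(* On the cell only the translates by -p, 0 and p of a function supported in [-2p/3, 2p/3]
   contribute, so that [tsum p 1] is the periodization there. *)
Definition residual W x : V :=
  jet_op (fun j x => leib j chi Z x + tsum p 1 (leib j eta W) x) x +
  nn (leib 0 chi Z x + tsum p 1 (leib 0 eta W) x) x.

Lemma cellP x : (x \in cell) = (- (p / 2) <= x < p / 2).
Proof. by apply/idP/idP; rewrite inE /cell /= in_itv. Qed.

Lemma shifts1 : shifts p 1 = [:: 1 * p; - (1 * p); 0].
Proof. by []. Qed.

Lemma shift_periodic (X : zmodType) (f : R -> X) c x : periodic f p -> c \in shifts p 1 -> f (x + c) = f x.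
Proof.
move=> fp; rewrite shifts1 !inE mul1r => /or3P[] /eqP ->; rewrite ?addr0 //.
by rewrite -[in RHS](subrK p x) fp.
Qed.

Lemma shift_cell c x : x \in cell -> c \in shifts p 1 -> c != 0 -> (x + c) \notin cell /\ p / 2 <= `|x + c|.
Proof.
rewrite !cellP => /andP[x1 x2]; rewrite shifts1 !inE mul1r.
case/or3P => /eqP -> c0.
- split; first by apply/negP => /andP[_ ?]; lra.
  by rewrite ger0_norm; lra.
- split; first by apply/negP => /andP[? _]; lra.
  by rewrite ler0_norm; lra.
- by rewrite eqxx in c0.
Qed.

(* The increments [w c - w' c] are exchanged one at a time; each of them is compared with the
   linear coefficient [Bm] at its own translate [x + c], where [U] is close to [Z]. *)
Lemma telescope_nn (r : seq R) x (U U0 : V) (w w' : R -> V) :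
  (forall c, c \in r -> nn^~ (x + c) = nn^~ x) ->
  (forall c, c \in r -> w c != w' c -> n1 (U - Z 0%N (x + c)) <= zs) ->
  (forall c, c \in r -> n1 (w c) <= sigma /\ n1 (w' c) <= sigma) ->
  n1 (U0 - U) + sigma *+ size r + zs <= delta ->
  n1 (nn (U0 + \sum_(c <- r) w c) x - nn (U0 + \sum_(c <- r) w' c) x -
      \sum_(c <- r) Bm (x + c) *m (w c - w' c)) <= eps * \sum_(c <- r) n1 (w c - w' c).
Proof.
elim: r U0 => [|c r IH] U0 per far sup sm.
  by rewrite !big_nil subrr subr0 n10 mulr0.
rewrite !big_cons.
have [sc sc'] := sup c (mem_head _ _).
have inr d : d \in r -> d \in c :: r by rewrite inE orbC => ->.
have ws : n1 (\sum_(d <- r) w d) <= sigma *+ size r.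
  apply: (le_trans (n1_sum _ _ _)).
  have -> : sigma *+ size r = \sum_(d <- r) sigma by rewrite big_const_seq count_predT iter_addr_0.
  by rewrite big_seq [leRHS]big_seq; apply: ler_sum => d dr; case: (sup d (inr d dr)).
have sm' : n1 (U0 + w' c - U) + sigma *+ size r + zs <= delta.
  apply: le_trans sm; rewrite lerD2r /= mulrS addrA lerD2r addrAC.
  by apply: (le_trans (n1D _ _)); rewrite lerD2l.
have := IH (U0 + w' c) (fun d dr => per d (inr d dr)) (fun d dr => far d (inr d dr))
  (fun d dr => sup d (inr d dr)) sm'.
rewrite -(addrA U0 (w' c) (\sum_(d <- r) w d)) -(addrA U0 (w' c) (\sum_(d <- r) w' d)).
set S := \sum_(d <- r) w d; set S' := \sum_(d <- r) w' d; set BS := \sum_(d <- r) _ => H.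
have step : n1 (nn (U0 + (w c + S)) x - nn (U0 + (w' c + S)) x - Bm (x + c) *m (w c - w' c)) <=
    eps * n1 (w c - w' c).
  have [->|ne] := eqVneq (w c) (w' c); first by rewrite !subrr mulmx0 subr0 n10 mulr0.
  have fc := far c (mem_head _ _) ne.
  have dist (q : V) : n1 q <= sigma -> n1 (U0 + (q + S) - Z 0%N (x + c)) <= delta.
    move=> qs; apply: le_trans sm; rewrite /= mulrS.
    have -> : U0 + (q + S) - Z 0%N (x + c) = (U0 - U) + (q + S) + (U - Z 0%N (x + c)).
      apply: coordinate_inj => im i; rewrite !(coordinateD, coordinateN); ring.
    apply: (le_trans (n1D _ _)); apply: lerD => //; apply: (le_trans (n1D _ _)); rewrite lerD2l.
    by apply: (le_trans (n1D _ _)); apply: lerD.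
  have := nn_diff (dist _ sc) (dist _ sc').
  have pe q : nn q (x + c) = nn q x := congr1 (fun h => h q) (per c (mem_head _ _)).
  rewrite !pe.
  have -> // : U0 + (w c + S) - (U0 + (w' c + S)) = w c - w' c.
  by apply: coordinate_inj => im i; rewrite !(coordinateD, coordinateN); ring.
have -> : nn (U0 + (w c + S)) x - nn (U0 + (w' c + S')) x - (Bm (x + c) *m (w c - w' c) + BS) =
  (nn (U0 + (w c + S)) x - nn (U0 + (w' c + S)) x - Bm (x + c) *m (w c - w' c)) +
  (nn (U0 + (w' c + S)) x - nn (U0 + (w' c + S')) x - BS).
  apply: coordinate_inj => im i; rewrite !(coordinateD, coordinateN); ring.
by apply: (le_trans (n1D _ _)); rewrite mulrDr; exact: lerD.
Qed.

Lemma cutoff_n1 (h : R) (w : V) : 0 <= h <= 1 -> n1 (of_real s h *: w) <= n1 w.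
Proof.
by move=> /andP[h0 h1]; rewrite n1Z ger0_norm // ler_piMl ?n1_ge0.
Qed.

(** The equation of the difference at each x + c is multiplied by eta (x + c) and summed over c. The
    sources add up to b x - b' x, because eta x = 1 and b, b' vanish off the cell. What is left are
    the commutators, of size jetc e, and the error in replacing nn by Bm, of size eps. *)
Lemma residual_diff W W' b b' x : x \in cell ->
  (forall y, y \notin cell -> b y = 0 /\ b' y = 0) ->
  (forall c, c \in shifts p 1 -> jet_op (fun i y => W i y - W' i y) (x + c) +
     Bm (x + c) *m (W 0%N (x + c) - W' 0%N (x + c)) = b (x + c) - b' (x + c)) ->
  (forall y, n1 (W 0%N y) <= sigma) -> (forall y, n1 (W' 0%N y) <= sigma) ->
  n1 ((b x - residual W x) - (b' x - residual W' x)) <=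
    (eps + jetc * e) * \sum_(c <- shifts p 1) jet_sum (fun i y => W i y - W' i y) (x + c).
Proof.
move=> xI b0 eqW Ws Ws'.
pose D i y := W i y - W' i y.
pose U := leib 0 chi Z x.
pose w c := leib 0 eta W (x + c).
pose w' c := leib 0 eta W' (x + c).
have wD c : w c - w' c = of_real s (eta (x + c)) *: D 0%N (x + c).
  by rewrite /w /w' /= -scalerBr.
have eta0 : eta x = 1.
  move: xI; rewrite cellP => /andP[x1 x2]; apply: eta_one.
  by rewrite ler_norml x1 /= ltW.
have jet_diff : jet_op (fun j y => leib j chi Z y + tsum p 1 (leib j eta W) y) x -
    jet_op (fun j y => leib j chi Z y + tsum p 1 (leib j eta W') y) x =
    \sum_(c <- shifts p 1) (of_real s (eta (x + c)) *: jet_op D (x + c) + commutator eta D (x + c)).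
  under [RHS]eq_bigr do rewrite -jet_op_leib.
  rewrite /jet_op exchange_big /= -sumrB; apply: eq_big_nat => j; rewrite ltnS => jk.
  rewrite -mulmxBr opprD addrACA subrr add0r /tsum -sumrB mulmx_sumr.
  rewrite big_seq [RHS]big_seq; apply: eq_bigr => c cs.
  by rewrite (shift_periodic x (alpha_p jk) cs) leibB.
have b_sum : \sum_(c <- shifts p 1) of_real s (eta (x + c)) *: (b (x + c) - b' (x + c)) = b x - b' x.
  rewrite shifts1 big_cons big_cons big_seq1 addr0 eta0 of_real1 scale1r.
  have o c : c \in shifts p 1 -> c != 0 -> b (x + c) - b' (x + c) = 0.
    by move=> cs c0; have [/b0[-> ->] _] := shift_cell xI cs c0; rewrite subrr.
  rewrite !o ?scaler0 ?add0r // ?shifts1 ?inE ?eqxx ?orbT // ?oppr_eq0 mul1r gt_eqF //.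
have tele := @telescope_nn (shifts p 1) x U U w w'.
have {}tele : n1 (nn (U + \sum_(c <- shifts p 1) w c) x - nn (U + \sum_(c <- shifts p 1) w' c) x -
      \sum_(c <- shifts p 1) Bm (x + c) *m (w c - w' c)) <=
    eps * \sum_(c <- shifts p 1) n1 (w c - w' c).
  apply: tele.
  - move=> c cs; apply/funext => q; exact: (shift_periodic x (nn_p q) cs).
  - move=> c cs ne; rewrite /U /=.
    have [c0|c0] := eqVneq c 0.
      rewrite c0 addr0; have [xs|xl] := leP `|x| (p / 6).
        by rewrite chi_one // of_real1 scale1r subrr n10.
      have -> : of_real s (chi x) *: Z 0%N x - Z 0%N x = - (of_real s (1 - chi x) *: Z 0%N x).
        apply: coordinate_inj => im i.
        by rewrite !(coordinateD, coordinateN, coordinateZ); ring.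
      rewrite n1N; apply: le_trans (Z_tail (ltW xl)); apply: cutoff_n1.
      by have := chi01 x; lra.
    have [_ far] := shift_cell xI cs c0.
    have etac : eta (x + c) != 0.
      by apply: contra_neq ne => E; apply/eqP; rewrite -subr_eq0 wD E of_real0 scale0r.
    have lt23 : `|x + c| < 2 / 3 * p by rewrite ltNge; apply: contra_neqN etac; exact: eta_zero.
    (* A translate by p or -p meets the support of eta only where |x| >= p - 2 p / 3 = p / 3, which
       is where chi starts to vanish. *)
    have x3 : p / 3 <= `|x|.
      move: cs lt23 c0; rewrite shifts1 !inE mul1r ltr_norml => /or3P[] /eqP -> /andP[? ?] c0.
      - by rewrite ler0_norm; lra.
      - by rewrite ger0_norm; lra.
      - by rewrite eqxx in c0.
    rewrite chi_zero // of_real0 scale0r sub0r n1N; apply: Z_tail; lra.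
  - by move=> c cs; split; rewrite /w /w' /=; apply: le_trans (cutoff_n1 _ (eta01 _)) _.
  - by rewrite subrr n10 add0r.
pose BD := \sum_(c <- shifts p 1) Bm (x + c) *m (w c - w' c).
have -> : (b x - residual W x) - (b' x - residual W' x) =
    - \sum_(c <- shifts p 1) commutator eta D (x + c) -
    (nn (U + \sum_(c <- shifts p 1) w c) x - nn (U + \sum_(c <- shifts p 1) w' c) x - BD).
  have E : jet_op (fun j y => leib j chi Z y + tsum p 1 (leib j eta W) y) x -
    jet_op (fun j y => leib j chi Z y + tsum p 1 (leib j eta W') y) x =
    (b x - b' x) - BD + \sum_(c <- shifts p 1) commutator eta D (x + c).
    rewrite jet_diff big_split /=; congr (_ + _); rewrite -b_sum -sumrB.
    rewrite big_seq [RHS]big_seq; apply: eq_bigr => c cs.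
    by rewrite -(eqW c cs) wD -scalemxAr -scalerBr addrK.
  rewrite /residual -/U -[tsum p 1 (leib 0 eta W) x]/(\sum_(c <- shifts p 1) w c).
  rewrite -[tsum p 1 (leib 0 eta W') x]/(\sum_(c <- shifts p 1) w' c).
  move: E; move: (jet_op _ x) (jet_op _ x) => A' A E.
  have -> : A = A' + ((b x - b' x) - BD + \sum_(c <- shifts p 1) commutator eta D (x + c)).
    by rewrite -E subrKC.
  apply: coordinate_inj => im i; rewrite !(coordinateD, coordinateN); ring.
apply: (le_trans (n1B _ _)); rewrite n1N mulrDl addrC; apply: lerD.
  apply: (le_trans tele); apply: ler_wpM2l => //; apply: ler_sum => c _.
  rewrite wD; apply: (le_trans (cutoff_n1 _ (eta01 _))).
  exact: (@n1_le_jet_sum D (x + c) 0%N).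
apply: (le_trans (n1_sum _ _ _)); rewrite mulr_sumr; apply: ler_sum => c _.
by apply: commutator_le => // i ik; exact: eta_small.
Qed.

Variables (r0 L CG : R) (G : (R -> V) -> nat -> R -> V).
Hypothesis alpha_mmeas : forall j, (1 <= j <= k)%N -> mmeas (alpha j).
Hypothesis nn_vcont : forall u, vcont u -> vcont (fun x => nn (u x) x).
Hypothesis L_ge0 : 0 <= L.
Hypothesis nn_lip : forall w x, n1 w <= r0 -> n1 (nn w x) <= L * n1 w.
Hypothesis Z_sup : forall x, n1 (Z 0%N x) <= r0.
Hypothesis Z_fin : forall i, (i <= k)%N -> vlocint (Z i) /\ (energy setT (Z i) < +oo)%E.
Hypothesis Z_cont : vcont (Z 0%N).
Hypothesis Z_sol : {ae mu, forall x, jet_op Z x + nn (Z 0%N x) x = 0}.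
Hypothesis chi_smooth : smooth chi.
Hypothesis chi_le : forall i x, (i <= k)%N -> `|derive1n i chi x| <= 1.
Hypothesis CG_ge0 : 0 <= CG.
Hypothesis G_solves : forall f, vmeas f -> (energy setT f < +oo)%E -> solves (G f) f.
Hypothesis G_bound : forall W f, vmeas f -> (energy setT f < +oo)%E -> solves W f ->
  (\sum_(i < k.+1) energy setT (W i) <= CG%:E * energy setT f)%E.

Lemma residual_vmeas W : (forall i, (i <= k)%N -> vlocint (W i)) -> vcont (W 0%N) ->
  vmeas (residual W).
Proof.
move=> Wl Wc; apply: vmeasD.
  apply: vmeas_sum_nat => j; rewrite ltnS => jk.
  apply: vmeas_mulmx; first exact: alpha_mmeas.
  have lj i : (i <= j)%N -> (i <= k)%N by move=> ij; case/andP: jk => _; exact: leq_trans.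
  apply: vmeasD.
    by apply: leib_vmeas => // i /lj ik; exact: vlocint_vmeas (Z_fin ik).1.
  apply: vmeas_sum => c; apply: vmeas_addr; apply: leib_vmeas => // i /lj ik.
  exact: vlocint_vmeas (Wl i ik).
apply: vcont_vmeas.
apply: (@nn_vcont (fun x => leib 0 chi Z x + tsum p 1 (leib 0 eta W) x)); apply: vcontD.
  by apply: vcontZ => //; exact: smooth_continuous.
apply: vcont_sum => c; apply: vcont_addr; apply: vcontZ => //; exact: smooth_continuous.
Qed.

Lemma solves_vcont W f : solves W f -> vcont (W 0%N).
Proof. by move=> [Wl _ Wp _]; apply: vprim_vcont Wp; exact: (Wl 1%N k_gt0).1. Qed.

(** The iteration runs in L^2, but the linearization of nn is accurate only near Z; entries 0 and 1
    of the a priori bound control the values through the Sobolev inequality. *)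
Lemma solves_sup W f x : vmeas f -> (energy setT f < +oo)%E -> solves W f ->
  ((nsq (W 0%N x))%:E <= (2 * CG)%:E * energy setT f)%E.
Proof.
move=> fm fe sW; have [Wl _ Wp _] := sW.
have W1 := Wl 1%N k_gt0; have W0 := Wl 0%N (leq0n k).
have sub (J : R -> V) : vmeas J -> (energy `[x, (x + 1)%R]%classic J <= energy setT J)%E.
  by move=> Jm; apply: energy_subset.
have xx : x <= x <= x + 1 by rewrite lexx lerDl ler01.
apply: (le_trans (vsobolev W1.1 Wp (le_lt_trans (sub _ (vlocint_vmeas W1.1)) W1.2) xx)).
rewrite EFinM -muleA.
apply: (@le_trans _ _ (2%:E * (energy setT (W 0%N) + energy setT (W 1%N)))%E).
  rewrite (ge0_muleDr _ (energy_ge0 _ _) (energy_ge0 _ _)).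
  by apply: leeD; apply: lee_wpmul2l => //; apply: sub; apply: vlocint_vmeas; [exact: W0.1|exact: W1.1].
apply: lee_wpmul2l => //; apply: (le_trans (energy01_le _ W k_gt0)); exact: G_bound.
Qed.

Definition outer : set R := ~` `](- (p / 6)), (p / 6)[%classic.

Lemma outerP x : (x \in outer) = (p / 6 <= `|x|).
Proof.
rewrite leNgt ltr_norml; apply/idP/idP.
  by rewrite inE /outer /= in_itv /= => /negP.
by move=> /negP h; rewrite inE /outer /= in_itv.
Qed.

Lemma measurable_cell : measurable cell.
Proof. exact: measurable_itv. Qed.

Lemma measurable_outer : measurable outer.
Proof. by apply: measurableC; exact: measurable_itv. Qed.

(** For |x| < p / 6 the cutoff is 1 near x and the residual is the equation of Z itself. Elsewhere a
    crude bound by the jet of Z suffices, nn being Lipschitz at 0. *)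
Lemma residual0_le : {ae mu, forall x,
  n1 (residual (fun _ _ => 0) x *+ (x \in cell)) <=
  (jetc + L) * \sum_(i < k.+1) n1 (Z i x *+ (x \in outer))}.
Proof.
apply: ae_imp Z_sol => x Zx.
have S0 : 0 <= \sum_(i < k.+1) n1 (Z i x *+ (x \in outer)) by apply: sumr_ge0 => i _; exact: n1_ge0.
have C0 : 0 <= jetc + L by rewrite addr_ge0 ?jetc_ge0.
have [xI|xI] := boolP (x \in cell); last by rewrite mulr0n n10 mulr_ge0.
rewrite mulr1n.
have ts0 j : tsum p 1 (leib j eta (fun _ _ => 0 : V)) x = 0.
  by rewrite /tsum big1 // => c _; exact: leib_zero.
have -> : residual (fun _ _ => 0) x = jet_op (fun j => leib j chi Z) x + nn (leib 0 chi Z x) x.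
  rewrite /residual ts0 addr0; congr (_ + _).
  by apply: eq_bigr => j _; rewrite ts0 addr0.
have [xo|xo] := boolP (x \in outer).
  rewrite mulrDl; apply: (le_trans (n1D _ _)); apply: lerD.
    have := @n1_jet_op_le Z (fun j => leib j chi Z x) x 1 ler01; rewrite mulr1; apply.
    move=> j /andP[_ jk]; apply: leib_le => i ij; apply: chi_le; exact: leq_trans jk.
  have c1 := cutoff_n1 (Z 0%N x) (chi01 x).
  apply: (le_trans (nn_lip _ (le_trans c1 (Z_sup x)))); apply: ler_wpM2l => //.
  apply: (le_trans c1); exact: (@n1_le_jet_sum Z x 0%N).
have xs : `|x| < p / 6 by rewrite outerP -ltNge in xo.
have near1 : \forall y \near x, chi y = (fun=> 1 : R) y.
  have : \forall y \near x, `|y - x| < p / 6 - `|x|.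
    by apply/nbhs_ballP; exists (p / 6 - `|x|) => [|y]; rewrite /= ?subr_gt0 // -ball_normE /= distrC.
  apply: filterS => y yx; apply: chi_one.
  have := ler_normD (y - x) x; rewrite subrK; lra.
have lE j : leib j chi Z x = Z j x.
  apply: leib_eq1; first by rewrite chi_one // ltW.
  move=> [//|i] _; have := near_derive1n i.+1 near1.
  by move=> /nbhs_singleton ->; rewrite derive1n_cst.
have -> : jet_op (fun j => leib j chi Z) x + nn (leib 0 chi Z x) x = jet_op Z x + nn (Z 0%N x) x.
  by rewrite lE; congr (_ + _); apply: eq_bigr => j _; rewrite lE.
by rewrite Zx n10 mulr_ge0 // sumr_ge0 // => i _; exact: n1_ge0.
Qed.

Definition tail_energy : \bar R := (\sum_(i < k.+1) energy outer (Z i))%E.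

Definition residc : R := (jetc + L) ^+ 2 * 2 ^+ k.+1 * @n1c R m.

Lemma residual0_energy :
  (energy setT (fun x => (residual (fun _ _ => 0) x *+ (x \in cell))%R) <= residc%:E * tail_energy)%E.
Proof.
have C0 : 0 <= jetc + L by rewrite addr_ge0 ?jetc_ge0.
pose t i : R -> V := if (i <= k)%N then fun x => Z i x *+ (x \in outer) else fun=> 0.
have Zm i : (i <= k)%N -> vmeas (Z i) by move=> ik; exact: vlocint_vmeas (Z_fin ik).1.
have tm i : vmeas (t i).
  rewrite /t; case: ifPn => [ik|_]; last exact: vmeas0.
  by apply: vmeas_restrict => //; [exact: measurable_outer|exact: Zm].
have rm : vmeas (fun x => residual (fun _ _ => 0) x *+ (x \in cell)).
  apply: vmeas_restrict; first exact: measurable_cell.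
  have [Wl _ _ _] := solves0; apply: residual_vmeas => [i ik|]; first exact: (Wl i ik).1.
  exact: solves_vcont solves0.
have := @energy_le_n1 R s m nat (index_iota 0 k.+1) setT _ t _ measurableT C0 rm tm.
rewrite size_iota subn0 -/residc big_mkord.
have -> : (\sum_(i < k.+1) energy setT (t i) = tail_energy)%E.
  apply: eq_bigr => i _; rewrite /t -ltnS ltn_ord energy_restrict //; first exact: measurable_outer.
  by apply: Zm; rewrite -ltnS.
apply; apply: ae_imp residual0_le => x H _; apply: (le_trans H).
apply: ler_wpM2l => //; rewrite big_mkord le_eqVlt; apply/orP; left; apply/eqP.
by apply: eq_bigr => i _; rewrite /t -ltnS ltn_ord.
Qed.

Definition Phi_of W b x : V := (b x - residual W x) *+ (x \in cell).

(** The pointwise bound has 3 (k + 1) terms, three translates of each entry of the jet; the last 3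
    counts how often each energy occurs. *)
Definition contractc : R := (eps + jetc * e) ^+ 2 * 2 ^+ (3 * k.+1) * @n1c R m * 3.

Lemma contractc_ge0 : 0 <= contractc.
Proof. by rewrite /contractc mulr_ge0 // mulr_ge0 ?n1c_ge0 // mulr_ge0 ?sqr_ge0 ?exprn_ge0. Qed.

Lemma jet_sum_energy (D : nat -> R -> V) f (C : R) : 0 <= C -> vmeas f ->
  (forall i, (i <= k)%N -> vmeas (D i)) ->
  {ae mu, forall x, n1 (f x) <= C * \sum_(c <- shifts p 1) jet_sum D (x + c)} ->
  (energy setT f <= (C ^+ 2 * 2 ^+ (3 * k.+1) * @n1c R m * 3)%:E * \sum_(i < k.+1) energy setT (D i))%E.
Proof.
move=> C0 fm Dm fD.
pose t (ci : R * nat) : R -> V := if (ci.2 <= k)%N then fun x => D ci.2 (x + ci.1) else fun=> 0.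
have tm ci : vmeas (t ci).
  rewrite /t; case: ifPn => [ik|_]; last exact: vmeas0.
  by apply: vmeas_addr; exact: Dm.
pose r := [seq (c, i) | c <- shifts p 1, i <- index_iota 0 k.+1].
have := @energy_le_n1 R s m _ r setT _ t _ measurableT C0 fm tm.
have -> : size r = (3 * k.+1)%N by rewrite size_allpairs size_iota.
have -> : (\sum_(i <- r) energy setT (t i) = 3%:E * \sum_(i < k.+1) energy setT (D i))%E.
  rewrite /r big_allpairs /=.
  have E c : (\sum_(j <- index_iota 0 k.+1) energy setT (t (c, j)) =
              \sum_(i < k.+1) energy setT (D i))%E.
    rewrite big_mkord; apply: eq_bigr => i _; rewrite /t /= -ltnS ltn_ord energy_addr //.
    by apply: Dm; rewrite -ltnS.
  under eq_bigr do rewrite E.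
  rewrite big_cons big_cons big_seq1.
  have S0 : (0 <= \sum_(i < k.+1) energy setT (D i))%E by apply: sume_ge0 => i _; exact: energy_ge0.
  move: (\sum_(i < k.+1) _)%E S0 => S S0.
  have -> : 3%:E = (1 + (1 + 1))%:E :> \bar R by congr (_%:E); ring.
  by rewrite EFinD ge0_muleDl ?lee_fin // EFinD ge0_muleDl ?lee_fin // !mul1e.
rewrite muleA -EFinM; apply; apply: ae_imp fD => x H _; apply: (le_trans H).
apply: ler_wpM2l => //; rewrite le_eqVlt; apply/orP; left; apply/eqP.
rewrite /r big_allpairs; apply: eq_bigr => c _; rewrite big_mkord.
by apply: eq_bigr => i _; rewrite /t /= -ltnS ltn_ord.
Qed.

(** Formulated for arbitrary solutions rather than for values of G, so that it also compares the
    solution chosen for the source 0 with the zero jet. *)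
Lemma Phi_contraction W W' b b' : vmeas b -> vmeas b' ->
  (energy setT b < +oo)%E -> (energy setT b' < +oo)%E -> solves W b -> solves W' b' ->
  (forall y, y \notin cell -> b y = 0 /\ b' y = 0) ->
  (forall y, n1 (W 0%N y) <= sigma) -> (forall y, n1 (W' 0%N y) <= sigma) ->
  (energy setT (fun x => (Phi_of W b x - Phi_of W' b' x)%R) <=
   (contractc * CG)%:E * energy setT (fun x => (b x - b' x)%R))%E.
Proof.
move=> bm bm' be be' sW sW' b0 Ws Ws'.
have sD := solvesB sW sW'; have [Dl _ _ eqD] := sD.
have [Wl _ _ _] := sW; have [Wl' _ _ _] := sW'.
have C0 : 0 <= eps + jetc * e by rewrite addr_ge0 // mulr_ge0 // jetc_ge0.
have Pm : vmeas (fun x => Phi_of W b x - Phi_of W' b' x).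
  apply: vmeasB; apply: vmeas_restrict; try exact: measurable_cell; apply: vmeasB => //.
    by apply: residual_vmeas => [i ik|]; [exact: (Wl i ik).1|exact: solves_vcont sW].
  by apply: residual_vmeas => [i ik|]; [exact: (Wl' i ik).1|exact: solves_vcont sW'].
have bDe : (energy setT (fun x => (b x - b' x)%R) < +oo)%E.
  apply: (le_lt_trans (energyB_le measurableT bm bm')).
  by rewrite lte_add_pinfty // lte_mul_pinfty // ge0_fin_numE.
have Cc0 := contractc_ge0.
rewrite EFinM -muleA.
apply: le_trans (lee_wpmul2l _ (G_bound (vmeasB bm bm') bDe sD)); last by rewrite lee_fin.
rewrite /contractc; apply: (@jet_sum_energy (fun i x => W i x - W' i x) _ _ C0 Pm); first by move=> i ik; exact: vlocint_vmeas (Dl i ik).1.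
have ae1 : {ae mu, forall x, forall c, c \in shifts p 1 ->
    jet_op (fun i y => W i y - W' i y) (x + c) +
    Bm (x + c) *m (W 0%N (x + c) - W' 0%N (x + c)) = b (x + c) - b' (x + c)}.
  have h c := ae_addr c eqD.
  have h12 := ae_imp2 (fun x a a' => conj a a') (h (1 * p)) (h (- (1 * p))).
  apply: ae_imp2 h12 (h 0) => x [e1 e2] e3 c.
  by rewrite shifts1 !inE => /or3P[] /eqP ->.
apply: ae_imp ae1 => x eqx.
have [xI|xI] := boolP (x \in cell).
  by rewrite /Phi_of xI !mulr1n; exact: residual_diff.
rewrite /Phi_of (negbTE xI) !mulr0n subrr n10 mulr_ge0 // sumr_ge0 // => c _.
exact: jet_sum_ge0.
Qed.

Variable t : R.
Hypothesis t_ge0 : 0 <= t.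
Hypothesis tail_le : (tail_energy <= t%:E)%E.
Hypothesis contract_small : contractc * CG <= 16^-1.
Hypothesis sigma_small : @n1c R m * (2 * CG * (4 * (2 * residc * t))) <= sigma ^+ 2.

(** The ball of the contraction principle contains functions not supported in the cell; they are cut
    before G is applied. *)
Definition cut b x : V := b x *+ (x \in cell).

Lemma cut_energy b : vmeas b -> (energy setT (cut b) <= energy setT b)%E.
Proof.
move=> bm; rewrite energy_restrict //; last exact: measurable_cell.
by apply: energy_subset => //; exact: measurable_cell.
Qed.

Lemma cut_vmeas b : vmeas b -> vmeas (cut b).
Proof. by apply: vmeas_restrict; exact: measurable_cell. Qed.

Lemma residc_ge0 : 0 <= residc.
Proof. by rewrite /residc mulr_ge0 ?n1c_ge0 // mulr_ge0 ?sqr_ge0 ?exprn_ge0. Qed.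

Definition Phi b : R -> V := Phi_of (G (cut b)) (cut b).

(** The hypothesis [sigma_small] is this chain of bounds: energy 4 (2 residc t) in the ball, factor
    2 CG from [solves_sup], and [n1c] to pass to the norm [n1]. *)
Lemma ball_solution b : l2_ball (2 * residc * t) b ->
  [/\ vmeas (cut b), (energy setT (cut b) < +oo)%E, solves (G (cut b)) (cut b) &
    forall y, n1 (G (cut b) 0%N y) <= sigma].
Proof.
move=> [bm be]; have cm := cut_vmeas bm.
have ce := le_trans (cut_energy bm) be.
have cf : (energy setT (cut b) < +oo)%E by apply: (le_lt_trans ce); exact: ltry.
have sG := G_solves cm cf; split => // y.
have := solves_sup y cm cf sG.
move=> /le_trans/(_ (lee_wpmul2l _ ce)).
rewrite lee_fin mulr_ge0 // => /(_ isT); rewrite -EFinM lee_fin => h.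
exact: n1_sqr_le h sigma_small.
Qed.

Lemma cut_out b b' y : y \notin cell -> cut b y = 0 /\ cut b' y = 0.
Proof. by rewrite /cut => /negbTE ->. Qed.

Lemma Phi_ball_contract b b' : l2_ball (2 * residc * t) b -> l2_ball (2 * residc * t) b' ->
  (energy setT (fun x => (Phi b x - Phi b' x)%R) <= 16^-1%:E * energy setT (fun x => (b x - b' x)%R))%E.
Proof.
move=> bb bb'; have [cm cf cs csup] := ball_solution bb.
have [cm' cf' cs' csup'] := ball_solution bb'.
apply: (le_trans (Phi_contraction cm cm' cf cf' cs cs' (@cut_out b b') csup csup')).
apply: lee_pmul => //.
- by rewrite lee_fin mulr_ge0 // contractc_ge0.
- exact: energy_ge0.
- have -> : (fun x => cut b x - cut b' x) = cut (fun x => b x - b' x).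
    by apply/funext => x; rewrite /cut mulrnBl.
  by apply: cut_energy; apply: vmeasB; [exact: bb.1|exact: bb'.1].
Qed.

Lemma Phi_ball_vmeas b : l2_ball (2 * residc * t) b -> vmeas (Phi b).
Proof.
move=> bb; have [cm cf cs csup] := ball_solution bb; have [Wl _ _ _] := cs.
apply: vmeas_restrict; first exact: measurable_cell.
apply: vmeasB => //; apply: residual_vmeas => [i ik|]; first exact: (Wl i ik).1.
exact: solves_vcont cs.
Qed.

Lemma rho_ge0 : 0 <= 2 * residc * t.
Proof. by apply: mulr_ge0 => //; apply: mulr_ge0 => //; exact: residc_ge0. Qed.

(** The jet chosen for the source 0 need not be literally zero. The contraction estimate shows that
    this does not affect Phi almost everywhere; the detour through the zero jet costs the factor
    2. *)
Lemma Phi_zero_energy : (energy setT (Phi (fun=> 0%R)) <= (2 * residc * t)%:E)%E.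
Proof.
have zb := @zero_ball R s m _ rho_ge0.
have [cm cf cs csup] := ball_solution zb.
have c0 : cut (fun=> 0) = (fun=> 0) by apply/funext => x; rewrite /cut mul0rn.
pose Psi := Phi_of (fun _ _ => 0) (cut (fun=> 0)).
have Psi_m : vmeas Psi.
  apply: vmeas_restrict; first exact: measurable_cell.
  have [Wl _ _ _] := solves0; apply: vmeasB => //; apply: residual_vmeas => [i ik|].
    exact: (Wl i ik).1.
  exact: solves_vcont solves0.
have Phi_m := Phi_ball_vmeas zb.
have z0 (y : R) : n1 ((fun _ _ => 0 : V) 0%N y) <= sigma by rewrite n10.
have s0 : solves (fun _ _ => 0) (cut (fun=> 0)) by rewrite c0; exact: solves0.
have := Phi_contraction cm cm cf cf cs s0 (@cut_out _ _) csup z0.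
rewrite -/Psi (_ : (fun x => cut (fun=> 0) x - cut (fun=> 0) x) = fun=> 0); last first.
  by apply/funext => x; rewrite subrr.
rewrite energy0 mule0 => d0.
have -> : energy setT (Phi (fun=> 0%R)) = energy setT (fun x => (Phi (fun=> 0) x - Psi x) + Psi x).
  by apply: eq_integral => x _; rewrite subrK.
apply: (le_trans (energyD_le measurableT (vmeasB Phi_m Psi_m) Psi_m)).
have PsiE : energy setT Psi = energy setT (fun x => residual (fun _ _ => 0) x *+ (x \in cell)).
  rewrite -[RHS]energyN; apply: eq_integral => x _.
  by rewrite /Psi /Phi_of c0 sub0r mulNrn.
have : (energy setT Psi <= (residc * t)%:E)%E.
  rewrite PsiE; apply: (le_trans residual0_energy).
  apply: (@le_trans _ _ (residc%:E * t%:E)%E); last by rewrite -EFinM.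
  by apply: lee_wpmul2l => //; rewrite lee_fin residc_ge0.
have split2 (q : R) : (2 * q * t)%:E = (2%:E * 0 + 2%:E * (q * t)%:E)%E.
  by rewrite mule0 add0e -EFinM mulrA.
rewrite split2; move: residc => q Psi_e.
by apply: leeD; apply: lee_wpmul2l.
Qed.

(** On the cell b = b - residual forces a zero residual. The constant 8 is the 4 of the ball times
    the 2 of [Phi_zero_energy]. *)
Lemma corrected_solution : exists W b, [/\ vmeas b, (energy setT b <= (8 * residc * t)%:E)%E,
  solves W b & {ae mu, forall x, x \in cell -> residual W x = 0}].
Proof.
have [b bb fixb] := l2_contraction_fixpoint rho_ge0 Phi_ball_vmeas Phi_zero_energy Phi_ball_contract.
have [cm cf cs csup] := ball_solution bb.
exists (G (cut b)), (cut b); split => //.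
  apply: (le_trans (cut_energy bb.1)); apply: (le_trans bb.2).
  by rewrite lee_fin !mulrA -natrM.
apply: ae_imp fixb => x; rewrite /Phi /Phi_of /cut => H xI; move: H; rewrite xI !mulr1n.
by move=> /esym/eqP; rewrite subr_eq -subr_eq0 opprD addrA subrr sub0r oppr_eq0 => /eqP.
Qed.

End AtPeriod.

End ApproximateInverse.

(** * Cutoff functions *)

Section Cutoffs.
Context {R : realType}.
Local Notation mu := (@lebesgue_measure R).

Lemma near_lt (a x : R) : x < a -> \forall y \near x, y < a.
Proof.
move=> xa; apply/nbhs_ballP; exists (a - x) => [|y]; rewrite /= ?subr_gt0 // -ball_normE /=.
by rewrite distrC ltr_norml => /andP[_]; lra.
Qed.

Lemma near_gt (a x : R) : a < x -> \forall y \near x, a < y.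
Proof.
move=> xa; apply/nbhs_ballP; exists (x - a) => [|y]; rewrite /= ?subr_gt0 // -ball_normE /=.
by rewrite distrC ltr_norml => /andP[]; lra.
Qed.

Lemma near_norm_lt (a x : R) : `|x| < a -> \forall y \near x, `|y| < a.
Proof.
rewrite ltr_norml => /andP[h1 h2]; near=> y; rewrite ltr_norml; apply/andP; split.
  by near: y; exact: near_gt.
by near: y; exact: near_lt.
Unshelve. all: by end_near. Qed.

Lemma near_norm_gt (a x : R) : a < `|x| -> \forall y \near x, a < `|y|.
Proof.
move=> ax; have /orP[h|h] : (a < x) || (a < - x).
  by move: ax; case: (ler0P x) => _ ->; rewrite ?orbT.
  by apply: filterS (near_gt h) => y /lt_le_trans; apply; exact: ler_norm.
apply: filterS (near_lt (x := x) (a := - a) _); last by rewrite ltrNr.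
by move=> y; rewrite ltrNr => /lt_le_trans; apply; rewrite -normrN ler_norm.
Qed.

Lemma Wkoo_norm_le k (chi : R -> R) i x : (Wkoo_norm k chi <= 1)%E -> (i <= k)%N ->
  `|derive1n i chi x| <= 1.
Proof.
move=> h ik; rewrite -lee_fin; apply: le_trans h.
apply: (@le_trans _ _ (ereal_sup (range (fun x => `|derive1n i chi x|%:E)))).
  by apply: ereal_sup_ubound; exists x.
exact: (@le_bigmax_cond _ _ _ 0%E (Ordinal (ik : (i < k.+1)%N)) xpredT
  (fun j : 'I_k.+1 => ereal_sup (range (fun x => `|derive1n j chi x|%:E)))).
Qed.

Variables (k : nat) (T : R) (n : nat) (chi : R -> R).
Hypothesis T_gt0 : 0 < T.
Hypothesis n_gt0 : (0 < n)%N.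
Hypothesis chiP : cutoff k T n chi.
Local Notation p := (n%:R * T).

Lemma period_gt0 : 0 < p.
Proof. by rewrite mulr_gt0 // ltr0n. Qed.

Lemma cutoff_one x : `|x| <= p / 6 -> chi x = 1.
Proof.
have [_ _ _ _ [h _]] := chiP; rewrite ler_norml => /andP[h1 h2]; apply: h.
by rewrite in_itv /= -mulrA ![6^-1 * T]mulrC mulrA h1 h2.
Qed.

Lemma cutoff_zero x : p / 3 <= `|x| -> `|x| <= p / 2 -> chi x = 0.
Proof.
have [_ _ _ _ [_ h]] := chiP => h1; rewrite ler_norml => /andP[h2 h3]; apply: h.
have e3 : n%:R / 3 * T = p / 3 by ring.
have e2 : n%:R / 2 * T = p / 2 by ring.
rewrite !in_itv /= e3 e2 h2 h3 andbT /=.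
by move: h1; case: (ler0P x) => _ h1; [left|right] => //; rewrite lerNr.
Qed.

(* On [0, 1] this is the left flank of the cutoff, rescaled. *)
Definition step_of x : R := if x <= 0 then 0 else if 1 <= x then 1 else chi ((x - 1) * (p / 2)).

(** For x in [0, 1] the argument (x - 1) p / 2 runs through [-p/2, 0], and x = 1/3 and x = 2/3
    correspond to -p/3 and -p/6, which explains the numbers in [smooth_step]. *)
Lemma step_of_zero x : x <= 3^-1 -> step_of x = 0.
Proof.
move=> x3; rewrite /step_of; case: (leP x 0) => // x0.
have -> : (1 <= x) = false by apply/negbTE; rewrite -ltNge; lra.
have p0 := period_gt0; rewrite cutoff_zero //; rewrite ler0_norm; try nra.
Qed.

Lemma step_of_one x : 2 / 3 <= x -> step_of x = 1.
Proof.
move=> x3; rewrite /step_of; have -> : (x <= 0) = false by apply/negbTE; rewrite -ltNge; lra.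
case: (leP 1 x) => // x1; have p0 := period_gt0.
by rewrite cutoff_one // ler0_norm; nra.
Qed.

Lemma smooth_step_of : smooth_step step_of.
Proof.
have [cs _ c01 _ _] := chiP.
split; [|exact: step_of_zero|exact: step_of_one|]; last first.
  move=> x; rewrite /step_of; case: ifP => _; first by rewrite lexx ler01.
  by case: ifP => _; [rewrite ler01 lexx|exact: c01].
apply: smooth_local => x; have [x1|x1] := ltP x 3^-1.
  by exists (fun=> 0); [exact: smooth_cst|apply: filterS (near_lt x1) => y /ltW; exact: step_of_zero].
have [x2|x2] := ltP (2 / 3) x.
  by exists (fun=> 1); [exact: smooth_cst|apply: filterS (near_gt x2) => y /ltW; exact: step_of_one].
exists (fun y => chi (p / 2 * y + - (p / 2))); first exact: smooth_affine.
have a1 : 0 < x by lra.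
have a2 : x < 1 by lra.
near=> y; rewrite /step_of.
have -> : (y <= 0) = false by apply/negbTE; rewrite -ltNge; near: y; exact: near_gt.
have -> : (1 <= y) = false by apply/negbTE; rewrite -ltNge; near: y; exact: near_lt.
by congr chi; ring.
Unshelve. all: by end_near. Qed.

(* [chi] is periodic; this keeps only the piece around 0. *)
Definition cut_off x : R := if `|x| <= p / 2 then chi x else 0.

Lemma cut_off_zero x : p / 3 <= `|x| -> cut_off x = 0.
Proof. by move=> h; rewrite /cut_off; case: leP => // h2; exact: cutoff_zero. Qed.

Lemma cut_off_one x : `|x| <= p / 6 -> cut_off x = 1.
Proof.
move=> h; rewrite /cut_off ifT ?cutoff_one //; have := period_gt0; lra.
Qed.

Lemma cut_off01 x : 0 <= cut_off x <= 1.
Proof.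
have [_ _ c01 _ _] := chiP.
by rewrite /cut_off; case: ifP => _; [exact: c01|rewrite lexx ler01].
Qed.

Lemma near_cut_off_zero x : p / 3 < `|x| -> \forall y \near x, cut_off y = (fun=> 0) y.
Proof. by move=> h; apply: filterS (near_norm_gt h) => y /ltW; exact: cut_off_zero. Qed.

Lemma near_cut_off_chi x : `|x| < p / 2 -> \forall y \near x, cut_off y = chi y.
Proof. by move=> h; apply: filterS (near_norm_lt h) => y /ltW yp; rewrite /cut_off yp. Qed.

(** The truncation at |x| = p / 2 is invisible, since chi is 0 from p / 3 on. *)
Lemma smooth_cut_off : smooth cut_off.
Proof.
have [cs _ _ _ _] := chiP.
apply: smooth_local => x; have [h|h] := ltP `|x| (p / 2).
  by exists chi => //; exact: near_cut_off_chi.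
exists (fun=> 0); first exact: smooth_cst.
apply: near_cut_off_zero; apply: lt_le_trans h; have := period_gt0; lra.
Qed.

Lemma derive1n_cut_off_zero i x : p / 3 < `|x| -> derive1n i cut_off x = 0.
Proof.
move=> h; have := near_derive1n i (near_cut_off_zero h) => /nbhs_singleton ->.
by case: i => // i; rewrite derive1n_cst.
Qed.

Lemma cut_off_le i x : (i <= k)%N -> `|derive1n i cut_off x| <= 1.
Proof.
have [_ _ _ cW _] := chiP => ik; have [h|h] := ltP `|x| (p / 2).
  have := near_derive1n i (near_cut_off_chi h) => /nbhs_singleton ->.
  exact: Wkoo_norm_le cW ik.
rewrite derive1n_cut_off_zero ?normr0 //; apply: lt_le_trans h; have := period_gt0; lra.
Qed.

End Cutoffs.

(** * The slowly varying plateau function *)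

Section Plateau.
Context {R : realType}.
Variable B : R -> R.
Hypothesis BS : smooth_step B.

(* Both factors are 1 on [-1/2, 1/2]; the first vanishes for x <= -2/3, the second for x >= 2/3. *)
Definition bump1 x : R := B (4 * x + 3) * B (- 4 * x + 3).

Lemma smooth_bump1 : smooth bump1.
Proof. by have [Bs _ _ _] := BS; apply: smoothM; exact: smooth_affine. Qed.

Lemma bump1_zero x : 2 / 3 <= `|x| -> bump1 x = 0.
Proof.
have [_ B0 _ _] := BS; rewrite /bump1; case: (ler0P x) => _ h.
  by rewrite B0 ?mul0r //; lra.
by rewrite [X in _ * X]B0 ?mulr0 //; lra.
Qed.

Lemma bump1_one x : `|x| <= 1 / 2 -> bump1 x = 1.
Proof.
have [_ _ B1 _] := BS; rewrite ler_norml => /andP[h1 h2].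
by rewrite /bump1 !B1 ?mulr1 //; lra.
Qed.

Lemma bump101 x : 0 <= bump1 x <= 1.
Proof.
have [_ _ _ B01] := BS; rewrite /bump1.
have /andP[a a'] := B01 (4 * x + 3); have /andP[b b'] := B01 (- 4 * x + 3).
by rewrite mulr_ge0 //= mulr_ile1.
Qed.

Lemma bump1_bounded k : exists2 M : R, 0 <= M & forall i x, (i <= k)%N -> `|derive1n i bump1 x| <= M.
Proof.
have tb : test_function bump1.
  apply/test_functionP; split; first exact: smooth_bump1.
  by exists 1 => x x1; apply: bump1_zero; lra.
elim: k => [|k [M M0 HM]].
  have [C HC] := test_function_bounded tb.
  by exists `|C| => // -[|//] x _; apply: le_trans (ler_norm _); exact: HC.
have [C HC] := test_function_bounded (test_function_derive1n k.+1 tb).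
exists (M + `|C|) => [|i x]; first exact: addr_ge0.
rewrite leq_eqVlt => /orP[/eqP ->|ik].
  by apply: (le_trans (HC x)); apply: (le_trans (ler_norm _)); rewrite lerDr.
by apply: (le_trans (HM i x ik)); rewrite lerDl.
Qed.

Variable p : R.
Hypothesis p_gt0 : 0 < p.
Definition bump x : R := bump1 (p^-1 * x + 0).

Lemma bump_norm x : `|p^-1 * x + 0| = `|x| / p.
Proof. by rewrite addr0 normrM mulrC normfV (gtr0_norm p_gt0). Qed.

Lemma smooth_bump : smooth bump.
Proof. exact: smooth_affine smooth_bump1. Qed.

Lemma bump_zero x : 2 / 3 * p <= `|x| -> bump x = 0.
Proof. by move=> h; apply: bump1_zero; rewrite bump_norm ler_pdivlMr. Qed.

Lemma bump_one x : `|x| <= p / 2 -> bump x = 1.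
Proof. by move=> h; apply: bump1_one; rewrite bump_norm ler_pdivrMr // mulrAC mul1r. Qed.

Lemma bump01 x : 0 <= bump x <= 1.
Proof. exact: bump101. Qed.

Lemma derive1n_bump_zero i x : 2 / 3 * p < `|x| -> derive1n i bump x = 0.
Proof.
move=> h; have n0 : \forall y \near x, bump y = (fun=> 0) y.
  by apply: filterS (near_norm_gt h) => y /ltW; exact: bump_zero.
have := near_derive1n i n0 => /nbhs_singleton ->.
by case: i => // i; rewrite derive1n_cst.
Qed.

(** The i-th derivative scales like p^-i, which is at most p^-1 because p >= 1 and i > 0. *)
Lemma bump_small k (M : R) i x : 1 <= p -> 0 <= M -> (forall i x, (i <= k)%N -> `|derive1n i bump1 x| <= M) ->
  (0 < i <= k)%N -> `|derive1n i bump x| <= M / p.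
Proof.
case: i => // i p1 M0 HM /andP[_ ik]; rewrite /bump derive1n_affine; last exact: smooth_bump1.
have q0 : 0 <= p^-1 by rewrite invr_ge0 ltW.
rewrite normrM mulrC ler_pM ?HM // normrX (ger0_norm q0) exprS ler_piMr //.
by rewrite exprn_ile1 // invf_le1.
Qed.

End Plateau.

(** * Continuous representatives and periodized jets *)

Section Versions.
Context {R : realType} {s : scalars} {m : nat}.
Local Notation F := (scalar_field R s).
Local Notation V := 'cV[F]_m.
Local Notation mu := (@lebesgue_measure R).
Implicit Types (f g u : R -> V).

Lemma ae_dense (P : R -> Prop) (x r : R) : {ae mu, forall x, P x} -> 0 < r ->
  exists2 y, `|y - x| < r & P y.
Proof.
move=> [A [mA A0 PA]] r0; apply: contrapT => nP.
have sub : `]x - r, x + r[%classic `<=` A.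
  move=> y; rewrite /= in_itv /= => /andP[h1 h2]; apply: PA => Py; apply: nP; exists y => //.
  by rewrite ltr_norml; apply/andP; split; lra.
have := le_measure mu (mem_set (measurable_itv `]x - r, x + r[)) (mem_set mA) sub.
move=> h; have : (mu `]x - r, x + r[%classic <= 0%E)%O by rewrite -[X in (_ <= X)%O]A0; exact: h.
rewrite lebesgue_measure_itv /= lte_fin ifT; last lra.
rewrite -EFinB lee_fin; lra.
Qed.

Lemma vcont_ae_eq f g : vcont f -> vcont g -> {ae mu, forall x, f x = g x} -> forall x, f x = g x.
Proof.
move=> fc gc fg x; apply: coordinate_inj => im i; apply/eqP; rewrite -subr_eq0.
apply/negPn/negP => ne.
have hc : {for x, continuous (fun y => coordinate im i (f y) - coordinate im i (g y))}.
  by apply: cvgB; [exact: fc|exact: gc].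
have := hc; move=> /cvgrPdist_lt/(_ `|coordinate im i (f x) - coordinate im i (g x)|).
rewrite normr_gt0 => /(_ ne) /nbhs_ballP[r /= r0 H].
have [y yx E] := ae_dense x fg r0.
have := H y; rewrite /= -ball_normE /= distrC => /(_ yx).
by rewrite E subrr subr0 ltxx.
Qed.

Lemma vcont_periodic_bounded (T : R) u : 0 < T -> vcont u -> periodic u T ->
  exists2 r : R, 0 <= r & forall x, n1 (u x) <= r.
Proof.
move=> T0 uc uT.
have : \forall r \near (+oo : set_system R), forall ii : bool * 'I_m, forall x, 0 <= x <= T ->
    `|coordinate ii.1 ii.2 (u x)| <= r.
  apply: (@filter_forall R _ (fun ii r => forall x, 0 <= x <= T ->
    `|coordinate ii.1 ii.2 (u x)| <= r) (+oo%R)) => -[im i].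
  have [C HC] := continuous_bounded_itv 0 T (@uc im i).
  apply: filterS (nbhs_pinfty_ge (num_real C)) => r Cr x x0; exact: le_trans (HC x x0) Cr.
move=> /near_pinfty_exists[r r0 Hr].
exists ((2 * m)%:R * r) => [|x]; first exact: mulr_ge0.
have [c cT Hc] := period_shift x T0.
have := Hc _ _ uT (x - c); rewrite subrK => ->.
by apply: n1_le => im i; exact: (Hr (im, i)).
Qed.

(* Replaces the 0-th entry of a jet by its continuous representative. *)
Definition rejet f J i : R -> V := if i is 0%N then f else J i.

Lemma rejet_vchain k f J : (0 < k)%N -> vcont f -> {ae mu, forall x, J 0%N x = f x} ->
  vchain k J -> vchain k (rejet f J).
Proof.
move=> k0 fc fJ Jc [|j] jk /=; last exact: Jc.
have [l1 l2] := vder_vlocint (Jc 0%N k0).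
apply: vder_ae (Jc 0%N k0) => //; first exact: vcont_vlocint.
by apply/aeW.
Qed.

(** Every x is outside the tail set for large n, so dominated convergence applies to integrands that
    are eventually 0 at each point. *)
Lemma energy_tail_cvg (T : R) f : 0 < T -> vmeas f -> (energy setT f < +oo)%E ->
  energy (outer (n%:R * T)) f @[n --> \oo] --> (0 : \bar R)%E.
Proof.
move=> T0 fm fe.
pose u n x := (nsq (f x *+ (x \in outer (n%:R * T))))%:E.
have um n : measurable_fun setT (u n).
  by apply: vmeas_nsq; apply: vmeas_restrict => //; exact: measurable_outer.
have gi : mu.-integrable setT (fun x => (nsq (f x))%:E).
  apply/integrableP; split; first exact: vmeas_nsq.
  by under eq_integral => x _ do rewrite gee0_abs ?lee_fin ?nsq_ge0 //.
have z0 : nsq (0 : V) = 0.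
  by rewrite /nsq big1 // => i _; rewrite big1 // => im _; rewrite coordinate0 expr0n.
have ptw : {ae mu, forall x, setT x -> u n x @[n --> \oo] --> (0 : \bar R)%E}.
  apply/aeW => x _; apply: cvg_near_cst.
  near=> n; rewrite /u; have -> : (x \in outer (n%:R * T)) = false; last by rewrite mulr0n z0.
  apply/negbTE; rewrite outerP -ltNge ltr_pdivlMr // -ltr_pdivrMr //.
  by near: n; exact: nbhs_infty_gtr.
have dom : {ae mu, forall x, forall n, setT x -> (`|u n x| <= (nsq (f x))%:E)%E}.
  apply/aeW => x n _; rewrite gee0_abs ?lee_fin ?nsq_ge0 // /u.
  by case: (x \in _); rewrite ?mulr1n // mulr0n z0 nsq_ge0.
have [_ _] := @dominated_convergence _ _ _ mu setT measurableT u (fun=> 0%E) _ um (measurable_cst 0%E) ptw gi dom.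
rewrite integral0; apply: cvg_trans; apply: near_eq_cvg; apply: nearW => n /=.
by rewrite -energy_restrict //; exact: measurable_outer.
Unshelve. all: by end_near. Qed.

End Versions.

(** * Jets of periodized functions *)

Section PeriodizedJets.
Context {R : realType} {s : scalars} {m : nat}.
Local Notation F := (scalar_field R s).
Local Notation V := 'cV[F]_m.
Local Notation mu := (@lebesgue_measure R).
Implicit Types (f g u : R -> V).

Lemma leib_ext j eta (J J' : nat -> R -> V) (x : R) : (forall i, J i x = J' i x) ->
  leib j eta J x = leib j eta J' x.
Proof.
elim: j eta J J' => [|j IH] eta J J' JJ /=; first by rewrite JJ.
by congr (_ + _); apply: IH => // i; exact: JJ.
Qed.

Variables (k : nat) (p : R) (eta : R -> R) (J : nat -> R -> V).
Hypothesis k_gt0 : (0 < k)%N.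
Hypothesis p_gt0 : 0 < p.
Hypothesis eta_smooth : smooth eta.
Hypothesis eta_supp : forall i x, 3 / 4 * p <= `|x| -> derive1n i eta x = 0.
Hypothesis eta_le : forall i x, (i <= k)%N -> `|derive1n i eta x| <= 1.
Hypothesis J_locint : vlocint (J 0%N).
Hypothesis J_chain : vchain k J.

Lemma leib_vchain : vchain k (fun j => leib j eta J).
Proof. by move=> j jk; apply: leib_vder => // i ij; apply: J_chain; exact: leq_ltn_trans jk. Qed.

Lemma leib_supp34 j : supp34 p (leib j eta J).
Proof. by move=> x xp; apply: leib_eq0 => i _; exact: eta_supp. Qed.

Lemma leib0_vlocint : vlocint (leib 0 eta J).
Proof. exact: (vder_vlocint (leib_vchain k_gt0)).1. Qed.

Lemma per_leib_vchain : vchain k (fun j => per p (leib j eta J)).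
Proof. by move=> j jk; apply: vder_per => //; [exact: leib_vchain|exact: leib_supp34..]. Qed.

Lemma per_leib0_vlocint : vlocint (per p (leib 0 eta J)).
Proof. exact: (vder_vlocint (per_leib_vchain k_gt0)).1. Qed.

Definition leibc : R := (1 * 2 ^+ k) ^+ 2 * 2 ^+ k.+1 * @n1c R m.

Lemma leibc_ge0 : 0 <= leibc.
Proof. by rewrite /leibc mulr_ge0 ?n1c_ge0 // mulr_ge0 ?sqr_ge0 ?exprn_ge0. Qed.

Lemma leib_energy j : (j <= k)%N ->
  (energy setT (leib j eta J) <= leibc%:E * \sum_(i < k.+1) energy setT (J i))%E.
Proof.
move=> jk.
pose t i : R -> V := if (i <= k)%N then J i else fun=> 0.
have Jm i : (i <= k)%N -> vmeas (J i) by move=> ik; exact: vlocint_vmeas (vchain_vlocint J_locint J_chain ik).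
have tm i : vmeas (t i) by rewrite /t; case: ifPn => [/Jm|_] //; exact: vmeas0.
have lm : vmeas (leib j eta J) by apply: leib_vmeas => // i ij; apply: Jm; exact: leq_trans jk.
have C0 : 0 <= 1 * 2 ^+ k :> R by rewrite mul1r exprn_ge0.
have := @energy_le_n1 R s m nat (index_iota 0 k.+1) setT _ t _ measurableT C0 lm tm.
rewrite size_iota subn0 -/leibc big_mkord.
have -> : (\sum_(i < k.+1) energy setT (t i) = \sum_(i < k.+1) energy setT (J i))%E.
  by apply: eq_bigr => i _; rewrite /t -ltnS ltn_ord.
apply; apply/aeW => x _.
have le1 : n1 (leib j eta J x) <= 1 * 2 ^+ j * \sum_(i < j.+1) n1 (J i x).
  by apply: leib_le => i ij; apply: eta_le; exact: leq_trans jk.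
apply: (le_trans le1); apply: ler_pM.
- by rewrite mul1r exprn_ge0.
- by apply: sumr_ge0 => i _; exact: n1_ge0.
- by rewrite !mul1r; apply: ler_weXn2l; rewrite ?ler1n.
- apply: (le_trans (partial_jet_sum_le J x jk)); rewrite /jet_sum big_mkord.
  by apply: ler_sum => i _; rewrite /t -ltnS ltn_ord.
Qed.

Definition perc (N : nat) : R := 2 ^+ size (shifts p N) * @n1c R m * (size (shifts p N))%:R.

Lemma perc_ge0 N : 0 <= perc N.
Proof. by rewrite /perc mulr_ge0 // mulr_ge0 ?n1c_ge0 ?exprn_ge0. Qed.

Lemma per_leib_energy (D : set R) N j : measurable D -> (forall x, D x -> `|x| <= N%:R * p + p / 4) ->
  (j <= k)%N ->
  (energy D (per p (leib j eta J)) <= (perc N * leibc)%:E * \sum_(i < k.+1) energy setT (J i))%E.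
Proof.
move=> mD DN jk.
have lm : vmeas (leib j eta J) by exact: vlocint_vmeas (vchain_vlocint leib0_vlocint leib_vchain jk).
have pm : vmeas (per p (leib j eta J)).
  exact: vlocint_vmeas (vchain_vlocint per_leib0_vlocint per_leib_vchain jk).
apply: (le_trans (energy_per_itv p_gt0 mD lm pm (@leib_supp34 j) DN)).
apply: (@le_trans _ _ ((perc N)%:E * (leibc%:E * \sum_(i < k.+1) energy setT (J i)))%E).
  by apply: lee_wpmul2l; [rewrite lee_fin perc_ge0|exact: leib_energy].
by rewrite muleA -EFinM.
Qed.

(** Only finiteness is claimed, so the number N of translates may depend on the interval. *)
Lemma per_leib_fin (a b : R) j : (j <= k)%N ->
  (forall i, (i <= k)%N -> (energy setT (J i) < +oo)%E) ->
  (energy `[a, b]%classic (per p (leib j eta J)) < +oo)%E.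
Proof.
move=> jk Jfin; have [N HN] : exists N : nat, (`|a| + `|b|) / p <= N%:R.
  by exists (Num.bound ((`|a| + `|b|) / p)); apply/ltW/archi_boundP; rewrite divr_ge0 ?addr_ge0 // ltW.
apply: (@le_lt_trans _ _ ((perc N * leibc)%:E * \sum_(i < k.+1) energy setT (J i))%E).
  apply: per_leib_energy => // x; rewrite /= in_itv /= => /andP[ax xb].
  have h : `|a| + `|b| <= N%:R * p by rewrite -ler_pdivrMr.
  have pa := ler_norm (- a); have pb := ler_norm b; rewrite normrN in pa.
  have := normr_ge0 a; have := normr_ge0 b; move: p_gt0 => p0 ? ?.
  by rewrite ler_norml; apply/andP; split; lra.
rewrite lte_mul_pinfty // ?lee_fin ?mulr_ge0 ?perc_ge0 ?leibc_ge0 //.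
by apply/lte_sum_pinfty => i _; apply: Jfin; rewrite -ltnS.
Qed.

End PeriodizedJets.

(** * Continuous jets and the differential operator *)

Section ContinuousJets.
Context {R : realType} {s : scalars} {m : nat}.
Local Notation F := (scalar_field R s).
Local Notation V := 'cV[F]_m.
Local Notation mu := (@lebesgue_measure R).
Variables (B : R -> R) (k : nat).
Hypothesis BS : smooth_step B.
Hypothesis k_gt0 : (0 < k)%N.

Lemma continuous_jet u : (forall j, (j <= k)%N -> has_weak_derivative j u) ->
  exists f : R -> V, [/\ {ae mu, forall x, u x = f x}, vcont f, vprim f (weak_derivative 1 u) &
    vchain k (rejet f (jet u))].
Proof.
move=> hu; have uc := jet_vchain hu; have [f uf fp] := vder_vprim BS (uc 0%N k_gt0).
have [_ l1] := vder_vlocint (uc 0%N k_gt0).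
have fc : vcont f by apply: vprim_vcont fp; exact: l1.
by exists f; split => //; apply: rejet_vchain.
Qed.

Lemma jet_op_diff_op (alpha : nat -> R -> 'M[F]_m) (u f : R -> V) x :
  jet_op k alpha (rejet f (jet u)) x = diff_op k alpha u x.
Proof. by apply: eq_big_nat => -[|j]. Qed.

Lemma diff_op_vchain (alpha : nat -> R -> 'M[F]_m) (J : nat -> R -> V) :
  vlocint (J 0%N) -> vchain k J ->
  {ae mu, forall x, diff_op k alpha (J 0%N) x = jet_op k alpha J x}.
Proof.
move=> J0 Jc.
have : {ae mu, forall x, forall j : 'I_k.+1, weak_derivative j (J 0%N) x = J j x}.
  apply: ae_forall_fin => j; apply: (weak_derivative_ae BS); apply: vchain_weak Jc _ => //.
  by rewrite -ltnS.
apply: ae_imp => x H; apply: eq_big_nat => j /andP[_ jk].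
by have := H (Ordinal jk) => /= ->.
Qed.

Lemma diff_opD (alpha : nat -> R -> 'M[F]_m) (u v : R -> V) :
  (forall j, (j <= k)%N -> has_weak_derivative j u) ->
  (forall j, (j <= k)%N -> has_weak_derivative j v) ->
  {ae mu, forall x, diff_op k alpha (fun x => u x + v x) x = diff_op k alpha u x + diff_op k alpha v x}.
Proof.
move=> hu hv.
have : {ae mu, forall x, forall j : 'I_k.+1, weak_derivative j (fun x => u x + v x) x =
    weak_derivative j u x + weak_derivative j v x}.
  apply: ae_forall_fin => j; apply: (weak_derivative_ae BS).
  by apply: vderD; apply: weak_derivativeP; [apply: hu|apply: hv]; rewrite -ltnS.
apply: ae_imp => x H; rewrite /diff_op -big_split; apply: eq_big_nat => j /andP[_ jk].
by have := H (Ordinal jk) => /= ->; rewrite mulmxDr.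
Qed.

End ContinuousJets.

Section Auxiliary.
Context {R : realType} {s : scalars} {m : nat}.
Local Notation F := (scalar_field R s).
Local Notation V := 'cV[F]_m.

Lemma sum_const_mule (n : nat) (q : \bar R) : (0 <= q)%E -> (\sum_(j < n) q = n%:R%:E * q)%E.
Proof.
move=> q0; elim: n => [|n IH]; first by rewrite big_ord0 mul0e.
by rewrite big_ord_recr /= IH -natr1 EFinD ge0_muleDl ?lee_fin // mul1e.
Qed.

(** Each summand of the lower bound has its purpose: 1 gives p >= 1, M gives M / p <= 1, and the
    last makes the commutator term at most q / 2. *)
Lemma large_period (M c q p : R) : 0 <= M -> 0 <= c -> 0 < q -> 1 + M + c * M * 2 / q <= p ->
  [/\ 1 <= p, 0 <= M / p, M / p <= 1 & c * (M / p) <= q / 2].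
Proof.
move=> M0 c0 q0 big; have x0 : 0 <= c * M * 2 / q.
  by apply: divr_ge0; [rewrite !mulr_ge0|exact: ltW].
have p1 : 1 <= p by lra.
have p0 : 0 < p by lra.
split => //.
- by rewrite divr_ge0 // ltW.
- by rewrite ler_pdivrMr //; lra.
- have : c * M * 2 / q <= p by lra.
  by rewrite mulrA !ler_pdivrMr //; lra.
Qed.

Lemma L2_norm_energy_le (D : set R) (f g : R -> V) (C : R) :
  (L2_norm D f <= C%:E * L2_norm D g)%E -> (energy D f <= (C ^+ 2)%:E * energy D g)%E.
Proof.
rewrite !L2_normE => H.
have h0 : (0 <= (C ^+ 2)%:E * energy D g)%E by rewrite mule_ge0 ?energy_ge0 // lee_fin sqr_ge0.
rewrite -lee_sqrt // sqrteM ?lee_fin ?sqr_ge0 //.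
apply: (le_trans H); rewrite /sqrte sqrtr_sqr.
by apply: lee_wpmul2r; [exact: sqrte_ge0|rewrite lee_fin ler_norm].
Qed.

Lemma vprim_bounded k (J : nat -> R -> V) : (0 < k)%N -> vprim (J 0%N) (J 1%N) ->
  (forall i, (i <= k)%N -> vlocint (J i) /\ (energy setT (J i) < +oo)%E) ->
  exists2 r : R, 0 <= r & forall x, n1 (J 0%N x) <= r.
Proof.
move=> k0 Jp Jf; have [l1 e1] := Jf 1%N k0; have [l0 e0] := Jf 0%N (leq0n k).
pose q := fine (energy setT (J 0%N)) + fine (energy setT (J 1%N)).
have q0 : 0 <= @n1c R m * (2 * q) by rewrite !mulr_ge0 ?n1c_ge0 ?addr_ge0 ?fine_ge0 ?energy_ge0.
exists (@n1c R m * (2 * q) + 1) => [|x]; first by rewrite addr_ge0.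
have le I : vmeas I -> (energy `[x, (x + 1)%R]%classic I <= energy setT I :> \bar R)%E.
  by move=> Im; apply: energy_subset.
have fin1 : (energy `[x, (x + 1)%R]%classic (J 1%N) < +oo)%E.
  by apply: le_lt_trans e1; apply: le; exact: vlocint_vmeas.
have xx : x <= x <= x + 1 by rewrite lexx lerDl ler01.
have H : ((nsq (J 0%N x))%:E <= (2 * q)%:E)%E.
  apply: (le_trans (vsobolev l1 Jp fin1 xx)).
  have -> : (2 * q)%:E = (2%:E * (energy setT (J 0%N) + energy setT (J 1%N)))%E.
    by rewrite EFinM /q [X in (_ * X)%E]EFinD !fineK ?ge0_fin_numE ?energy_ge0.
  rewrite (ge0_muleDr _ (energy_ge0 _ _) (energy_ge0 _ _)).
  by apply: leeD; apply: lee_wpmul2l => //; apply: le; exact: vlocint_vmeas.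
rewrite lee_fin in H; apply: n1_sqr_le H _; first by rewrite addr_ge0.
by rewrite sqrrD1 -[leLHS]addr0; have := sqr_ge0 (@n1c R m * (2 * q)); move: q0; lra.
Qed.

End Auxiliary.

(** * From the problem on the circle to periodic solutions *)

Section Reduction.
Context {R : realType} {s : scalars} {m : nat}.
Local Notation F := (scalar_field R s).
Local Notation V := 'cV[F]_m.
Local Notation mu := (@lebesgue_measure R).
Variables (k : nat) (T : R) (alpha : nat -> R -> 'M[F]_m) (nl : V -> R -> V) (v z : R -> V).
Variables (B : R -> R) (vt zt : R -> V).
Hypothesis k_gt0 : (0 < k)%N.
Hypothesis T_gt0 : 0 < T.
Hypothesis BS : smooth_step B.
Hypothesis alpha_cont : forall j, (1 <= j <= k)%N -> continuous (alpha j).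
Hypothesis alpha_per : forall j, (1 <= j <= k)%N -> periodic (alpha j) T.
Hypothesis alpha_unit : forall x, alpha k x \in unitmx.
Hypothesis nl_cont : continuous (fun p : V * R => nl p.1 p.2).
Hypothesis nl_C2 : twice_C1_in_u nl.
Hypothesis nl_per : forall w, periodic (nl w) T.
Hypothesis v_Hk : in_Hk_per k T v.
Hypothesis z_Hk : in_Hk k z.
Hypothesis v_sol : solution k alpha nl v.
Hypothesis zv_sol : solution k alpha nl (fun x => z x + v x).
Hypothesis zv_nondeg : nondegenerate_state k alpha nl (fun x => z x + v x).
Hypothesis v_vt : {ae mu, forall x, v x = vt x}.
Hypothesis vt_cont : vcont vt.
Hypothesis vt_per : periodic vt T.
Hypothesis z_zt : {ae mu, forall x, z x = zt x}.
Hypothesis zt_cont : vcont zt.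
Hypothesis zt_prim : vprim zt (weak_derivative 1 z).

(** The representatives vt and zt replace v and z here, so that continuity, periodicity and uniform
    bounds hold everywhere and not only almost everywhere. *)
Definition Zjet := rejet zt (jet z).
Definition shifted_nl w x : V := nl (w + vt x) x - nl (vt x) x.
Definition linear_coef x : 'M[F]_m := du_nl nl (zt x + vt x) x.
Local Notation jop := (jet_op k alpha).
Local Notation sol := (solves k alpha linear_coef).

Lemma z_weak j : (j <= k)%N -> has_weak_derivative j z.
Proof. by move=> jk; have [] := z_Hk jk. Qed.

Lemma v_weak j : (j <= k)%N -> has_weak_derivative j v.
Proof. by move=> jk; have [] := v_Hk.2 j jk. Qed.

Lemma rejet_fin (u f : R -> V) i : in_Hk k u -> vcont f -> {ae mu, forall x, u x = f x} -> (i <= k)%N ->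
  vlocint (rejet f (jet u) i) /\ (energy setT (rejet f (jet u) i) < +oo)%E.
Proof.
move=> hu fc uf; have [_ H] := in_Hk_jet BS hu; case: i => [_|i ik]; last exact: (H i.+1 ik).
split; first exact: vcont_vlocint.
have [l e] := H 0%N (leq0n k).
rewrite -(energy_ae measurableT (vlocint_vmeas l) (vcont_vmeas fc)) //.
by apply: ae_imp uf => x.
Qed.

Lemma Z_fin i : (i <= k)%N -> vlocint (Zjet i) /\ (energy setT (Zjet i) < +oo)%E.
Proof. exact: rejet_fin. Qed.

Lemma Z_sol : {ae mu, forall x, jop Zjet x + shifted_nl (Zjet 0%N x) x = 0}.
Proof.
have D := diff_opD BS alpha z_weak v_weak.
have H1 := ae_imp2 (fun x a b => conj a b) D (ae_imp2 (fun x a b => conj a b) v_sol zv_sol).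
have H2 := ae_imp2 (fun x a b => conj a b) v_vt z_zt.
apply: ae_imp2 H1 H2 => x [Dx [vx zvx]] [vv zz].
rewrite jet_op_diff_op /shifted_nl /= -vv -zz.
move: zvx; rewrite Dx => E; rewrite -[RHS]E -{1}[diff_op k alpha z x]addr0 -[in LHS]vx.
apply: coordinate_inj => im i; rewrite !(coordinateD, coordinateN); ring.
Qed.

Lemma shifted_nl_periodic w : periodic (shifted_nl w) T.
Proof. by move=> x; rewrite /shifted_nl vt_per !nl_per. Qed.

Lemma vcontB f g : @vcont R s m f -> vcont g -> vcont (fun x => f x - g x).
Proof.
move=> fc gc im i x; under eq_fun do rewrite coordinateB.
by apply: cvgB; [exact: fc|exact: gc].
Qed.

Lemma shifted_nl_vcont (u : R -> V) : vcont u -> vcont (fun x => shifted_nl (u x) x).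
Proof. by move=> uc; apply: vcontB; apply: nl_vcont => //; exact: vcontD. Qed.

Variables (r0 rv : R).
Hypothesis zt_sup : forall x, n1 (zt x) <= r0.
Hypothesis vt_sup : forall x, n1 (vt x) <= rv.

Lemma n1_shift_le w x : n1 w <= r0 -> n1 (w + vt x) <= r0 + rv.
Proof. by move=> wr; apply: (le_trans (n1D _ _)); exact: lerD. Qed.

Lemma shifted_nl_lip : exists2 L : R, 0 <= L &
  forall w x, n1 w <= r0 -> n1 (shifted_nl w x) <= L * n1 w.
Proof.
have [L L0 HL] := nl_lipschitz T_gt0 nl_C2 nl_per (r0 + rv).
exists L => // w x wr; have := HL (w + vt x) (vt x) x (n1_shift_le x wr).
rewrite addrK; apply; apply: (le_trans (vt_sup x)).
by rewrite lerDr (le_trans _ wr) // n1_ge0.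
Qed.

Lemma shifted_nl_diff (eps : R) : 0 < eps -> exists2 d : R, 0 < d & forall y w w',
  n1 (w - Zjet 0%N y) <= d -> n1 (w' - Zjet 0%N y) <= d ->
  n1 (shifted_nl w y - shifted_nl w' y - linear_coef y *m (w - w')) <= eps * n1 (w - w').
Proof.
move=> e0; have [d d0 Hd] := nl_strictly_differentiable T_gt0 nl_C2 nl_per (r0 + rv) e0.
exists d => // y w w' wd w'd.
have sh (a b : V) : a + vt y - (b + vt y) = a - b.
  by apply: coordinate_inj => im i; rewrite !(coordinateD, coordinateN); ring.
have := Hd (zt y + vt y) (w + vt y) (w' + vt y) y (n1_shift_le y (zt_sup y)).
rewrite !sh => /(_ wd w'd).
have -> // : nl (w + vt y) y - nl (w' + vt y) y = shifted_nl w y - shifted_nl w' y.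
by apply: coordinate_inj => im i; rewrite !(coordinateD, coordinateN); ring.
Qed.

Lemma linear_coef_bounded : exists2 c : R, 0 <= c & forall x, mxbound (linear_coef x) c.
Proof.
have [c c0 Hc] := du_nl_bounded T_gt0 nl_C2 nl_per (r0 + rv).
by exists c => // x; apply: Hc; exact: n1_shift_le.
Qed.

Lemma linearization_ae phi f : {ae mu, forall x, phi x = f x} ->
  {ae mu, forall x, linearization k alpha nl (fun x => z x + v x) phi x =
    diff_op k alpha phi x + linear_coef x *m f x}.
Proof.
move=> pf; have H2 := ae_imp2 (fun x a b => conj a b) v_vt z_zt.
by apply: ae_imp2 pf H2 => x pfx [vv zz]; rewrite /linearization /linear_coef pfx vv zz.
Qed.

Lemma solves_exists f : vmeas f -> (energy setT f < +oo)%E -> exists W, sol W f.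
Proof.
move=> fm fe; have [_ ex _ _] := zv_nondeg.
have [phi hphi Lphi] := ex f ((L2P f).2 (conj fm fe)).
have [g [pg gc gp gch]] := continuous_jet BS k_gt0 (fun j jk => (hphi j jk).1).
exists (rejet g (jet phi)); split => //.
  by move=> i ik; exact: rejet_fin.
apply: ae_imp2 Lphi (linearization_ae pg) => x <- ->.
by rewrite jet_op_diff_op.
Qed.

(** Entry 0 of any solution jet lies in H^k, so the L^2 bound of nondegeneracy applies to every
    solution. Its constant appears squared because energies are squared norms. *)
Lemma inverse_bounded : exists2 CG : R, 0 <= CG & forall W f,
  vmeas f -> (energy setT f < +oo)%E -> sol W f ->
  (\sum_(i < k.+1) energy setT (W i) <= CG%:E * energy setT f)%E.
Proof.
have [L2l _ _ [C HC]] := zv_nondeg.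
have [ca ca0 Hca] := periodic_mxbound_all T_gt0 alpha_cont alpha_per.
have [cb cb0 Hcb] := linear_coef_bounded.
have kk : (1 <= k <= k)%N by rewrite k_gt0 leqnn.
have [kp kp0 Hkp] := periodic_inverse_bound T_gt0 (alpha_cont kk) (alpha_per kk) alpha_unit.
have [CG CG0 HCG] := inverse_bound Hca Hcb Hkp k_gt0 BS ca0 cb0 kp0 (sqr_ge0 C).
exists CG => // W f fm fe [Wl Wc Wp Wf].
have W0 := (Wl 0%N (leq0n k)).1.
have hW := vchain_in_Hk BS W0 Wc (fun j jk => (Wl j jk).2).
apply: HCG => // [i ik|]; first exact: (Wl i ik).2.
have [lm _] := (L2P _).1 (L2l _ hW).
have -> : energy setT f = energy setT (linearization k alpha nl (fun x => (z x + v x)%R) (W 0%N)).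
  apply: energy_ae => //.
  have e1 := @linearization_ae (W 0%N) (W 0%N) (aeW _ (fun x => erefl)).
  have e2 := ae_imp2 (fun x a b => conj a b) e1 (diff_op_vchain BS alpha W0 Wc).
  by apply: ae_imp2 Wf e2 => x <- [-> ->] _.
by apply: L2_norm_energy_le; exact: HC.
Qed.

(** The Sobolev inequality is used on an interval of length 1 with endpoint y pointing away from 0,
    which stays in the tail set. *)
Lemma Z_tail_nsq (p y : R) : 0 < p -> p / 6 <= `|y| ->
  ((nsq (Zjet 0%N y))%:E <= 2%:E * tail_energy k Zjet p)%E.
Proof.
move=> p0 py; have [l1 e1] := Z_fin k_gt0; have [l0 e0] := Z_fin (leq0n k).
have [a [ay sub]] : exists a, a <= y <= a + 1 /\ `[a, a + 1]%classic `<=` outer p.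
  have io x : p / 6 <= `|x| -> outer p x by move=> h; apply/set_mem; rewrite outerP.
  move: py; case: (ler0P y) => y0 py; [exists (y - 1)|exists y]; split; try lra.
    move=> x; rewrite /= in_itv /= => /andP[h1 h2]; apply: io; rewrite ler0_norm; lra.
  move=> x; rewrite /= in_itv /= => /andP[h1 h2]; apply: io; rewrite ger0_norm; lra.
have le J : vmeas J -> (energy `[a, (a + 1)%R]%classic J <= energy (outer p) J :> \bar R)%E.
  by move=> Jm; apply: energy_subset => //; exact: measurable_outer.
have fin1 : (energy `[a, (a + 1)%R]%classic (Zjet 1%N) < +oo)%E.
  by apply: le_lt_trans e1; apply: energy_subset => //; exact: vlocint_vmeas.
apply: (le_trans (vsobolev l1 zt_prim fin1 ay)).
apply: (@le_trans _ _ (2%:E * (energy (outer p) (Zjet 0%N) + energy (outer p) (Zjet 1%N)))%E).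
  rewrite (ge0_muleDr _ (energy_ge0 _ _) (energy_ge0 _ _)).
  by apply: leeD; apply: lee_wpmul2l => //; apply: le; exact: vlocint_vmeas.
apply: lee_wpmul2l => //; exact: energy01_le.
Qed.


(** * The periodic solution for one multiple of the period *)

Section AtMultiple.
Variables (n : nat) (chi : R -> R) (W : nat -> R -> V) (f : R -> V).
Hypothesis n_gt0 : (0 < n)%N.
Hypothesis chiP : cutoff k T n chi.
Local Notation p := (n%:R * T).
Local Notation hat := (cut_off T n chi).
Local Notation eta := (bump B p).
Hypothesis eta_le : forall i x, (i <= k)%N -> `|derive1n i eta x| <= 1.
Hypothesis W_sol : sol W f.
Hypothesis W_res : {ae mu, forall x, x \in cell p ->
  residual k alpha shifted_nl Zjet p hat eta W x = 0}.

Definition correction : R -> V := per p (leib 0 eta W).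
(** Here z and v are the given functions and not their representatives, because the formula for the
    solution has to hold at every point of the cell. *)
Definition periodic_solution x : V := per p (leib 0 hat (jet z)) x + v x + correction x.

Let p0 : 0 < p := period_gt0 T_gt0 n_gt0.

Let hat_supp i x : 3 / 4 * p <= `|x| -> derive1n i hat x = 0.
Proof. by move=> h; apply: (derive1n_cut_off_zero chiP); move: p0; lra. Qed.

Let eta_supp i x : 3 / 4 * p <= `|x| -> derive1n i eta x = 0.
Proof. by move=> h; apply: derive1n_bump_zero => //; move: p0; lra. Qed.

Let hat_smooth : smooth hat := smooth_cut_off T_gt0 n_gt0 chiP.
Let eta_smooth : smooth eta := @smooth_bump _ B BS p.
Let hat_le i x : (i <= k)%N -> `|derive1n i hat x| <= 1.
Proof. by move=> ik; apply: (cut_off_le T_gt0 n_gt0 chiP). Qed.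

Let W_locint : vlocint (W 0%N).
Proof. by have [Wl _ _ _] := W_sol; exact: (Wl 0%N (leq0n k)).1. Qed.

Let W_chain : vchain k W.
Proof. by have [_ Wc _ _] := W_sol. Qed.

Let W_fin i : (i <= k)%N -> (energy setT (W i) < +oo)%E.
Proof. by have [Wl _ _ _] := W_sol => ik; exact: (Wl i ik).2. Qed.

Let z_jet := in_Hk_jet BS z_Hk.

Let z_locint : vlocint (jet z 0%N) := (z_jet.2 0%N (leq0n k)).1.

Let hat_chain := per_leib_vchain p0 hat_smooth hat_supp z_jet.1.
Let eta_chain := per_leib_vchain p0 eta_smooth eta_supp W_chain.
Let hat_locint := per_leib0_vlocint k_gt0 p0 hat_smooth hat_supp z_jet.1.
Let eta_locint := per_leib0_vlocint k_gt0 p0 eta_smooth eta_supp W_chain.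

Lemma correction_Hk_per : in_Hk_per k p correction.
Proof.
split; first by move=> x; apply: per_periodic => //; exact: leib_supp34.
apply: (vchain_in_Hk_loc (J := fun j => per p (leib j eta W)) BS) => //.
by move=> j a b jk; exact: (per_leib_fin k_gt0 p0 eta_smooth eta_supp eta_le W_locint W_chain a b jk W_fin).
Qed.

Definition sol_jet j x : V := per p (leib j hat (jet z)) x + jet v j x + per p (leib j eta W) x.

Lemma sol_jet_vchain : vchain k sol_jet.
Proof.
move=> j jk; apply: vderD; last exact: eta_chain.
by apply: vderD; [exact: hat_chain|exact: (jet_vchain v_weak)].
Qed.

Lemma sol_jet_locint : vlocint (sol_jet 0%N).
Proof. exact: (vder_vlocint (sol_jet_vchain k_gt0)).1. Qed.

Lemma jet_v_fin (a b : R) j : (j <= k)%N -> (energy `[a, b]%classic (jet v j) < +oo)%E.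
Proof.
move=> jk; have [hj L2j] := v_Hk.2 j jk.
have [_ wl] := vder_vlocint (weak_derivativeP hj).
have [_ jl] := in_Hk_loc_jet BS v_Hk.2.
have jl' := vlocint_vmeas (jl j jk).
rewrite -(@energy_ae _ _ _ _ (weak_derivative j v)) //.
- by apply/L2_energy => //; exact: vlocint_vmeas.
- exact: vlocint_vmeas.
- by apply: ae_imp (jet_ae BS v_weak jk) => x.
Qed.

Lemma periodic_solution_Hk_per : in_Hk_per k p periodic_solution.
Proof.
split.
  move=> x; rewrite /periodic_solution (periodic_mul n v_Hk.1) correction_Hk_per.1.
  by rewrite per_periodic //; exact: leib_supp34.
apply: (vchain_in_Hk_loc (J := sol_jet) BS sol_jet_locint sol_jet_vchain) => j a b jk.
have [_ jl] := in_Hk_loc_jet BS v_Hk.2.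
have vm := vlocint_vmeas (jl j jk).
have hm : vmeas (per p (leib j hat (jet z))).
  exact: vlocint_vmeas (vchain_vlocint hat_locint hat_chain jk).
have em : vmeas (per p (leib j eta W)).
  exact: vlocint_vmeas (vchain_vlocint eta_locint eta_chain jk).
have hf : (energy `[a, b]%classic (per p (leib j hat (jet z))) < +oo)%E.
  apply: (per_leib_fin k_gt0 p0 hat_smooth hat_supp hat_le z_locint z_jet.1 a b jk) => i ik.
  exact: (z_jet.2 i ik).2.
have ef := per_leib_fin k_gt0 p0 eta_smooth eta_supp eta_le W_locint W_chain a b jk W_fin.
have vf := jet_v_fin a b jk.
have two (e1 e2 : \bar R) : (0 <= e1 -> 0 <= e2 -> e1 < +oo -> e2 < +oo -> 2%:E * e1 + 2%:E * e2 < +oo)%E.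
  by move=> h1 h2 h3 h4; rewrite lte_add_pinfty // lte_mul_pinfty // ge0_fin_numE.
have hv : (energy `[a, b]%classic (fun x => (per p (leib j hat (jet z)) x + jet v j x)%R) < +oo)%E.
  by apply: (le_lt_trans (energyD_le _ hm vm)) => //; apply: two => //; exact: energy_ge0.
apply: (le_lt_trans (energyD_le _ (vmeasD hm vm) em)) => //.
by apply: two => //; exact: energy_ge0.
Qed.

Let in_cell x : - (p / 2) <= x < p / 2 -> x \in cell p.
Proof. by rewrite cellP. Qed.

Let per_cell (g : R -> V) x : supp34 p g -> x \in cell p -> per p g x = tsum p 1 g x.
Proof.
move=> gs; rewrite cellP => /andP[h1 h2]; apply: per_tsum => //; rewrite mul1r ler_norml.
by apply/andP; split; move: p0 h1 h2; lra.
Qed.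

Let per_hat_cell j x (J : nat -> R -> V) : x \in cell p -> per p (leib j hat J) x = leib j hat J x.
Proof.
move=> xc; rewrite per_cell //; last exact: leib_supp34.
rewrite /tsum shifts1 big_cons big_cons big_seq1 addr0.
have out c : c \in shifts p 1 -> c != 0 -> leib j hat J (x + c) = 0.
  move=> cs c0; have [_ far] := shift_cell xc cs c0.
  by apply: leib_eq0 => i _; apply: (derive1n_cut_off_zero chiP); move: p0; lra.
by rewrite !out ?add0r // ?shifts1 ?inE ?eqxx ?orbT // ?oppr_eq0 mul1r gt_eqF.
Qed.

Lemma periodic_solutionE x : - (p / 2) <= x < p / 2 ->
  periodic_solution x = of_real s (chi x) *: z x + v x + correction x.
Proof.
move=> xp; rewrite /periodic_solution per_hat_cell ?in_cell //=; congr (of_real s _ *: _ + _ + _).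
rewrite /cut_off ifT // ler_norml; move: xp => /andP[-> /ltW ->] //.
Qed.

(** The left-hand side of the equation satisfied by the deviation from v, written with periodic
    functions: it is p-periodic and coincides with [residual] on the cell almost everywhere. *)
Let periodic_part x : V :=
  jop (fun j x => per p (leib j hat (jet z)) x + per p (leib j eta W) x) x +
  shifted_nl (per p (leib 0 hat (jet z)) x + per p (leib 0 eta W) x) x.

Let periodic_partP x : periodic_part (x + p) = periodic_part x.
Proof.
have hp j := @per_periodic R p p0 s m (leib j hat (jet z)) x (leib_supp34 _ hat_supp j).
have ep j := @per_periodic R p p0 s m (leib j eta W) x (leib_supp34 _ eta_supp j).
rewrite /periodic_part !hp !ep (periodic_mul n (shifted_nl_periodic _)); congr (_ + _).
by apply: eq_big_nat => j jk; rewrite hp ep (periodic_mul n (alpha_per jk)).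
Qed.

Let periodic_part_ae : {ae mu, forall x, periodic_part x = 0}.
Proof.
apply: (ae_periodic p0); first by move=> x; rewrite periodic_partP.
apply: ae_imp2 W_res z_zt => x res zz /in_cell xc.
have jz i : jet z i x = Zjet i x by case: i.
have hE j : per p (leib j hat (jet z)) x = leib j hat Zjet x.
  by rewrite per_hat_cell //; apply: leib_ext.
have eE j : per p (leib j eta W) x = tsum p 1 (leib j eta W) x.
  by rewrite per_cell //; exact: leib_supp34.
rewrite -[RHS](res xc) /periodic_part /residual !hE !eE; congr (_ + _).
by apply: eq_big_nat => j _; rewrite hE eE.
Qed.

Lemma periodic_solution_solves : solution k alpha nl periodic_solution.
Proof.
have h1 := ae_imp2 (fun x a b => conj a b) periodic_part_ae
  (diff_op_vchain BS alpha sol_jet_locint sol_jet_vchain).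
have h2 := ae_imp2 (fun x a b => conj a b) v_sol v_vt.
apply: ae_imp2 h1 h2 => x [P0 D] [vs vv].
have -> : diff_op k alpha periodic_solution x = jop sol_jet x by exact: D.
have -> : jop sol_jet x =
    jop (fun j x => per p (leib j hat (jet z)) x + per p (leib j eta W) x) x + diff_op k alpha v x.
  rewrite /jet_op /diff_op -big_split; apply: eq_big_nat => j /andP[j0 _].
  rewrite /= -mulmxDr; congr (_ *m _); rewrite /sol_jet addrAC.
  by case: j j0.
move: P0; rewrite /periodic_part /shifted_nl -vv => P0.
have -> : periodic_solution x = per p (leib 0 hat (jet z)) x + per p (leib 0 eta W) x + v x.
  by rewrite /periodic_solution addrAC.
move: P0 vs; move: (jop _ x) (nl _ x) (nl (v x) x) (diff_op k alpha v x) => a b c d P0 vs.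
rewrite -[RHS]P0 -[RHS]addr0 -[in RHS]vs.
apply: coordinate_inj => im i; rewrite !(coordinateD, coordinateN); ring.
Qed.

(** One period is covered by N = 1, that is, by three translates, so the constant does not depend on
    n; k.+1 counts the derivatives. *)
Lemma correction_norm : (Hk_per_norm k p correction <=
  sqrte ((k.+1%:R * (2 ^+ 3 * @n1c R m * 3 * @leibc R m k))%:E * \sum_(i < k.+1) energy setT (W i)))%E.
Proof.
rewrite /Hk_per_norm (Hk_norm_vchain (J := fun j => per p (leib j eta W)) BS) //.
set S := (\sum_(i < k.+1) energy setT (W i))%E.
have S0 : (0 <= S)%E by apply: sume_ge0 => i _; exact: energy_ge0.
have c0 : 0 <= 2 ^+ 3 * @n1c R m * 3 * @leibc R m k.
  by rewrite mulr_ge0 ?leibc_ge0 // mulr_ge0 // mulr_ge0 ?n1c_ge0 // exprn_ge0.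
rewrite lee_sqrt; last by rewrite mule_ge0 // lee_fin mulr_ge0.
apply: (@le_trans _ _ (\sum_(j < k.+1) (2 ^+ 3 * @n1c R m * 3 * @leibc R m k)%:E * S)%E).
  apply: lee_sum => j _.
  apply: (per_leib_energy (N := 1) k_gt0 p0 eta_smooth eta_supp eta_le W_locint W_chain) => //.
    by move=> x; rewrite /= in_itv /= mul1r => /andP[h1 h2]; rewrite ger0_norm; move: p0; lra.
  by rewrite -ltnS.
by rewrite sum_const_mule ?mule_ge0 // muleA -EFinM.
Qed.

End AtMultiple.

(** * Choice of the constants and decay of the tail *)

Variable chi : nat -> R -> R.
Hypothesis chi_cutoff : \forall n \near \oo, cutoff k T n (chi n).

Definition tail (n : nat) : \bar R := tail_energy k Zjet (n%:R * T).

Lemma tail_ge0 n : (0 <= tail n)%E.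
Proof. by apply: sume_ge0 => i _; exact: energy_ge0. Qed.

Lemma tail_lty n : (tail n < +oo)%E.
Proof.
apply/lte_sum_pinfty => i _; have [l e] := @Z_fin i (ltn_ord i).
apply: le_lt_trans e; apply: energy_subset => //; first exact: measurable_outer.
exact: vlocint_vmeas.
Qed.

Lemma tail_cvg : tail n @[n --> \oo] --> (0 : \bar R)%E.
Proof.
have -> : (0 : \bar R)%E = (\sum_(i < k.+1) (0 : \bar R))%E by rewrite big1.
apply: cvg_nnesum => i _; first by apply: nearW => n; exact: energy_ge0.
have [l e] := @Z_fin i (ltn_ord i).
by apply: energy_tail_cvg => //; exact: vlocint_vmeas.
Qed.

Lemma Hk_norm_tail n :
  Hk_norm k (~` `](- (n%:R / 6 * T))%R, (n%:R / 6 * T)%R[) z = sqrte (tail n).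
Proof.
have -> : ~` `](- (n%:R / 6 * T))%R, (n%:R / 6 * T)%R[ = outer (n%:R * T).
  by rewrite /outer (_ : n%:R / 6 * T = n%:R * T / 6) //; ring.
have [zc zf] := in_Hk_jet BS z_Hk; have z0 := (zf 0%N (leq0n k)).1.
rewrite (Hk_norm_vchain (J := jet z) BS _ z0 zc); last exact: measurable_outer.
congr sqrte; apply: eq_bigr => -[[|i] ik] _ //=.
apply: energy_ae; [exact: measurable_outer|exact: vlocint_vmeas|exact: vcont_vmeas|].
by apply: ae_imp z_zt => x.
Qed.

Lemma near_tail_le (t : R) : 0 < t -> \forall n \near \oo, (tail n <= t%:E)%E.
Proof.
move=> t0; have /fine_cvgP[_ /cvgrPdist_lt/(_ _ t0)] := tail_cvg.
apply: filterS => n; rewrite /= sub0r normrN ger0_norm ?fine_ge0 ?tail_ge0 // => h.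
by rewrite -[tail n]fineK ?ge0_fin_numE ?tail_ge0 ?tail_lty // lee_fin ltW.
Qed.

Lemma eventually_periodic_solution : exists2 C : R, 0 < C & \forall n \near \oo,
  exists u a : R -> V, [/\ in_Hk_per k (n%:R * T) u, solution k alpha nl u,
    in_Hk_per k (n%:R * T) a,
    forall x, - (n%:R * T / 2) <= x < n%:R * T / 2 -> u x = of_real s (chi n x) *: z x + v x + a x &
    (Hk_per_norm k (n%:R * T)%R a <= C%:E * sqrte (tail n))%E].
Proof.
have [ca ca0 Hca] := periodic_mxbound_all T_gt0 alpha_cont alpha_per.
have [CG CG0 HCG] := inverse_bounded.
have [L L0 HL] := shifted_nl_lip.
have [M M0 HM] := bump1_bounded BS k.
(* A solution is chosen for every f; the zero jet is a dummy value when f is not square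
   integrable. *)
have /choice[G HG] : forall f : R -> V, exists W, vmeas f -> (energy setT f < +oo)%E -> sol W f.
  move=> f; case: (pselect (vmeas f /\ (energy setT f < +oo)%E)) => [[fm fe]|nf].
    by have [W HW] := solves_exists fm fe; exists W.
  by exists (fun _ _ => 0) => fm fe; case: nf.
pose c1 := 2 ^+ (3 * k.+1) * @n1c R m * 3 * CG.
have c10 : 0 <= c1.
  by rewrite /c1 mulr_ge0 // mulr_ge0 // mulr_ge0 ?n1c_ge0 // exprn_ge0.
(* The contraction factor will be at most q^2 c1, and q^2 c1 = c1 / (16 (c1 + 1)^2) <= 1/16. Half of
   q goes to the linearization error, half to the commutator. *)
pose q := (4 * (c1 + 1))^-1.
have q0 : 0 < q by rewrite invr_gt0 mulr_gt0 // ltr_wpDl.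
have qc1 : q ^+ 2 * c1 <= 16^-1.
  have d0 : 0 < c1 + 1 by rewrite ltr_wpDl.
  rewrite /q invfM exprMn -mulrA (_ : 4^-1 ^+ 2 = 16^-1 :> R); last by field.
  rewrite ler_piMr ?invr_ge0 // exprVn mulrC ler_pdivrMr ?exprn_gt0 // mul1r.
  by have := sqr_ge0 c1; rewrite sqrrD1; move: c10; lra.
have e0 : 0 < q / 2 by rewrite divr_gt0.
have [delta delta0 Hdelta] := shifted_nl_diff e0.
(* Used both for sigma and for zs, so that three sigma plus zs is exactly delta. *)
pose sg := delta / 4.
have sg0 : 0 < sg by rewrite divr_gt0.
(* Naming the constants through an existential hides their definitions from the arithmetic
   tactics. *)
have [jc jcE] : exists jc : R, jc = @jetc R m k ca by exists (@jetc R m k ca).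
have jc0 : 0 <= jc by rewrite jcE; exact: jetc_ge0.
have [Rc RcE] : exists Rc : R, Rc = @residc R m k ca L by exists (@residc R m k ca L).
have Rc0 : 0 <= Rc by rewrite RcE; exact: residc_ge0.
(* A sum of two constants, so that one threshold t0 makes both the corrections and the tail of Z at
   most sg. *)
pose D := @n1c R m * (2 * CG * (4 * (2 * Rc))) + @n1c R m * 2.
have D10 : 0 <= @n1c R m * (2 * CG * (4 * (2 * Rc))).
  apply: mulr_ge0; first exact: n1c_ge0.
  by apply: mulr_ge0; [exact: mulr_ge0|apply: mulr_ge0 => //; exact: mulr_ge0].
have D20 : 0 <= @n1c R m * 2 by rewrite mulr_ge0 ?n1c_ge0.
pose t0 := sg ^+ 2 / (D + 1).
have Dp : 0 < D + 1 by rewrite ltr_wpDl // addr_ge0.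
have t00 : 0 < t0 by rewrite divr_gt0 // exprn_gt0.
have small (c t : R) : 0 <= c -> c <= D -> t <= t0 -> c * t <= sg ^+ 2.
  move=> c0 cD tt; apply: (le_trans (ler_wpM2l c0 tt)); rewrite /t0 mulrA ler_pdivrMr //.
  by rewrite mulrC ler_wpM2l ?sqr_ge0 //; move: cD; lra.
pose C2 := k.+1%:R * (2 ^+ 3 * @n1c R m * 3 * @leibc R m k).
have C20 : 0 <= C2.
  by rewrite /C2 mulr_ge0 // mulr_ge0 ?leibc_ge0 // mulr_ge0 // mulr_ge0 ?n1c_ge0 // exprn_ge0.
pose C3 := C2 * (CG * (8 * Rc)).
have C30 : 0 <= C3 by apply: mulr_ge0 => //; apply: mulr_ge0 => //; exact: mulr_ge0.
(* C3 collects the periodization constant, the inverse bound and the size 8 Rc of the source; 1 is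
   added for strict positivity. *)
exists (Num.sqrt C3 + 1); first by rewrite ltr_wpDl ?sqrtr_ge0.
near=> n.
have n0 : (0 < n)%N by near: n; exact: nbhs_infty_gt.
have cn : cutoff k T n (chi n) by near: n.
have tn : (tail n <= t0%:E)%E by near: n; exact: near_tail_le.
have nbig : (1 + M + jc * M * 2 / q) / T <= n%:R by near: n; exact: nbhs_infty_ger.
pose p := n%:R * T; have p0 : 0 < p := period_gt0 T_gt0 n0.
have pbig : 1 + M + jc * M * 2 / q <= p by rewrite -ler_pdivrMr.
have [p1 Mp0 Mp jM] := large_period M0 jc0 q0 pbig.
pose t := fine (tail n).
have tE : tail n = t%:E by rewrite /t fineK // ge0_fin_numE ?tail_ge0 ?tail_lty.
have t_ge0 : 0 <= t by rewrite /t fine_ge0 ?tail_ge0.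
have tt0 : t <= t0 by move: tn; rewrite tE lee_fin.
have eta_small i x : (0 < i <= k)%N -> `|derive1n i (bump B p) x| <= M / p.
  by apply: bump_small.
have eta_le i x : (i <= k)%N -> `|derive1n i (bump B p) x| <= 1.
  case: i => [_|i ik]; last by apply: (le_trans (eta_small i.+1 x ik)).
  by have /andP[b0 b1] := bump01 BS p x; rewrite ger0_norm.
have Zt y : p / 6 <= `|y| -> n1 (Zjet 0%N y) <= sg.
  move=> yp; have := Z_tail_nsq p0 yp; rewrite -/(tail n) tE -EFinM lee_fin => H.
  apply: n1_sqr_le H _; first exact: ltW.
  by rewrite mulrA; apply: small => //; rewrite /D lerDr.
have := @corrected_solution R s m k alpha linear_coef shifted_nl Zjet ca
  k_gt0 ca0 Hca p (cut_off T n (chi n)) (bump B p) (M / p) delta sg sg (q / 2) p0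
  (fun j jk => periodic_mul n (alpha_per jk)) (fun w => periodic_mul n (shifted_nl_periodic w))
  (@smooth_bump _ B BS p) Mp0 eta_small (bump01 BS p) (bump_one BS p0) (bump_zero BS p0)
  (cut_off01 cn) (cut_off_one T_gt0 n0 cn) (cut_off_zero cn) Hdelta Zt (ltW sg0) (ltW sg0) (ltW e0)
  _ r0 L CG G (fun j jk => continuous_mmeas (alpha_cont jk)) shifted_nl_vcont L0 HL zt_sup Z_fin
  zt_cont Z_sol (smooth_cut_off T_gt0 n0 cn) (fun i x ik => cut_off_le T_gt0 n0 cn x ik) CG0 HG HCG
  t t_ge0 _ _ _.
rewrite -RcE; case=> [||||W [b [bm be sW res]]]; last first.
- exists (periodic_solution n (chi n) W), (correction n W); split.
  + exact: (periodic_solution_Hk_per n0 cn eta_le sW).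
  + exact: (periodic_solution_solves n0 cn sW res).
  + exact: (correction_Hk_per n0 eta_le sW).
  + by move=> x xp; apply: periodic_solutionE.
  + apply: (le_trans (correction_norm n0 eta_le sW)).
    have Wn : (\sum_(i < k.+1) energy setT (W i) <= (CG * (8 * Rc) * t)%:E)%E.
      have bf : (energy setT b < +oo)%E by apply: (le_lt_trans be); exact: ltry.
      apply: (le_trans (HCG W b bm bf sW)); apply: (le_trans (lee_wpmul2l _ be)) => //.
      by rewrite -EFinM lee_fin !mulrA.
    apply: (@le_trans _ _ (sqrte (C3 * t)%:E)).
      rewrite lee_sqrt ?lee_fin ?mulr_ge0 //.
      apply: (@le_trans _ _ (C2%:E * (CG * (8 * Rc) * t)%:E)%E).
        by apply: lee_wpmul2l => //; rewrite lee_fin.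
      have -> : C3 * t = C2 * (CG * (8 * Rc) * t) by rewrite /C3 -mulrA.
      by rewrite -EFinM.
    by rewrite tE /= -EFinM lee_fin sqrtrM // ler_wpM2r ?sqrtr_ge0 // lerDl ler01.
- have -> : @n1c R m * (2 * CG * (4 * (2 * Rc * t))) = @n1c R m * (2 * CG * (4 * (2 * Rc))) * t by ring.
  by apply: small => //; rewrite /D lerDl.
- have -> : contractc (m := m) k ca (M / p) (q / 2) * CG = (q / 2 + jc * (M / p)) ^+ 2 * c1.
    by rewrite /contractc -jcE /c1; ring.
  apply: le_trans qc1; apply: ler_wpM2r => //.
  have u0 : 0 <= q / 2 + jc * (M / p) by apply: addr_ge0; [exact: ltW|exact: mulr_ge0].
  apply: sqr_le_norm; rewrite ger0_norm //.
  by rewrite [leRHS]splitr lerD2l.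
- by rewrite -/(tail n) tE.
- by rewrite /sg; lra.
Unshelve. all: by end_near. Qed.

End Reduction.

Theorem theorem4p1 (R : realType) (s : scalars) (k m : nat) (T : R)
    (alpha : nat -> R -> 'M[scalar_field R s]_m)
    (nl : 'cV[scalar_field R s]_m -> R -> 'cV[scalar_field R s]_m)
    (chi : nat -> R -> R) (v z : R -> 'cV[scalar_field R s]_m)
    (k_gt0 : (0 < k)%N) (m_gt0 : (0 < m)%N) (T_gt0 : 0 < T)
    (alpha_cont : forall j, (1 <= j <= k)%N -> continuous (alpha j))
    (alpha_per : forall j, (1 <= j <= k)%N -> periodic (alpha j) T)
    (alpha_unit : forall x, alpha k x \in unitmx)
    (nl_cont : continuous
       (fun p : 'cV[scalar_field R s]_m * R => nl p.1 p.2))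
    (nl_C2 : twice_C1_in_u nl)
    (nl_per : forall w, periodic (nl w) T)
    (chi_cutoff : \forall n \near \oo, cutoff k T n (chi n))
    (v_Hk : in_Hk_per k T v) (z_Hk : in_Hk k z)
    (v_sol : solution k alpha nl v)
    (zv_sol : solution k alpha nl (fun x => z x + v x))
    (zv_nondeg : nondegenerate_state k alpha nl (fun x => z x + v x)) :
  exists (C : R) (N : nat) (u a : nat -> R -> 'cV[scalar_field R s]_m),
    [/\ 0 < C,
        forall n, (N <= n)%N ->
          [/\ in_Hk_per k (n%:R * T) (u n),
              solution k alpha nl (u n),
              in_Hk_per k (n%:R * T) (a n),
              forall x : R, x \in `[- (n%:R / 2 * T), n%:R / 2 * T[ ->
                u n x = of_real s (chi n x) *: z x + v x + a n x &
              (Hk_per_norm k (n%:R * T)%R (a n) <=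
               C%:E * Hk_norm k (~` `](- (n%:R / 6 * T))%R, (n%:R / 6 * T)%R[) z)%E] &
        Hk_per_norm k (n%:R * T) (a n) @[n --> \oo] --> 0%E].
Proof.
(* A single cutoff, unrelated to the threshold N, provides the smooth step on which the theory of
   weak derivatives rests. *)
have [n0 [n0_gt0 cn0]] : exists n, (0 < n)%N /\ cutoff k T n (chi n).
  near \oo => n; exists n; split; near: n; [exact: nbhs_infty_gt|exact: chi_cutoff].
have BS := smooth_step_of T_gt0 n0_gt0 cn0.
have [zt [z_zt zt_cont zt_prim _]] := continuous_jet BS k_gt0 (fun j jk => (z_Hk j jk).1).
have [vt [v_vt vt_cont _ _]] := continuous_jet BS k_gt0 (fun j jk => (v_Hk.2 j jk).1).
(* Periodicity passes from v to vt almost everywhere, and then everywhere by continuity. *)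
have vt_per : periodic vt T.
  apply: vcont_ae_eq (vcont_addr (c := T) vt_cont) vt_cont _.
  by apply: ae_imp2 (ae_addr T v_vt) v_vt => x <- <-; exact: v_Hk.1.
have [r0 _ zt_sup] := vprim_bounded (J := rejet zt (jet z)) k_gt0 zt_prim
  (fun i ik => rejet_fin BS z_Hk zt_cont z_zt ik).
have [rv _ vt_sup] := vcont_periodic_bounded T_gt0 vt_cont vt_per.
have [C C0 [N _ HN]] := eventually_periodic_solution k_gt0 T_gt0 BS alpha_cont alpha_per alpha_unit
  nl_cont nl_C2 nl_per v_Hk z_Hk v_sol zv_sol zv_nondeg v_vt vt_cont vt_per z_zt zt_cont zt_prim
  zt_sup vt_sup chi_cutoff.
(* The sequences must be defined for all n; below N they are 0. *)
have /choice[ua Hua] n : exists ua : (R -> 'cV[scalar_field R s]_m) * (R -> 'cV[scalar_field R s]_m),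
    (N <= n)%N -> [/\ in_Hk_per k (n%:R * T) ua.1, solution k alpha nl ua.1,
    in_Hk_per k (n%:R * T) ua.2,
    forall x, - (n%:R * T / 2) <= x < n%:R * T / 2 ->
      ua.1 x = of_real s (chi n x) *: z x + v x + ua.2 x &
    (Hk_per_norm k (n%:R * T)%R ua.2 <= C%:E * sqrte (tail k T z zt n))%E].
  have [Nn|nN] := leqP N n; last by exists (fun=> 0, fun=> 0).
  by have [u [a H]] := HN n Nn; exists (u, a).
exists C, N, (fun n => (ua n).1), (fun n => (ua n).2); split; first exact: C0.
  move=> n Nn; have [h1 h2 h3 h4 h5] := Hua n Nn; split => //.
    move=> x; rewrite in_itv /= (_ : n%:R / 2 * T = n%:R * T / 2); last by ring.
    exact: h4.
  by rewrite (Hk_norm_tail T BS z_Hk z_zt zt_cont).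
have tail0 := tail_cvg T_gt0 BS z_Hk z_zt zt_cont.
have bound0 : (C%:E * sqrte (tail k T z zt n))%E @[n --> \oo] --> (0 : \bar R)%E.
  have tn n : tail k T z zt n = (fine (tail k T z zt n))%:E.
    by rewrite fineK // ge0_fin_numE ?tail_ge0 // (tail_lty T BS z_Hk z_zt zt_cont).
  have /fine_cvgP[_ f0] := tail0.
  apply/fine_cvgP; split; first by apply: nearW => n; rewrite tn.
  have -> : fine \o (fun n => C%:E * sqrte (tail k T z zt n))%E =
      fun n => C * Num.sqrt (fine (tail k T z zt n)).
    by apply/funext => n /=; rewrite tn.
  rewrite -[X in _ --> X](mulr0 C) -sqrtr0; apply: cvgMr.
  exact: (cvg_comp _ _ f0 (@sqrt_continuous R 0)).
apply: squeeze_cvge _ (cvg_cst _) bound0.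
near=> n; rewrite sqrte_ge0 /=.
have Nn : (N <= n)%N by near: n; exact: nbhs_infty_ge.
by have [_ _ _ _ ->] := Hua n Nn.
Unshelve. all: by end_near. Qed.
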